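(* Let $I=[0,2\pi]$, $b\in\mathbb R$, $b\neq0$, $a\ge0$. For $m\in\mathbb N$ let $G_m:I\to\mathbb R$, $G_m\in C(I)$, $G_m(0)=G_m(2\pi)$, be such that $G_m\to G$ in $C(I)$ as $m\to\infty$. Let $F:\mathbb R\times I\to\mathbb R$ satisfy Assumption (A) of the context with constants $k,l>0$ and function $h$, and $F(u,0)=F(u,2\pi)$ for all $u\in\mathbb R$. Consider the problems $$-\frac{d^4u_m}{dx^4}+b\frac{du_m}{dx}+au_m+\int_{0}^{2\pi}G_m(x-y)F(u_m(y),y)\,dy=0,\quad x\in I,\ m\in\mathbb N, \qquad (P_m)$$ and the limiting problem $$-\frac{d^4u}{dx^4}+b\frac{du}{dx}+au+\int_{0}^{2\pi}G(x-y)F(u(y),y)\,dy=0,\quad x\in I. \qquad (P)$$ I) If $a>0$, assume that $2\sqrt{\pi}\,\mathcal N_{a,b,m}\,l\le1-\varepsilon$ for all $m\in\mathbb N$ with some fixed $0<\varepsilon<1$. Then each problem $(P_m)$ has a unique solution $u_m\in H^4(I)$, and the limiting problem (P) has a unique solution $u\in H^4(I)$. II) If $a=0$, assume that $\int_0^{2\pi}G_m(x)\,dx=0$ for all $m\in\mathbb N$ and $2\sqrt{\pi}\,\mathcal N_{0,b,m}\,l\le1-\varepsilon$ for all $m\in\mathbb N$ with some fixed $0<\varepsilon<1$. Then each problem $(P_m)$ with $a=0$ has a unique solution $u_m\in H^4_0(I)$, and the limiting problem (P) with $a=0$ has a unique solution $u\in H^4_0(I)$. In both cases, $u_m\to u$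 as $m\to\infty$ in the norm of $H^4(I)$ in case I) and of $H^4_0(I)$ in case II). Moreover, in both cases, the unique solution $u_m$ of $(P_m)$ is not identically zero on $I$ provided that the Fourier coefficients satisfy $G_{m,n}F(0,x)_n\neq0$ for some $n\in\mathbb Z$; likewise, the unique solution $u$ of (P) does not vanish identically on $I$ if $G_nF(0,x)_n\neq0$ for some $n\in\mathbb Z$.
   Context: All functions in physical space are real valued. Kernels on $I=[0,2\pi]$ with equal endpoint values are extended $2\pi$-periodically to $\mathbb R$, so that $G_m(x-y)$ and $G(x-y)$ make sense for $x,y\in I$ (the uniform limit $G$ also satisfies $G(0)=G(2\pi)$). Function spaces: $H^4(I)=\{u:I\to\mathbb R \mid u,u''''\in L^2(I),\ u(0)=u(2\pi),\ u'(0)=u'(2\pi),\ u''(0)=u''(2\pi),\ u'''(0)=u'''(2\pi)\}$ with norm $\|u\|_{H^4(I)}^2=\|u\|_{L^2(I)}^2+\|u''''\|_{L^2(I)}^2$, and its closed subspace $H^4_0(I)=\{u\in H^4(I)\mid \int_0^{2\pi}u(x)\,dx=0\}$ with the same norm. $C(I)$ carries the sup norm. Assumption (A): $F:\mathbb R\times I\to\mathbb R$ satisfies the Carathéodory condition ($F(u,x)$ is measurable in $x$ for every $u$ and continuous in $u$ for almost every $x$), and there are constants $k>0$, $l>0$ and a nonnegative function $h\in L^2(I)$ such that $|F(u,x)|\le k|u|+h(x)$ for all $u\in\mathbb R$, $x\in I$, and $|F(u_1,x)-F(u_2,x)|\le l|u_1-u_2|$ for all $u_1,u_2\in\mathbb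 R$, $x\in I$. Fourier coefficients: $G_n:=\int_0^{2\pi}G(x)\frac{e^{-inx}}{\sqrt{2\pi}}\,dx$ and $G_{m,n}:=\int_0^{2\pi}G_m(x)\frac{e^{-inx}}{\sqrt{2\pi}}\,dx$, $n\in\mathbb Z$; $F(0,x)_n$ denotes the $n$-th Fourier coefficient (same formula) of $x\mapsto F(0,x)$. For $a\ge0$, $b\in\mathbb R$, $b\neq0$, $m\in\mathbb N$: $$\mathcal N_{a,b,m}:=\max\left\{\left\|\frac{G_{m,n}}{n^4-a-ibn}\right\|_{l^\infty},\ \left\|\frac{n^4G_{m,n}}{n^4-a-ibn}\right\|_{l^\infty}\right\},$$ where $l^\infty$ norms are over $n\in\mathbb Z$. When $a=0$, at $n=0$ a quotient of the form $0/0$ is interpreted as $0$. *)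

(* Defs.v *)
From HB Require Import structures.
From mathcomp Require Import all_boot all_order all_algebra.
From mathcomp Require Import all_classical all_reals all_analysis.
From mathcomp Require Import complex.

Set Implicit Arguments.
Unset Strict Implicit.
Unset Printing Implicit Defensive.

Import Order.TTheory GRing.Theory Num.Theory.
Import numFieldNormedType.Exports.

Local Open Scope classical_set_scope.
Local Open Scope ring_scope.

(* R with the sigma-algebra of Lebesgue measurable sets, i.e. the domain of
   completed_lebesgue_measure (R itself carries the Borel sets). *)
Definition lebesgueTypeR (R : realType) :=
  caratheodory_type ((wlength (@idfun R))^*)%mu.

Section Defs.
Context {R : realType}.

Local Notation mu := (@completed_lebesgue_measure R).

(* A function on I = [0, 2 pi] is represented by a total function on R; its
   values outside I are irrelevant in everything below. *)
Definition I : set R := `[0, 2 * pi].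

Definition measurable_on_I (f : R -> R) :=
  @measurable_fun _ _ (lebesgueTypeR R) R I f.

Definition L2 (f : R -> R) : Prop := (f \_ I : R -> R) \in Lfun mu 2%:E.

Definition L2norm (f : R -> R) : R := fine ('N[mu]_(2%:E)[EFin \o (f \_ I)]).

(* f has limits at both ends of ]0, 2 pi[, and they coincide. *)
Definition same_end_limits (f : R -> R) :=
  exists2 c : R, f x @[x --> 0^'+] --> c & f x @[x --> (2 * pi)^'-] --> c.

(* An element of H^4(I) is identified with its representative that is C^3 up to
   the boundary. The condition on u''' says that it is absolutely continuous;
   then u'''' exists almost everywhere, and it is the weak derivative of u'''.
   The values of u', u'', u''' at the end points of I are their limits there,
   because derive1n k u 0 and derive1n k u (2 * pi) would depend on u outside I. *)
Definition H4 (u : R -> R) :=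
  [/\ L2 u /\ L2 (derive1n 4 u),
      derivable_oo_LRcontinuous u 0 (2 * pi),
      forall x, x \in `]0, 2 * pi[ ->
        derivable (derive1n 1 u) x 1 /\ derivable (derive1n 2 u) x 1,
      forall x y, 0 < x -> x <= y -> y < 2 * pi ->
        derive1n 3 u y - derive1n 3 u x = \int[mu]_(t in `[x, y]) derive1n 4 u t
    & [/\ u 0 = u (2 * pi), same_end_limits (derive1n 1 u),
          same_end_limits (derive1n 2 u) & same_end_limits (derive1n 3 u)]].

Definition H4_0 (u : R -> R) := H4 u /\ \int[mu]_(x in I) u x = 0.

Definition H4norm (u : R -> R) : R :=
  Num.sqrt (L2norm u ^+ 2 + L2norm (derive1n 4 u) ^+ 2).

(* The 2 pi-periodic extension of the restriction of f to [0, 2 pi[. *)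
Definition periodic_ext (f : R -> R) (x : R) : R :=
  f (x - 2 * pi * (Num.floor (x / (2 * pi)))%:~R).

Definition caratheodory (F : R -> R -> R) :=
  (forall u, measurable_on_I (F u)) /\
  {ae mu, forall x, I x -> continuous (F ^~ x)}.

Definition assumptionA (F : R -> R -> R) (k l : R) (h : R -> R) :=
  [/\ caratheodory F,
      [/\ 0 < k, 0 < l, L2 h & forall x, I x -> 0 <= h x],
      forall u x, I x -> `|F u x| <= k * `|u| + h x
    & forall u1 u2 x, I x -> `|F u1 x - F u2 x| <= l * `|u1 - u2|].

(* Real and imaginary parts of the integral of f x * e^{-inx} / sqrt (2 pi). *)
Definition fourier (f : R -> R) (n : int) : R[i] :=
  ((\int[mu]_(x in I) (f x * (cos (n%:~R * x) / Num.sqrt (2 * pi)))) -i*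
   (\int[mu]_(x in I) (f x * (sin (n%:~R * x) / Num.sqrt (2 * pi)))))%C.

Definition linf_norm (z : int -> R[i]) : \bar R :=
  ereal_sup [set (ComplexField.Normc.normc (z n))%:E | n in [set: int]].

(* n^4 - a - i b n *)
Definition symb (a b : R) (n : int) : R[i] :=
  ((n%:~R ^+ 4 - a) -i* (b * n%:~R))%C.

(* The quotients 0 / 0 occurring for a = 0 and n = 0 evaluate to 0. *)
Definition calN (a b : R) (K : R -> R) : \bar R :=
  maxe (linf_norm (fun n => fourier K n / symb a b n))
       (linf_norm (fun n => n%:~R ^+ 4 * fourier K n / symb a b n)).

Definition solution (a b : R) (K : R -> R) (F : R -> R -> R) (u : R -> R) :=
  {ae mu, forall x, I x ->
    - derive1n 4 u x + b * derive1 u x + a * u x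
      + \int[mu]_(y in I) (periodic_ext K (x - y) * F (u y) y) = 0}.

(* Equality in the space V is equality on I. *)
Definition unique_in (V P : (R -> R) -> Prop) (u : R -> R) :=
  [/\ V u, P u & forall v, V v -> P v -> forall x, I x -> v x = u x].

Definition solvable_and_convergent (V : (R -> R) -> Prop) (a b : R)
    (K_ : nat -> R -> R) (K : R -> R) (F : R -> R -> R) :=
  exists (u_ : nat -> R -> R) (u : R -> R),
    [/\ (forall m, unique_in V (solution a b (K_ m) F) (u_ m)) /\
        unique_in V (solution a b K F) u,
        H4norm (u_ m \- u) @[m --> \oo] --> 0,
        forall m, (exists n, fourier (K_ m) n * fourier (F 0) n != 0) ->
          exists2 x, I x & u_ m x != 0
      & (exists n, fourier K n * fourier (F 0) n != 0) ->
          exists2 x, I x & u x != 0].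

End Defs.

(* Main.v *)
Require Import Defs.
From HB Require Import structures.
From mathcomp Require Import all_boot all_order all_algebra.
From mathcomp Require Import all_classical all_reals all_analysis.
From mathcomp Require Import measurable_realfun complex ring lra.

(** The problem is diagonal in Fourier space. Writing K^ for the complex coefficients
    of K, the linear equation - u'''' + b u' + a u + conv K f = 0 says that
    (n^4 - a - i b n) u^(n) = K^(n) f^(n) for all n. As b <> 0, the symbol
    n^4 - a - i b n vanishes only if n = 0 and a = 0, where K and u have mean zero. So
    there is exactly one solution, linsol a b K f, whose coefficients are the
    quotients; its series can be differentiated four times, since K^ f^ is
    summable as a product of two square summable sequences and the symbol grows
    like n^4. The lemmas solution_linsol and linsol_equation establish this. They rest on
    the coefficients of functions in H4 (H4_fourier), the convolution theorem
    (fourier_conv), and the fact that a continuous function with vanishing coefficients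
    is zero (fourier_eq0).

    A solution of the nonlinear problem is therefore a fixed point of
    u |-> picard a b F K u = linsol a b K (F(u(.), .)). By the Bessel and Parseval relations this
    map is Lipschitz in L2 with constant l sqrt rho, where rho bounds the squared modulus
    of K^(n) / (n^4 - a - i b n), and the hypothesis on calN allows rho l^2 = q^2 / 2 with
    q = 1 - eps < 1 (admissible_calN). Banach's iteration is run on continuous functions:
    the coefficients of linsol are absolutely summable, so a bound in L2 on the
    source controls linsol uniformly (picard_sup), and L2 convergence of the iterates
    becomes uniform convergence (picard_fixed_point).

    For the convergence of the solutions, the bounds on the coefficients pass from the
    kernels to their uniform limit (admissible_limit), so the limiting problem is of the same
    kind. The difference of two solutions is
    linsol K (F(u, .) - F(v, .)) + linsol (K - L) (F(v, .)). The first term is absorbed by the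
    contraction, and the second is bounded by the sup norm of K - L; the same
    splitting bounds the fourth derivative, because calN also controls the
    quotients with the factor n^4 (picard_stability).

    If a solution vanishes identically, its coefficients do, and the equation leaves
    K^(n) F(0, .)^(n) = 0 for all n (nontrivial_solution).

    Complex coefficients are represented by the pairs fc, fs of cosine and sine
    integrals; multiplication and division by the symbol are written out in real terms. *)

Set Implicit Arguments.
Unset Strict Implicit.
Unset Printing Implicit Defensive.

Import Order.TTheory GRing.Theory Num.Theory.
Import numFieldNormedType.Exports.

Local Open Scope classical_set_scope.
Local Open Scope ring_scope.

(** * Integration on the period interval *)

Section LebesgueIntegral.
Context {R : realType}.
Implicit Types (f g u v : R -> R) (A : set R).

Local Notation mu := (@completed_lebesgue_measure R).
Local Notation lR := (lebesgueTypeR R).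
Local Notation I := (@I R).

Lemma lebesgue_measurable_borel A :
  measurable A -> measurable (A : set lR).
Proof. by move=> mA; apply: sub_caratheodory. Qed.

Lemma measurable_fun_lebesgue A f :
  measurable A -> measurable_fun A f -> measurable_fun (A : set lR) f.
Proof.
move=> mA mf _ B mB; apply: lebesgue_measurable_borel.
exact: mf.
Qed.

Lemma measurable_id_lebesgue : measurable_fun [set: lR] (id : lR -> R).
Proof. by move=> _ B mB; rewrite setTI; exact: lebesgue_measurable_borel. Qed.

(** The identity from the Lebesgue sets to the Borel sets is measurable and pushes
    the completed measure forward to the Lebesgue measure, so the change of
    variables formula transports integrals between the two. *)
Lemma integral_completed_setT A (f : R -> R) :
  measurable A ->
  measurable_fun [set: R] f ->
  lebesgue_measure.-integrable A (EFin \o f) ->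
  mu.-integrable A (EFin \o f) /\
  (\int[mu]_(x in A) (f x)%:E = \int[lebesgue_measure]_(x in A) (f x)%:E)%E.
Proof.
move=> mA mf intf.
have mid : measurable_fun [set: lR] (id : lR -> measurableTypeR R) := measurable_id_lebesgue.
have mEf : measurable_fun [set: R] (EFin \o f) by apply/measurable_EFinP.
have intf' : mu.-integrable (A : set lR) (EFin \o f).
  apply/integrableP; split.
    by apply/measurable_EFinP; apply: measurable_fun_lebesgue => //; exact: measurable_funTS.
  move/integrableP : intf => [_].
  have mabs : measurable_fun A (abse \o (EFin \o f)).
    by apply: measurableT_comp => //; exact: measurable_funTS.
  have E : (\int[lebesgue_measure]_(x in A) `|(f x)%:E| = \int[mu]_(x in A) `|(f x)%:E|)%E.
    have /= <- := @ge0_integral_pushforward _ _ _ _ _ _ mid mu A (abse \o (EFin \o f)) mA.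
    - by apply: eq_measure_integral.
    - exact: mabs.
    - by move=> x _ /=; rewrite lee_fin.
  by rewrite E.
split => //.
have /= <- := @integral_pushforward _ _ _ _ _ _ mid mu A (EFin \o f) mEf intf' mA.
exact: eq_measure_integral.
Qed.

(** Only integrals over A are compared, so f may be replaced by its extension by
    zero, which is Borel measurable on the whole line. *)
Lemma integral_completed A (f : R -> R) :
  measurable A -> lebesgue_measure.-integrable A (EFin \o f) ->
  mu.-integrable A (EFin \o f) /\
  \int[mu]_(x in A) f x = \int[lebesgue_measure]_(x in A) f x.
Proof.
move=> mA intf.
have mf : measurable_fun [set: R] (f \_ A).
  apply/(measurable_restrictT _ mA).
  by apply/measurable_EFinP; exact: (measurable_int lebesgue_measure).
have eqf : {in A, EFin \o (f \_ A) =1 EFin \o f}.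
  by move=> x xA /=; rewrite patchE xA.
have [||intA intE] := @integral_completed_setT A (f \_ A) mA.
- exact: mf.
- by apply: eq_integrable intf => // x xA /=; rewrite patchE xA.
have mA' : measurable (A : set lR) by exact: lebesgue_measurable_borel.
split.
  exact: (@eq_integrable _ lR R mu A mA' (EFin \o (f \_ A)) (EFin \o f) eqf intA).
rewrite /Rintegral; congr fine.
transitivity (\int[mu]_(x in A) ((f \_ A) x)%:E)%E.
  by apply: eq_integral => x xA; exact/esym/eqf.
by rewrite intE; apply: eq_integral => x xA; exact: eqf.
Qed.

Lemma continuous_integrable (a b : R) f :
  {within `[a, b], continuous f} -> mu.-integrable `[a, b] (EFin \o f).
Proof.
move=> cf.
by apply: (integral_completed _ _).1 => //; apply: continuous_compact_integrable => //; exact: segment_compact.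
Qed.

(** The fundamental theorem of calculus, transported to the completed measure. *)
Lemma integral_derivative (a b : R) (f F : R -> R) : a < b ->
  {within `[a, b], continuous f} -> derivable_oo_LRcontinuous F a b ->
  {in `]a, b[, derive1 F =1 f} ->
  \int[mu]_(x in `[a, b]) f x = F b - F a.
Proof.
move=> ab cf dF F'f.
have intf : lebesgue_measure.-integrable `[a, b] (EFin \o f).
  by apply: continuous_compact_integrable => //; exact: segment_compact.
rewrite (integral_completed _ intf).2//.
by rewrite /Rintegral (continuous_FTC2 ab cf dF F'f) -EFinB.
Qed.

Lemma two_pi_gt0 : 0 < 2 * pi :> R.
Proof. by rewrite mulr_gt0// pi_gt0. Qed.

Lemma measurable_I : measurable (I : set lR).
Proof. by apply: lebesgue_measurable_borel; exact: measurable_itv. Qed.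

Hint Resolve measurable_I two_pi_gt0 : core.

Lemma mu_I : mu I = (2 * pi)%:E.
Proof.
have -> : mu I = lebesgue_measure I by [].
by rewrite lebesgue_measure_itv/= lte_fin two_pi_gt0 -EFinB subr0.
Qed.

Definition L1 f := mu.-integrable I (EFin \o f).
Definition J f : R := \int[mu]_(x in I) f x.

Lemma L1_measurable f : L1 f -> measurable_on_I f.
Proof. by move=> /(measurable_int mu)/measurable_EFinP. Qed.

Lemma eq_L1 f g : {in I, f =1 g} -> L1 f -> L1 g.
Proof. by move=> fg; apply: eq_integrable => // x xI /=; rewrite fg. Qed.

Lemma L1_le f g : measurable_on_I f -> L1 g ->
  (forall x, I x -> `|f x| <= g x) -> L1 f.
Proof.
move=> mf ig fg; apply: (le_integrable measurable_I _ _ ig).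
  exact/measurable_EFinP.
by move=> x Ix /=; rewrite lee_fin (le_trans (fg _ Ix))// ler_norm.
Qed.

Lemma L1D f g : L1 f -> L1 g -> L1 (fun x => f x + g x).
Proof. by move=> fi gi; exact: (integrableD measurable_I fi gi). Qed.

Lemma L1Z c f : L1 f -> L1 (fun x => c * f x).
Proof. by move=> fi; exact: (integrableZl measurable_I c fi). Qed.

Lemma L1B f g : L1 f -> L1 g -> L1 (fun x => f x - g x).
Proof. by move=> fi gi; exact: (integrableB measurable_I fi gi). Qed.

Lemma L1_cst c : L1 (fun=> c).
Proof.
apply: measurable_bounded_integrable => //.
  by apply: (eq_ind_r (fun z => (z < +oo)%E) (ltry (2 * pi))); exact: mu_I.
by exists `|c|; split => // M cM x _ /=; exact: ltW.
Qed.

Lemma L1_norm f : L1 f -> L1 (fun x => `|f x|).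
Proof. exact: integrable_norm. Qed.

Lemma EFin_J f : L1 f -> (J f)%:E = (\int[mu]_(x in I) (f x)%:E)%E.
Proof. by move=> f1; rewrite fineK//; exact: integrable_fin_num f1. Qed.

Lemma JD f g : L1 f -> L1 g -> J (fun x => f x + g x) = J f + J g.
Proof. exact: RintegralD. Qed.

Lemma JB f g : L1 f -> L1 g -> J (fun x => f x - g x) = J f - J g.
Proof. exact: RintegralB. Qed.

Lemma JZ c f : L1 f -> J (fun x => c * f x) = c * J f.
Proof. exact: RintegralZl. Qed.

Lemma J_cst c : J (fun=> c) = 2 * pi * c.
Proof.
transitivity (c * fine (mu I)); first exact: Rintegral_cst.
by rewrite mu_I mulrC.
Qed.

Lemma eq_J f g : {in I, f =1 g} -> J f = J g.
Proof. by move=> fg; exact: (@eq_Rintegral _ lR R mu I g f fg). Qed.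

Lemma J_ge0 f : (forall x, I x -> 0 <= f x) -> 0 <= J f.
Proof. exact: (@Rintegral_ge0 _ lR R mu I f). Qed.

Lemma le_J f g : L1 f -> L1 g -> (forall x, I x -> f x <= g x) -> J f <= J g.
Proof. exact: (@le_Rintegral _ lR R mu I f g measurable_I). Qed.

Lemma J_norm_le f g : measurable_on_I f -> L1 g ->
  (forall x, I x -> `|f x| <= g x) -> `|J f| <= J g.
Proof.
move=> mf ig fg; have f1 := L1_le mf ig fg.
apply: (le_trans (le_normr_Rintegral measurable_I f1)).
by apply: le_J => //; exact: L1_norm.
Qed.

Lemma continuous_on_L1 f : {within I, continuous f} -> L1 f.
Proof. exact: continuous_integrable. Qed.

Lemma continuous_L1 f : continuous f -> L1 f.
Proof. by move=> cf; apply: continuous_on_L1; exact: continuous_subspaceT. Qed.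

Lemma continuous_on_bounded f : {within I, continuous f} ->
  exists2 M : R, 0 < M & forall x, I x -> `|f x| <= M.
Proof.
move=> cf.
have cI : compact I by exact: segment_compact.
have [M [_ MP]] := compact_bounded (continuous_compact cf cI).
exists (`|M| + 1); first by rewrite ltr_wpDl.
move=> x Ix; apply: (MP (`|M| + 1)); last by exists x.
by rewrite (le_lt_trans (ler_norm M))// ltrDl.
Qed.

Lemma L1_bounded f M : measurable_on_I f -> (forall x, I x -> `|f x| <= M) -> L1 f.
Proof. by move=> mf fM; exact: (L1_le mf (L1_cst M)). Qed.

Lemma L1M_bounded f g M : L1 f -> measurable_on_I g ->
  (forall x, I x -> `|g x| <= M) -> L1 (fun x => f x * g x).
Proof.
move=> f1 mg gM; have mf := L1_measurable f1.
apply: (@L1_le _ (fun x => M * `|f x|)) => //.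
- exact: measurable_funM.
- by apply: L1Z; exact: L1_norm.
- by move=> x Ix; rewrite normrM mulrC ler_wpM2r// gM.
Qed.

Lemma L1M_continuous f g : L1 f -> {within I, continuous g} -> L1 (fun x => f x * g x).
Proof.
move=> f1 cg; have [M _ gM] := continuous_on_bounded cg.
by apply: (L1M_bounded f1 _ gM); apply: L1_measurable; exact: continuous_on_L1.
Qed.

(** L2 is phrased with an extended real norm of an extension by zero; this
    equivalent form (see L2P) works with real integrals only. *)
Definition Ltwo f := measurable_on_I f /\ L1 (fun x => f x ^+ 2).

(** |f g| <= f^2 + g^2. *)
Lemma Ltwo_mul f g : Ltwo f -> Ltwo g -> L1 (fun x => f x * g x).
Proof.
move=> [mf f2] [mg g2].
apply: (@L1_le _ (fun x => f x ^+ 2 + g x ^+ 2)).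
- exact: measurable_funM.
- exact: L1D.
move=> x _; rewrite normrM -(real_normK (num_real (f x))) -(real_normK (num_real (g x))).
have := sqr_ge0 (`|f x| - `|g x|); have := sqr_ge0 (`|f x| + `|g x|).
by rewrite !expr2; lra.
Qed.

Lemma Ltwo_L1 f : Ltwo f -> L1 f.
Proof.
move=> f2.
have /(Ltwo_mul f2) : Ltwo (fun=> 1) by split; [exact: measurable_cst|exact: L1_cst].
by apply: eq_L1 => x _; rewrite mulr1.
Qed.

Lemma LtwoZ c f : Ltwo f -> Ltwo (fun x => c * f x).
Proof.
move=> [mf f2]; split; first exact: measurable_funM.
have := L1Z (c ^+ 2) f2.
by apply: eq_L1 => x _; rewrite exprMn.
Qed.

Lemma LtwoD f g : Ltwo f -> Ltwo g -> Ltwo (fun x => f x + g x).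
Proof.
move=> f2 g2; split; first exact: (measurable_funD f2.1 g2.1).
have := L1D (L1D f2.2 g2.2) (L1Z 2 (Ltwo_mul f2 g2)).
by apply: eq_L1 => x _; ring.
Qed.

Lemma LtwoB f g : Ltwo f -> Ltwo g -> Ltwo (fun x => f x - g x).
Proof.
move=> f2 /(LtwoZ (-1)) /(LtwoD f2) [mfg fg2]; split.
  by apply: eq_measurable_fun mfg => x _; rewrite mulN1r.
by apply: eq_L1 fg2 => x _; rewrite mulN1r.
Qed.

Lemma Ltwo_le f g : measurable_on_I f -> Ltwo g ->
  (forall x, I x -> `|f x| <= g x) -> Ltwo f.
Proof.
move=> mf [mg g2] fg; split => //.
apply: (L1_le _ g2); first exact: measurable_funX.
by move=> x Ix; rewrite normrX lerXn2r// ?nnegrE// ?(le_trans _ (fg _ Ix))// fg.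
Qed.

Lemma continuous_on_Ltwo f : {within I, continuous f} -> Ltwo f.
Proof.
move=> cf; have [M M0 fM] := continuous_on_bounded cf.
apply: (@Ltwo_le _ (fun=> M)) => //.
  by apply: L1_measurable; exact: continuous_on_L1.
by split; [exact: measurable_cst|exact: L1_cst].
Qed.

Lemma continuous_Ltwo f : continuous f -> Ltwo f.
Proof. by move=> cf; apply: continuous_on_Ltwo; exact: continuous_subspaceT. Qed.

(** The norm integrates over the whole line the real power of an absolute value;
    off I the extension by zero contributes nothing. *)
Lemma J_sqr_L2norm f : measurable_on_I f ->
  ('N[mu]_(2%:E)[EFin \o (f \_ I)] `^ 2 = \int[mu]_(x in I) ((f x) ^+ 2)%:E)%E.
Proof.
move=> mf; rewrite powR_Lnorm// [RHS]integral_mkcond.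
apply: eq_integral => x _; rewrite /= !patchE.
case: ifPn => xI /=.
  by rewrite powR_mulrn// real_normK ?num_real.
have -> : (point : R) = 0 by [].
by rewrite normr0 powR0.
Qed.

Lemma L2P f : L2 f <-> Ltwo f.
Proof.
rewrite /L2 inE; split.
- case/andP; rewrite inE/= => mf; rewrite inE/= /finite_norm => fn.
  have mf' : measurable_on_I f by exact/(measurable_restrictT _ measurable_I).
  split => //; apply/integrableP; split.
    by apply/measurable_EFinP; exact: measurable_funX.
  under eq_integral do rewrite /= ger0_norm ?sqr_ge0//.
  by rewrite -J_sqr_L2norm// poweR_lty.
- move=> [mf /integrableP[_ f2]]; apply/andP; split; rewrite inE/=.
    exact/(measurable_restrictT _ measurable_I).
  rewrite /finite_norm; apply: (@lty_poweRy _ _ 2) => //.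
  rewrite J_sqr_L2norm//; apply: le_lt_trans f2.
  by under [leRHS]eq_integral do rewrite /= ger0_norm ?sqr_ge0//.
Qed.

Lemma L2norm_sqr f : Ltwo f -> L2norm f ^+ 2 = J (fun x => f x ^+ 2).
Proof.
move=> f2; rewrite /L2norm /J /Rintegral -J_sqr_L2norm//; last exact: f2.1.
have /L2P := f2; rewrite /L2 inE => /andP[_]; rewrite inE/= /finite_norm.
have := Lnorm_ge0 mu 2%:E (EFin \o (f \_ I)).
case: ('N[mu]_2[_])%E => [r| |]// r0 _.
by rewrite poweR_EFin /= powR_mulrn.
Qed.

End LebesgueIntegral.

(** * Exchanging two integrals *)

Section Fubini.
Context {R : realType}.
Implicit Types (f g u v : R -> R) (A : set R).

Local Notation mu := (@completed_lebesgue_measure R).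
Local Notation lR := (lebesgueTypeR R).
Local Notation I := (@I R).
Hint Resolve measurable_I two_pi_gt0 : core.

Lemma le_integral_lebesgue (p q : lR -> \bar R) :
  measurable_fun setT p -> measurable_fun setT q ->
  (forall x, 0 <= p x)%E -> (forall x, p x <= q x)%E ->
  (\int[mu]_x p x <= \int[mu]_x q x)%E.
Proof. by move=> mp mq p0 pq; apply: ge0_le_integral. Qed.

Lemma measurable_fun_abse d (T : measurableType d) (p : T -> \bar R) :
  measurable_fun setT p -> measurable_fun setT (fun x => `|p x|%E).
Proof. by move=> mp; exact: measurableT_comp. Qed.

(** The kernel is only bounded on the square I x I, so Fubini is applied to its
    product with indicators of I; the bounded kernel times the integrable f is then
    integrable for the product measure. *)
Lemma fubini_kernel (k : R -> R -> R) f (M : R) :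
  measurable_fun [set: R * R] (fun z => k z.1 z.2) ->
  (forall x y, I x -> I y -> `|k x y| <= M) -> L1 f ->
  J (fun x => J (fun y => k x y * f y)) = J (fun y => J (fun x => k x y) * f y).
Proof.
move=> mk kM f1.
have mid : measurable_fun [set: lR] (id : lR -> R) := measurable_id_lebesgue.
have mfI : measurable_fun [set: lR] (f \_ I).
  by apply/(measurable_restrictT _ measurable_I); exact: L1_measurable.
have mkc d (T : measurableType d) (p q : T -> R) :
    measurable_fun setT p -> measurable_fun setT q ->
    measurable_fun setT (fun t => k (p t) (q t)).
  move=> mp mq; exact: (measurableT_comp mk (measurable_fun_pair mp mq)).
have mk1 x : measurable_fun [set: lR] (fun y : lR => k x y).
  by apply: mkc => //; exact: measurable_cst.
have mk2 y : measurable_fun [set: lR] (fun x : lR => k x y).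
  by apply: mkc => //; exact: measurable_cst.
pose h (z : lR * lR) : R := (\1_I z.1 * k z.1 z.2) * (f \_ I) z.2.
have mh : measurable_fun [set: lR * lR] h.
  apply: measurable_funM.
    apply: measurable_funM.
      apply: (@measurableT_comp _ _ _ _ _ _ (\1_I : lR -> R)) => //.
    apply: mkc.
      exact: (measurableT_comp mid measurable_fst).
    exact: (measurableT_comp mid measurable_snd).
  exact: (measurableT_comp mfI measurable_snd).
have mEh : measurable_fun [set: lR * lR] (EFin \o h) by apply/measurable_EFinP.
have h0 x y : ~ I x \/ ~ I y -> h (x, y) = 0.
  rewrite /h /= => -[Ix|Iy].
    by rewrite indicE memNset// !mul0r.
  by rewrite patchE memNset// mulr0.
have hE x y : I x -> I y -> h (x, y) = k x y * f y.
  by move=> Ix Iy; rewrite /h /= indicE patchE !mem_set// mul1r.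
have kf1 x : I x -> L1 (fun y => k x y * f y).
  move=> Ix; have : L1 (fun y => f y * k x y).
    apply: (L1M_bounded f1 (M := M)); first exact: measurable_funTS.
    by move=> y Iy; exact: kM.
  by apply: eq_L1 => y _; rewrite mulrC.
have k1 y : I y -> L1 (fun x => k x y).
  move=> Iy; apply: (L1_bounded (M := M)); first exact: measurable_funTS.
  by move=> x Ix; exact: kM.
have inner1 x : I x -> (\int[mu]_y (h (x, y))%:E = (J (fun y => k x y * f y))%:E)%E.
  move=> Ix; rewrite [RHS](EFin_J (kf1 _ Ix)).
  rewrite [RHS]integral_mkcond; apply: eq_integral => y _; rewrite patchE.
  case: ifPn => [/set_mem Iy|/negP Iy]; first by rewrite hE.
  by rewrite h0//; right => Iy'; apply: Iy; exact/mem_set.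
have inner2 y : I y -> (\int[mu]_x (h (x, y))%:E = (J (fun x => k x y) * f y)%:E)%E.
  move=> Iy.
  have -> : J (fun x => k x y) * f y = J (fun x => f y * k x y).
    by rewrite [RHS](JZ (f y) (k1 _ Iy)) mulrC.
  have e1 : L1 (fun x => f y * k x y) by apply: L1Z; exact: k1.
  have e2 := EFin_J e1.
  rewrite [RHS]e2.
  rewrite [RHS]integral_mkcond; apply: eq_integral => x _; rewrite patchE.
  case: ifPn => [/set_mem Ix|/negP Ix]; first by rewrite hE// mulrC.
  by rewrite h0//; left => Ix'; apply: Ix; exact/mem_set.
have ih : (mu \x mu)%E.-integrable setT (EFin \o h).
  apply/(integrable12ltyP _ _ mEh).
  (* the bound on the inner integral is the constant C on I and 0 elsewhere,
     so it is integrable over the whole line *)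
  pose C := (`|M| * J (fun y => `|f y|)).
  have C0 : 0 <= C by rewrite mulr_ge0// J_ge0.
  have inner x : (\int[mu]_y `|(EFin \o h) (x, y)| <= ((cst C \_ I) x)%:E)%E.
    rewrite patchE; case: ifPn => [/set_mem Ix|/negP Ix]; last first.
      rewrite integral0_eq// => y _ /=.
      by rewrite h0 ?normr0//; left => Ix'; apply: Ix; exact/mem_set.
    apply: (@le_trans _ _ (\int[mu]_(y in I) (`|M| * `|f y|)%:E)%E).
      rewrite [leRHS]integral_mkcond.
      have m1 : measurable_fun [set: lR] (fun y : lR => `|(h (x, y))%:E|%E).
        apply: measurable_fun_abse.
        exact: (measurableT_comp mEh (measurable_fun_pair (measurable_cst x) (@measurable_id _ lR setT))).
      have m2 : measurable_fun [set: lR] ((fun y => (`|M| * `|f y|)%:E) \_ I).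
        apply/(measurable_restrictT _ measurable_I)/measurable_EFinP.
        exact: L1_measurable (L1Z `|M| (L1_norm f1)).
      apply: (le_integral_lebesgue m1 m2) => y; first exact: abse_ge0.
      rewrite /= patchE; case: ifPn => [/set_mem Iy|/negP Iy].
        by rewrite hE// normrM lee_fin ler_wpM2r// (le_trans (kM _ _ Ix Iy))// ler_norm.
      by rewrite h0 ?normr0//; right => Iy'; apply: Iy; exact/mem_set.
    rewrite /C -JZ; last exact: L1_norm.
    by rewrite [leRHS](EFin_J (L1Z `|M| (L1_norm f1))).
  apply: (@le_lt_trans _ _ (\int[mu]_x ((cst C \_ I) x)%:E)%E).
    have m1 : measurable_fun [set: lR] (fun x => (\int[mu]_y `|(EFin \o h) (x, y)|)%E).
      apply: (@measurable_fun_fubini_tonelli_F _ _ _ _ _ mu (fun z => `|(EFin \o h) z|%E)).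
        exact: measurable_fun_abse.
      by move=> z; exact: abse_ge0.
    have m2 : measurable_fun [set: lR] (fun x => ((cst C \_ I) x)%:E).
      apply/measurable_EFinP/(measurable_restrictT _ measurable_I).
      exact: measurable_cst.
    apply: (le_integral_lebesgue m1 m2) => x; last exact: inner.
    by apply: integral_ge0 => y _; exact: abse_ge0.
  have -> : (\int[mu]_x ((cst C \_ I) x)%:E = \int[mu]_(x in I) C%:E)%E.
    by rewrite [RHS]integral_mkcond; apply: eq_integral => x _; rewrite !patchE; case: ifPn.
  by have /integrable_lty := L1_cst C; apply.
have FE := Fubini ih.
congr fine.
transitivity (\int[mu]_x \int[mu]_y (EFin \o h) (x, y))%E.
  rewrite integral_mkcond; apply: eq_integral => x _; rewrite patchE.
  case: ifPn => [/set_mem Ix|/negP Ix]; first by rewrite -inner1.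
  apply/esym/integral0_eq => y _.
  by apply: (congr1 EFin (h0 _ _ _)); left => Ix'; apply: Ix; exact/mem_set.
rewrite FE [RHS]integral_mkcond; apply: eq_integral => y _; rewrite patchE.
case: ifPn => [/set_mem Iy|/negP Iy]; first by rewrite -inner2.
apply/integral0_eq => x _.
by apply: (congr1 EFin (h0 _ _ _)); right => Iy'; apply: Iy; exact/mem_set.
Qed.

End Fubini.

(** * Completeness of the trigonometric system *)

Section Completeness.
Context {R : realType}.
Implicit Types (f g u v : R -> R) (A : set R).

Local Notation mu := (@completed_lebesgue_measure R).
Local Notation lR := (lebesgueTypeR R).
Local Notation I := (@I R).
Hint Resolve measurable_I two_pi_gt0 : core.

(** fc f w - i fs f w is the integral of f x e^{-iwx} over a period. Keeping the real
    and imaginary parts apart avoids complex-valued integrals altogether. *)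
Definition fc f (w : R) : R := J (fun x => f x * cos (w * x)).
Definition fs f (w : R) : R := J (fun x => f x * sin (w * x)).

Lemma continuous_cosM w : continuous (fun x : R => cos (w * x)).
Proof.
move=> x; apply: continuous_comp; last exact: continuous_cos.
by apply: continuousM; [exact: cvg_cst|exact: cvg_id].
Qed.

Lemma continuous_sinM w : continuous (fun x : R => sin (w * x)).
Proof.
move=> x; apply: continuous_comp; last exact: continuous_sin.
by apply: continuousM; [exact: cvg_cst|exact: cvg_id].
Qed.

Lemma L1_cos f w : L1 f -> L1 (fun x => f x * cos (w * x)).
Proof. by move=> f1; apply: L1M_continuous => //; apply: continuous_subspaceT; exact: continuous_cosM. Qed.

Lemma L1_sin f w : L1 f -> L1 (fun x => f x * sin (w * x)).
Proof. by move=> f1; apply: L1M_continuous => //; apply: continuous_subspaceT; exact: continuous_sinM. Qed.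

Lemma fcN f w : fc f (- w) = fc f w.
Proof. by apply: eq_J => x _; rewrite mulNr cosN. Qed.

Lemma fsN f w : L1 f -> fs f (- w) = - fs f w.
Proof.
move=> f1; rewrite -[RHS]mulN1r -(JZ _ (L1_sin w f1)).
by apply: eq_J => x _; rewrite mulNr sinN mulrN mulN1r.
Qed.

Lemma fc_lin (a : R) f g w : L1 f -> L1 g -> fc (fun x => f x + a * g x) w = fc f w + a * fc g w.
Proof.
move=> f1 g1; rewrite -(JZ _ (L1_cos w g1)) -(JD (L1_cos w f1) (L1Z a (L1_cos w g1))).
by apply: eq_J => x _; ring.
Qed.

Lemma fs_lin (a : R) f g w : L1 f -> L1 g -> fs (fun x => f x + a * g x) w = fs f w + a * fs g w.
Proof.
move=> f1 g1; rewrite -(JZ _ (L1_sin w g1)) -(JD (L1_sin w f1) (L1Z a (L1_sin w g1))).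
by apply: eq_J => x _; ring.
Qed.

(** The classical peak function for the uniqueness of Fourier coefficients: for
    0 < d < pi it exceeds 1 exactly within distance d of x0 (modulo a period), and stays in
    [-1, 1] elsewhere, so its powers concentrate at x0. *)
Definition bump (x0 d x : R) := 1 - cos d + cos (x - x0).

Lemma continuous_bumpX x0 d m : continuous (fun x => bump x0 d x ^+ m).
Proof.
move=> x; apply: (@continuous_comp _ _ _ (bump x0 d) (fun y : R => y ^+ m)); last exact: exprn_continuous.
apply: cvgD; first exact: cvg_cst.
apply: continuous_comp; last exact: continuous_cos.
by apply: cvgB; [exact: cvg_id|exact: cvg_cst].
Qed.

(** The powers of the bump are trigonometric polynomials. *)
Lemma bump_orthogonal g (x0 d : R) : {within I, continuous g} ->
  (forall n : int, fc g n%:~R = 0 /\ fs g n%:~R = 0) ->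
  forall m (n : int), fc (fun x => g x * bump x0 d x ^+ m) n%:~R = 0 /\
     fs (fun x => g x * bump x0 d x ^+ m) n%:~R = 0.
Proof.
move=> cg g0; elim=> [|m IH] n.
  have [gc gs] := g0 n; split.
    by rewrite -[RHS]gc; apply: eq_J => x _; rewrite expr0 mulr1.
  by rewrite -[RHS]gs; apply: eq_J => x _; rewrite expr0 mulr1.
pose q x := g x * bump x0 d x ^+ m.
have q1 : L1 q.
  apply: L1M_continuous; first exact: continuous_on_L1.
  by apply: continuous_subspaceT; exact: continuous_bumpX.
have Lc w : L1 (fun x => q x * cos (w * x)).
  by apply: L1M_continuous => //; apply: continuous_subspaceT; exact: continuous_cosM.
have Ls w : L1 (fun x => q x * sin (w * x)).
  by apply: L1M_continuous => //; apply: continuous_subspaceT; exact: continuous_sinM.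
have [cn sn] := IH n; have [cp sp] := IH (n + 1); have [cm sm] := IH (n - 1).
have ep x : ((n + 1)%:~R : R) * x = n%:~R * x + x by rewrite intrD mulrDl mul1r.
have em x : ((n - 1)%:~R : R) * x = n%:~R * x - x by rewrite intrB mulrBl mul1r.
have combination0 a0 a1 a2 f0 f1 f2 f3 f4 :
    L1 f0 -> L1 f1 -> L1 f2 -> L1 f3 -> L1 f4 ->
    J f0 = 0 -> J f1 = 0 -> J f2 = 0 -> J f3 = 0 -> J f4 = 0 ->
    J (fun x => a0 * f0 x + ((a1 * f1 x + a1 * f2 x) + (a2 * f3 x - a2 * f4 x))) = 0.
  move=> i0 i1 i2 i3 i4 e0 e1 e2 e3 e4.
  have i12 := L1D (L1Z a1 i1) (L1Z a1 i2); have i34 := L1B (L1Z a2 i3) (L1Z a2 i4).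
  rewrite (JD (L1Z a0 i0) (L1D i12 i34)) (JD i12 i34).
  rewrite (JD (L1Z a1 i1) (L1Z a1 i2)) (JB (L1Z a2 i3) (L1Z a2 i4)).
  by rewrite (JZ _ i0) (JZ _ i1) (JZ _ i2) (JZ _ i3) (JZ _ i4) e0 e1 e2 e3 e4; ring.
(* by the product-to-sum formulas, multiplying by cos (x - x0) only mixes the
   frequencies n - 1 and n + 1 *)
split.
- rewrite -[RHS](combination0 (1 - cos d) (cos x0 / 2) (sin x0 / 2) _ _ _ _ _
    (Lc _) (Lc _) (Lc _) (Ls _) (Ls _) cn cp cm sp sm).
  apply: eq_J => x _; rewrite ep em /q /bump !(cosB, sinB, cosD, sinD) exprS.
  by field.
- rewrite -[RHS](combination0 (1 - cos d) (cos x0 / 2) (sin x0 / 2) _ _ _ _ _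
    (Ls _) (Ls _) (Ls _) (Lc _) (Lc _) sn sp sm cm cp).
  apply: eq_J => x _; rewrite ep em /q /bump !(cosB, sinB, cosD, sinD) exprS.
  by field.
Qed.

Lemma cos_anti (s t : R) : 0 <= s -> s <= t -> t <= pi -> cos t <= cos s.
Proof.
move=> s0; rewrite le_eqVlt => /predU1P[->//|st] tpi; rewrite ltW// ltr_cos//.
  by rewrite in_itv/= s0 (le_trans (ltW st)).
by rewrite in_itv/= tpi (le_trans s0)// ltW.
Qed.

(** If g x0 were positive, the integral of g times a high power of the bump at x0,
    which is zero by orthogonality, would grow geometrically with the power. *)
Lemma orthogonal_le0 g (x0 : R) : {within I, continuous g} ->
  (forall n : int, fc g n%:~R = 0 /\ fs g n%:~R = 0) -> 0 < x0 < 2 * pi -> g x0 <= 0.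
Proof.
move=> cg g0 /andP[x00 x0p]; rewrite leNgt; apply/negP => gx0.
have cgx : {for x0, continuous g}.
  by apply: (within_continuous_continuous two_pi_gt0 cg); rewrite in_itv/= x00.
have [M M0 gM] := continuous_on_bounded cg.
have [d [d0 d1 dl dr dg]] : exists d : R, [/\ 0 < d, d < 1, d < x0, x0 < 2 * pi - d &
    forall x, `|x - x0| <= d -> g x0 / 2 <= g x].
  have : \forall x \near x0, g x0 / 2 < g x.
    by apply: cvgr_gt cgx _ _; rewrite ltr_pdivrMr// ltr_pMr// ltr1n.
  move=> /nbhs_ballP[e /= e0 eg].
  pose d := Num.min (Num.min (e / 2) (1 / 2)) (Num.min (x0 / 2) ((2 * pi - x0) / 2)).
  have dle : [/\ d <= e / 2, d <= 1 / 2, d <= x0 / 2 & d <= (2 * pi - x0) / 2].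
    by rewrite /d !ge_min !lexx !orbT.
  have d0 : 0 < d by rewrite /d !lt_min; apply/andP; split; apply/andP; split; lra.
  case: dle => ? ? ? ?; exists d; split; [lra|lra|lra|lra|].
  move=> x xd; apply/ltW/eg; rewrite /ball/= distrC (le_lt_trans xd)//; lra.
have pi2 := @pi_ge2 R.
(* the bump is at least r > 1 within d / 2 of x0, at least 1 within d, and in
   [-1, 1] farther away *)
pose r := bump x0 d (x0 + d / 2).
have r1 : 1 < r.
  have -> : r = 1 - cos d + cos (d / 2) by rewrite /r /bump; congr (_ + cos _); ring.
  have : cos d < cos (d / 2) by rewrite ltr_cos; [lra|rewrite in_itv/=; apply/andP; split; lra..].
  by lra.
pose A : set R := [set` `[x0 - d / 2, x0 + d / 2]].
have AI : A `<=` I by move=> x; rewrite /A /I /= !in_itv/= => /andP[? ?]; apply/andP; split; lra.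
have mA : measurable (A : set lR) by apply: lebesgue_measurable_borel; exact: measurable_itv.
have A1 : L1 (\1_A : R -> R).
  apply: (L1_bounded (M := 1)); first exact: measurable_funTS.
  by move=> x _; rewrite indicE; case: (_ \in _); rewrite ?normr1 ?normr0.
have JA : J (\1_A : R -> R) = d.
  have e : (\int[mu]_(x in I) (\1_A x)%:E = mu (A `&` I))%E by exact: integral_indic.
  rewrite /J /Rintegral e setIidl//.
  have -> : mu A = lebesgue_measure A by [].
  rewrite lebesgue_measure_itv/= lte_fin ifT; last by lra.
  by rewrite -EFinB/=; lra.
have lower m x : I x -> (g x0 / 2 * r ^+ m) * \1_A x - M <= g x * bump x0 d x ^+ m.
  move=> Ix; have [xd|xd] := leP `|x - x0| d.
    have p1 : 1 <= bump x0 d x.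
      rewrite /bump -(cos_norm (x - x0)).
      have := @cos_anti `|x - x0| d (normr_ge0 _) xd; have : d <= pi by lra.
      by move=> h /(_ h); lra.
    have gx := dg x xd.
    rewrite indicE; have [xA|xA] := boolP (x \in A); last first.
      rewrite mulr0 sub0r (le_trans (_ : _ <= 0)) ?oppr_le0 ?(ltW M0)//.
      by rewrite mulr_ge0 ?exprn_ge0//; lra.
    rewrite mulr1.
    have xd2 : `|x - x0| <= d / 2.
      move: xA; rewrite inE /A /= in_itv/= => /andP[? ?].
      by rewrite ler_norml; apply/andP; split; lra.
    have rp : r <= bump x0 d x.
      rewrite /r /bump -(cos_norm (x - x0)) lerD2l.
      have -> : x0 + d / 2 - x0 = d / 2 by ring.
      by apply: cos_anti => //; lra.
    have : g x0 / 2 * r ^+ m <= g x * bump x0 d x ^+ m.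
      apply: ler_pM => //; first lra.
        by rewrite exprn_ge0//; lra.
      by rewrite lerXn2r// nnegrE; lra.
    by lra.
  rewrite indicE memNset ?mulr0 ?sub0r; last first.
    move=> xA; move: xA xd; rewrite /A /= in_itv/= ltr_normr => /andP[? ?].
    by move=> /orP[]; lra.
  have cosle : cos (x - x0) <= cos d.
    have xI : 0 <= x <= 2 * pi by move: Ix; rewrite /I /= in_itv.
    case/andP: xI => x0' xp; rewrite -cos_norm.
    have xx : `|x - x0| <= 2 * pi - d by rewrite ler_norml; apply/andP; split; lra.
    have [xpi|xpi] := leP `|x - x0| pi.
      by apply: cos_anti => //; lra.
    have -> : cos `|x - x0| = cos (2 * pi - `|x - x0|).
      have -> : 2 * pi - `|x - x0| = - `|x - x0| + pi *+ 2 by ring.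
      by rewrite cosD2pi cosN.
    by apply: cos_anti; lra.
  have : `|g x * bump x0 d x ^+ m| <= M.
    rewrite normrM -[M]mulr1 ler_pM// ?gM//.
    rewrite normrX exprn_ile1//.
    rewrite /bump ler_norml; have := cos_le1 d; have := cos_geN1 (x - x0); have := cos_le1 (x - x0).
    by move=> ? ? ?; apply/andP; split; lra.
  by rewrite ler_norml => /andP[].
have Jle m : g x0 / 2 * r ^+ m * d - 2 * pi * M <= 0.
  have i1 : L1 (fun x => (g x0 / 2 * r ^+ m) * \1_A x - M) by apply: L1B; [exact: L1Z|exact: L1_cst].
  have i2 : L1 (fun x => g x * bump x0 d x ^+ m).
    apply: L1M_continuous; first exact: continuous_on_L1.
    by apply: continuous_subspaceT; exact: continuous_bumpX.
  have := le_J i1 i2 (lower m).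
  rewrite (JB (L1Z _ A1) (L1_cst _)) (JZ _ A1) JA J_cst => /le_trans; apply.
  have [+ _] := bump_orthogonal x0 d cg g0 m 0.
  rewrite /fc => e; rewrite le_eqVlt; apply/orP; left; apply/eqP.
  by rewrite -[RHS]e; apply: eq_J => x _; rewrite mul0r cos0 mulr1.
(* r ^ m grows without bound (Bernoulli), against the fixed bound of Jle *)
pose K := 2 * pi * M / (g x0 / 2 * d * (r - 1)).
have K0 : 0 < g x0 / 2 * d * (r - 1) by rewrite !mulr_gt0//; lra.
have Kge0 : 0 <= K.
  by apply: divr_ge0; [apply: mulr_ge0; [exact: ltW two_pi_gt0|exact: ltW]|exact: ltW].
have Ka := archi_boundP Kge0.
have Jm := Jle (Num.bound K).
have rm : 1 + (r - 1) *+ Num.bound K <= r ^+ Num.bound K.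
  elim: (Num.bound K) => [|m IH]; first by rewrite mulr0n addr0 expr0.
  rewrite exprS mulrS; have : 0 <= (r - 1) *+ m by rewrite mulrn_wge0//; lra.
  by nra.
move: Ka; rewrite ltr_pdivrMr// -mulr_natl => Ka.
have : g x0 / 2 * d * (1 + (r - 1) *+ Num.bound K) <= g x0 / 2 * d * r ^+ Num.bound K.
  by rewrite ler_pM2l// mulr_gt0//; lra.
by rewrite -mulr_natl; nra.
Qed.

(** Applying orthogonal_le0 to g and to - g gives the claim inside the period, and
    continuity extends it to the end points. *)
Lemma fourier_eq0 g : {within I, continuous g} ->
  (forall n : nat, fc g n%:R = 0 /\ fs g n%:R = 0) -> forall x, I x -> g x = 0.
Proof.
move=> cg g0; have g1 := continuous_on_L1 cg.
have gz (n : int) : fc g n%:~R = 0 /\ fs g n%:~R = 0.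
  case: n => n; first exact: g0.
  rewrite NegzE rmorphN /= fcN fsN//.
  by have [-> ->] := g0 n.+1; rewrite oppr0.
have inside x : 0 < x < 2 * pi -> g x = 0.
  move=> xI; apply/eqP; rewrite eq_le (orthogonal_le0 cg gz xI)/= -oppr_le0.
  have cNg : {within I, continuous (fun x => 0 + -1 * g x)}.
    move=> y; apply: cvgD; first exact: cvg_cst.
    by apply: cvgM; [exact: cvg_cst|exact: cg].
  have := orthogonal_le0 cNg _ xI; rewrite add0r mulN1r; apply => n.
  rewrite fc_lin ?fs_lin//; try exact: L1_cst.
  have [-> ->] := gz n; rewrite !mulr0 !addr0.
  by split; rewrite -[RHS](mul0r (J (fun=> 0))) -(JZ _ (L1_cst 0)); apply: eq_J => y _; rewrite !mul0r.
move: (cg) => /continuous_within_itvP-/(_ two_pi_gt0)[_ cl cr].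
have [c0 cp] : g 0 = 0 /\ g (2 * pi) = 0.
  split.
  - apply: (cvg_unique (@Rhausdorff R) cl).
    apply: cvg_near_cst; near=> y; rewrite inside//; apply/andP; split; near: y.
      exact: nbhs_right_gt.
    exact: nbhs_right_lt two_pi_gt0.
  - apply: (cvg_unique (@Rhausdorff R) cr).
    apply: cvg_near_cst; near=> y; rewrite inside//; apply/andP; split; near: y.
      exact: nbhs_left_gt two_pi_gt0.
    exact: nbhs_left_lt.
move=> x; rewrite /I /= in_itv/= => /andP[].
rewrite le_eqVlt => /predU1P[<-//|x0]; rewrite le_eqVlt => /predU1P[->//|xp].
by apply: inside; rewrite x0.
Unshelve. all: by end_near.
Qed.

End Completeness.

(** * Trigonometric sums and Bessel's inequality *)

Section FourierSeries.
Context {R : realType}.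
Implicit Types (f g u v : R -> R) (A : set R) (c s : nat -> R).

Local Notation mu := (@completed_lebesgue_measure R).
Local Notation lR := (lebesgueTypeR R).
Local Notation I := (@I R).
Hint Resolve measurable_I two_pi_gt0 : core.

Lemma cos_periodic (k : int) (x : R) : cos (k%:~R * (x + 2 * pi)) = cos (k%:~R * x).
Proof.
have nat_case (n : nat) y : cos (n%:R * (y + 2 * pi)) = cos (n%:R * y :> R).
  rewrite mulrDr -(periodicn (@cosD2pi R) n (n%:R * y)); congr cos.
  by rewrite -mulr_natr; ring.
case: k => n; first exact: nat_case.
by rewrite NegzE rmorphN /= !mulNr !cosN; exact: nat_case.
Qed.

Lemma sin_periodic (k : int) (x : R) : sin (k%:~R * (x + 2 * pi)) = sin (k%:~R * x).
Proof.
have nat_case (n : nat) y : sin (n%:R * (y + 2 * pi)) = sin (n%:R * y :> R).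
  rewrite mulrDr -(periodicn (@sinD2pi R) n (n%:R * y)); congr sin.
  by rewrite -mulr_natr; ring.
case: k => n; first exact: nat_case.
by rewrite NegzE rmorphN /= !mulNr !sinN; congr (- _); exact: nat_case.
Qed.

Lemma is_deriveD_fun f g (x a b : R) : is_derive x 1 f a -> is_derive x 1 g b ->
  is_derive x 1 (fun y => f y + g y) (a + b).
Proof. by move=> fa gb; exact: is_deriveD. Qed.

Lemma is_deriveZ_fun f (x k a : R) : is_derive x 1 f a ->
  is_derive x 1 (fun y => k * f y) (k * a).
Proof. by move=> fa; exact: is_deriveZ. Qed.

Lemma is_deriveM_fun f g (x a b : R) : is_derive x 1 f a -> is_derive x 1 g b ->
  is_derive x 1 (fun y => f y * g y) (a * g x + f x * b).
Proof.
move=> fa gb; have h : is_derive x 1 (fun y => f y * g y) (f x *: b + g x *: a).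
  exact: is_deriveM.
by apply: (is_derive_eq h); rewrite /GRing.scale/=; ring.
Qed.

Lemma is_derive_cosM (w x : R) : is_derive x 1 (fun x => cos (w * x)) (- (w * sin (w * x))).
Proof.
have h := is_deriveZ_fun w (is_derive_id x 1).
have {}h : is_derive x 1 (cos \o (fun y => w * y)) (- sin (w * x) * (w * 1)).
  exact: is_derive1_comp.
by apply: (is_derive_eq h); ring.
Qed.

Lemma is_derive_sinM (w x : R) : is_derive x 1 (fun x => sin (w * x)) (w * cos (w * x)).
Proof.
have h := is_deriveZ_fun w (is_derive_id x 1).
have {}h : is_derive x 1 (sin \o (fun y => w * y)) (cos (w * x) * (w * 1)).
  exact: is_derive1_comp.
by apply: (is_derive_eq h); ring.
Qed.

Lemma is_derive_continuous f (x a : R) : is_derive x 1 f a -> {for x, continuous f}.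
Proof.
by move=> fa; apply: differentiable_continuous; apply/derivable1_diffP; exact: ex_derive.
Qed.

Lemma derive_LRcontinuous f (df : R -> R) (a b : R) :
  (forall x : R, is_derive x 1 f (df x)) -> derivable_oo_LRcontinuous f a b.
Proof.
move=> fd; split; first by move=> x _; exact: ex_derive.
- exact: cvg_at_right_filter (is_derive_continuous (fd a)).
- exact: cvg_at_left_filter (is_derive_continuous (fd b)).
Qed.

Lemma J_derive f (df : R -> R) : continuous df ->
  (forall x : R, is_derive x 1 f (df x)) -> J df = f (2 * pi) - f 0.
Proof.
move=> cdf fd; apply: integral_derivative => //.
- exact: continuous_subspaceT.
- exact: derive_LRcontinuous fd.
- by move=> x _; rewrite derive1E; exact: derive_val.
Qed.

Lemma J_cos (k : int) : J (fun x : R => cos (k%:~R * x)) = if k == 0 then 2 * pi else 0.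
Proof.
case: eqP => [->|/eqP k0].
  rewrite -[RHS]mulr1 -J_cst; apply: eq_J => x _.
  by rewrite mul0r cos0.
have k0' : (k%:~R : R) != 0 by rewrite intr_eq0.
have dF (x : R) : is_derive x 1 (fun x => k%:~R^-1 * sin (k%:~R * x)) (cos (k%:~R * x)).
  have h := is_deriveZ_fun k%:~R^-1 (is_derive_sinM k%:~R x).
  by apply: (is_derive_eq h); rewrite mulKf.
rewrite (J_derive (@continuous_cosM R k%:~R) dF) -[2 * pi]add0r sin_periodic; ring.
Qed.

Lemma J_sin (k : int) : J (fun x : R => sin (k%:~R * x)) = 0.
Proof.
have [->|k0] := eqVneq k 0.
  rewrite -[RHS](mulr0 (2 * pi)) -J_cst; apply: eq_J => x _.
  by rewrite mul0r sin0.
have k0' : (k%:~R : R) != 0 by rewrite intr_eq0.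
have dF (x : R) : is_derive x 1 (fun x => - k%:~R^-1 * cos (k%:~R * x)) (sin (k%:~R * x)).
  have h := is_deriveZ_fun (- k%:~R^-1) (is_derive_cosM k%:~R x).
  by apply: (is_derive_eq h); rewrite mulrNN mulKf.
rewrite (J_derive (@continuous_sinM R k%:~R) dF) -[2 * pi]add0r cos_periodic; ring.
Qed.

(** The inverses of the squared norms over a period of cos (n x), and of sin (n x) for
    n > 0. With them, a series is described by the unnormalised coefficients fc and fs of its sum. *)
Definition weight (n : nat) : R := if n == 0%N then (2 * pi)^-1 else pi^-1.

Definition trig c s n (x : R) : R := c n * cos (n%:R * x) + s n * sin (n%:R * x).
Definition psum c s N (x : R) : R := \sum_(n < N) weight n * trig c s n x.

Lemma weight_gt0 n : 0 < weight n.
Proof. by rewrite /weight; case: ifP => _; rewrite invr_gt0 ?pi_gt0 ?two_pi_gt0. Qed.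

Lemma weight_le1 n : weight n <= 1.
Proof.
have := @pi_ge2 R => p2; rewrite /weight; case: ifP => _; rewrite invf_le1 ?pi_gt0//; lra.
Qed.

Lemma continuous_trig c s n : continuous (trig c s n).
Proof.
move=> x; apply: cvgD; apply: cvgM; [exact: cvg_cst| |exact: cvg_cst|].
  exact: continuous_cosM.
exact: continuous_sinM.
Qed.

Lemma psumS c s N : psum c s N.+1 = fun x => psum c s N x + weight N * trig c s N x.
Proof. by apply/funext => x; rewrite /psum big_ord_recr. Qed.

Lemma psum0 c s : psum c s 0 = fun=> 0.
Proof. by apply/funext => x; rewrite /psum big_ord0. Qed.

Lemma continuous_psum c s N : continuous (psum c s N).
Proof.
elim: N => [|N IH]; first by rewrite psum0 => x; exact: cvg_cst.
rewrite psumS => x; apply: cvgD; first exact: IH.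
by apply: cvgM; [exact: cvg_cst|exact: continuous_trig].
Qed.

Lemma L1_trig c s n : L1 (trig c s n).
Proof. by apply: continuous_L1; exact: continuous_trig. Qed.

Lemma L1_psum c s N : L1 (psum c s N).
Proof. by apply: continuous_L1; exact: continuous_psum. Qed.

Lemma J_comb (a b : R) f g : L1 f -> L1 g ->
  J (fun x => a * f x + b * g x) = a * J f + b * J g.
Proof. by move=> f1 g1; rewrite (JD (L1Z a f1) (L1Z b g1)) (JZ a f1) (JZ b g1). Qed.

Lemma J_trigM f c s n : L1 f ->
  J (fun x => f x * trig c s n x) = c n * fc f n%:R + s n * fs f n%:R.
Proof.
move=> f1; rewrite -(J_comb (c n) (s n) (L1_cos _ f1) (L1_sin _ f1)).
by apply: eq_J => x _; rewrite /trig; ring.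
Qed.

Lemma J_psumM f c s N : L1 f -> J (fun x => f x * psum c s N x) =
  \sum_(n < N) weight n * (c n * fc f n%:R + s n * fs f n%:R).
Proof.
move=> f1; elim: N => [|N IH].
  by rewrite big_ord0 -[RHS](mulr0 (2 * pi)) -J_cst; apply: eq_J => x _; rewrite psum0 mulr0.
rewrite big_ord_recr /= -IH -J_trigM// psumS.
have i1 : L1 (fun x => f x * psum c s N x).
  by apply: L1M_continuous => //; apply: continuous_subspaceT; exact: continuous_psum.
have i2 : L1 (fun x => f x * trig c s N x).
  by apply: L1M_continuous => //; apply: continuous_subspaceT; exact: continuous_trig.
rewrite -[X in X + _]mul1r -(J_comb 1 (weight N) i1 i2).
by apply: eq_J => x _; ring.
Qed.

(** Orthogonality of the trigonometric system. Its sine counterpart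
    asks for s 0 = 0, because sin (0 x) = 0 cannot carry a coefficient. *)
Lemma fc_trig c s n m : fc (trig c s n) m%:R = if n == m then c n / weight n else 0.
Proof.
pose a := (n%:Z - m%:Z); pose b := (n%:Z + m%:Z).
have ea x : (a%:~R : R) * x = n%:R * x - m%:R * x by rewrite intrB mulrBl.
have eb x : (b%:~R : R) * x = n%:R * x + m%:R * x by rewrite intrD mulrDl.
have C1 k : L1 (fun x : R => cos (k%:~R * x)) by apply: continuous_L1; exact: continuous_cosM.
have S1 k : L1 (fun x : R => sin (k%:~R * x)) by apply: continuous_L1; exact: continuous_sinM.
transitivity (J (fun x => c n / 2 * (1 * cos (a%:~R * x) + 1 * cos (b%:~R * x)) +
   s n / 2 * (1 * sin (a%:~R * x) + 1 * sin (b%:~R * x)))).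
  apply: eq_J => x _; rewrite /trig ea eb !(cosB, sinB, cosD, sinD); by field.
rewrite (J_comb _ _ (L1D (L1Z _ (C1 _)) (L1Z _ (C1 _))) (L1D (L1Z _ (S1 _)) (L1Z _ (S1 _)))).
rewrite (J_comb _ _ (C1 _) (C1 _)) (J_comb _ _ (S1 _) (S1 _)) !J_cos !J_sin /a /b subr_eq0 eqz_nat -PoszD eqz_nat addn_eq0.
have [<-|nm] := eqVneq n m.
  by rewrite andbb /weight; case: (n == 0%N); rewrite invrK; field.
case: ifP => [/andP[/eqP n0 /eqP m0]|_]; last by ring.
by rewrite n0 m0 eqxx in nm.
Qed.

Lemma fs_trig c s n m : s 0%N = 0 ->
  fs (trig c s n) m%:R = if n == m then s n / weight n else 0.
Proof.
move=> s0.
pose a := (n%:Z - m%:Z); pose b := (n%:Z + m%:Z).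
have ea x : (a%:~R : R) * x = n%:R * x - m%:R * x by rewrite intrB mulrBl.
have eb x : (b%:~R : R) * x = n%:R * x + m%:R * x by rewrite intrD mulrDl.
have C1 k : L1 (fun x : R => cos (k%:~R * x)) by apply: continuous_L1; exact: continuous_cosM.
have S1 k : L1 (fun x : R => sin (k%:~R * x)) by apply: continuous_L1; exact: continuous_sinM.
transitivity (J (fun x => s n / 2 * (1 * cos (a%:~R * x) + -1 * cos (b%:~R * x)) +
   c n / 2 * (1 * sin (b%:~R * x) + -1 * sin (a%:~R * x)))).
  apply: eq_J => x _; rewrite /trig ea eb !(cosB, sinB, cosD, sinD); by field.
rewrite (J_comb _ _ (L1D (L1Z _ (C1 _)) (L1Z _ (C1 _))) (L1D (L1Z _ (S1 _)) (L1Z _ (S1 _)))).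
rewrite (J_comb _ _ (C1 _) (C1 _)) (J_comb _ _ (S1 _) (S1 _)) !J_cos !J_sin /a /b subr_eq0 eqz_nat -PoszD eqz_nat addn_eq0.
have [<-|nm] := eqVneq n m.
  rewrite andbb /weight.
  by case: (eqVneq n 0%N) => [->|_]; rewrite ?s0 invrK; field.
case: ifP => [/andP[/eqP n0 /eqP m0]|_]; last by ring.
by rewrite n0 m0 eqxx in nm.
Qed.

Lemma fc_psum c s N m : fc (psum c s N) m%:R = if (m < N)%N then c m else 0.
Proof.
elim: N => [|N IH].
  rewrite psum0 -[RHS](mulr0 (2 * pi)) -J_cst; apply: eq_J => x _; exact: mul0r.
rewrite psumS fc_lin; [|exact: L1_psum|exact: L1_trig].
rewrite IH fc_trig [in RHS]ltnS [in RHS]leq_eqVlt (eq_sym m).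
have [->|Nm] := eqVneq N m; last by rewrite /= mulr0 addr0.
by rewrite ltnn add0r mulrC divfK// gt_eqF// weight_gt0.
Qed.

Lemma fs_psum c s N m : s 0%N = 0 -> fs (psum c s N) m%:R = if (m < N)%N then s m else 0.
Proof.
move=> s0; elim: N => [|N IH].
  rewrite psum0 -[RHS](mulr0 (2 * pi)) -J_cst; apply: eq_J => x _; exact: mul0r.
rewrite psumS fs_lin; [|exact: L1_psum|exact: L1_trig].
rewrite IH fs_trig// [in RHS]ltnS [in RHS]leq_eqVlt (eq_sym m).
have [->|Nm] := eqVneq N m; last by rewrite /= mulr0 addr0.
by rewrite ltnn add0r mulrC divfK// gt_eqF// weight_gt0.
Qed.

Lemma J_psum_sqr c s N : s 0%N = 0 ->
  J (fun x => psum c s N x ^+ 2) = \sum_(n < N) weight n * (c n ^+ 2 + s n ^+ 2).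
Proof.
move=> s0; transitivity (J (fun x => psum c s N x * psum c s N x)).
  by apply: eq_J => x _; rewrite expr2.
rewrite J_psumM; last exact: L1_psum.
by apply: eq_bigr => n _; rewrite fc_psum fs_psum// ltn_ord !expr2.
Qed.

Lemma fs0 f : fs f 0 = 0.
Proof. by rewrite -[RHS](mulr0 (2 * pi)) -J_cst; apply: eq_J => x _; rewrite mul0r sin0 mulr0. Qed.

(** The integral of the square of f minus its partial sum is nonnegative. *)
Lemma bessel f N : Ltwo f ->
  \sum_(n < N) weight n * (fc f n%:R ^+ 2 + fs f n%:R ^+ 2) <= J (fun x => f x ^+ 2).
Proof.
move=> f2; pose P := psum (fun n => fc f n%:R) (fun n => fs f n%:R) N.
have JP : J (fun x => P x ^+ 2) = \sum_(n < N) weight n * (fc f n%:R ^+ 2 + fs f n%:R ^+ 2).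
  by rewrite J_psum_sqr ?fs0.
have P2 : Ltwo P by apply: continuous_Ltwo; exact: continuous_psum.
have JfP : J (fun x => f x * P x) = J (fun x => P x ^+ 2).
  rewrite JP J_psumM; last exact: Ltwo_L1.
  by apply: eq_bigr => n _; rewrite !expr2.
have : 0 <= J (fun x => (f x - P x) ^+ 2) by apply: J_ge0 => x _; exact: sqr_ge0.
have -> : J (fun x => (f x - P x) ^+ 2) =
    J (fun x => 1 * (f x ^+ 2) + 1 * (-2 * (f x * P x) + 1 * P x ^+ 2)).
  by apply: eq_J => x _; ring.
have i1 := Ltwo_mul f2 P2.
rewrite J_comb; [|exact: f2.2|by apply: L1D; [exact: L1Z|apply: L1Z; exact: P2.2]].
rewrite J_comb; [|exact: i1|exact: P2.2].
by rewrite JfP JP; lra.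
Qed.

End FourierSeries.

(** * Absolutely convergent trigonometric series *)

Section SeriesLimit.
Context {R : realType}.
Implicit Types (f g u v : R -> R) (c s : nat -> R).

Local Notation I := (@I R).
Hint Resolve measurable_I two_pi_gt0 : core.

Definition abs_sum c s N : R := \sum_(n < N) (`|c n| + `|s n|).
Definition summable_coefs c s := exists A : R, forall N, abs_sum c s N <= A.
(** The limit is taken pointwise; it is meaningful for the absolutely summable
    coefficients of summable_coefs, where the convergence is uniform. *)
Definition fseries c s (x : R) : R := limn (fun N => psum c s N x).

Lemma norm_trig_le c s n (x : R) : `|trig c s n x| <= `|c n| + `|s n|.
Proof.
rewrite (le_trans (ler_normD _ _))// !normrM lerD// ler_piMr//; [exact: cos_max|exact: sin_max].
Qed.

Lemma abs_sum_mono c s : {homo abs_sum c s : m n / (m <= n)%N >-> m <= n}.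
Proof.
move=> m n /subnK <-; elim: (n - m)%N => // k IH; rewrite addSn.
by rewrite (le_trans IH)// /abs_sum big_ord_recr /= lerDl addr_ge0.
Qed.

Lemma psum_diff c s m n (x : R) : (m <= n)%N ->
  `|psum c s n x - psum c s m x| <= abs_sum c s n - abs_sum c s m.
Proof.
move=> /subnK <-; elim: (n - m)%N => [|k IH]; first by rewrite !subrr normr0.
rewrite addSn psumS [abs_sum _ _ _.+1]/abs_sum big_ord_recr/= -/(abs_sum _ _ _).
rewrite addrAC (addrAC (abs_sum _ _ _)) (le_trans (ler_normD _ _))// lerD//.
rewrite normrM ger0_norm ?(ltW (weight_gt0 _))//.
rewrite (le_trans _ (norm_trig_le _ _ _ x))// ler_piMl//; exact: weight_le1.
Qed.

Lemma abs_sum_cvg c s : summable_coefs c s ->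
  exists2 L : R, abs_sum c s n @[n --> \oo] --> L & forall N, abs_sum c s N <= L.
Proof.
move=> [A cA].
have cv : cvgn (abs_sum c s).
  apply: nondecreasing_is_cvgn; first exact: abs_sum_mono.
  by exists A => _ [n _ <-].
exists (limn (abs_sum c s)) => // N.
by apply: nondecreasing_cvgn_le => //; exact: abs_sum_mono.
Qed.

Lemma cvg_psum c s (x : R) : summable_coefs c s ->
  psum c s n x @[n --> \oo] --> fseries c s x.
Proof.
move=> [A cA].
have psumE : (fun n => psum c s n x) = series (fun n => weight n * trig c s n x).
  by apply/funext => n; rewrite /series /= big_mkord.
rewrite /fseries psumE; apply: normed_cvg.
apply: nondecreasing_is_cvgn; first by apply: nondecreasing_series => n _ _; exact: normr_ge0.
exists A => _ [n _ <-]; apply: le_trans (cA n); rewrite [leLHS]big_mkord; apply: ler_sum => i _ /=.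
rewrite normrM ger0_norm ?(ltW (weight_gt0 _))//.
rewrite (le_trans _ (norm_trig_le _ _ _ x))// ler_piMl//; exact: weight_le1.
Qed.

Lemma fseries_tail c s : summable_coefs c s ->
  exists2 t : nat -> R, t n @[n --> \oo] --> 0 &
    forall N x, `|fseries c s x - psum c s N x| <= t N.
Proof.
move=> cs; have [L cL SL] := abs_sum_cvg cs.
exists (fun N => L - abs_sum c s N).
  by rewrite -[X in _ --> X](subrr L); apply: cvgB => //; exact: cvg_cst.
move=> N x.
have cv : `|psum c s n x - psum c s N x| @[n --> \oo] --> `|fseries c s x - psum c s N x|.
  by apply: cvg_norm; apply: cvgB; [exact: cvg_psum|exact: cvg_cst].
apply: (cvgr_to_le cv); near=> n.
rewrite (le_trans (psum_diff _ _ _ (_ : N <= n)%N))//; first by near: n; exists N.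
by rewrite lerB.
Unshelve. all: by end_near.
Qed.

Lemma fseries_le c s A (x : R) : (forall N, abs_sum c s N <= A) -> `|fseries c s x| <= A.
Proof.
move=> cA; have cv : `|psum c s n x| @[n --> \oo] --> `|fseries c s x|.
  by apply: cvg_norm; apply: cvg_psum; exists A.
apply: (cvgr_to_le cv); near=> n; apply: le_trans (cA n).
have := psum_diff c s x (leq0n n).
by rewrite psum0 /abs_sum big_ord0 !subr0.
Unshelve. all: by end_near.
Qed.

Lemma continuous_uniform_limit (f_ : nat -> R -> R) f : (forall n, continuous (f_ n)) ->
  (forall e : R, 0 < e -> exists n, forall x, `|f x - f_ n x| <= e) -> continuous f.
Proof.
move=> cf_ ff x; apply/cvgrPdist_le => /= e e0.
have e3 : 0 < e / 3 by rewrite divr_gt0.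
have [n fn] := ff _ e3.
have := cf_ n x => /cvgrPdist_le /(_ _ e3) /=; apply: filterS => y cy.
have := fn x; have := fn y; move: cy; rewrite !ler_norml.
by do 3 move=> /andP[? ?]; apply/andP; split; lra.
Qed.

Lemma continuous_fseries c s : summable_coefs c s -> continuous (fseries c s).
Proof.
move=> cs; have [t t0 ct] := fseries_tail cs.
apply: (@continuous_uniform_limit (psum c s)) => [N|e e0]; first exact: continuous_psum.
have [N _ tN] : \forall n \near \oo, t n <= e by exact: (cvgr_le _ t0 _ e0).
by exists N => x; apply: le_trans (ct N x) (tN N (leqnn N)).
Qed.

Lemma L1_fseries c s : summable_coefs c s -> L1 (fseries c s).
Proof. by move=> cs; apply: continuous_L1; exact: continuous_fseries. Qed.

(** The form in which a fixed quantity is shown to be zero by approximation. *)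
Lemma cvg_eq_small (a : R) (t : nat -> R) (C : R) : t n @[n --> \oo] --> 0 ->
  (\forall n \near \oo, `|a| <= C * t n) -> a = 0.
Proof.
move=> t0 at0; apply/eqP; rewrite -normr_le0.
have cv : C * t n @[n --> \oo] --> C * 0 by apply: cvgM => //; exact: cvg_cst.
by rewrite -(mulr0 C); exact: (cvgr_to_ge cv).
Qed.

(** Uniform convergence lets the integral be taken term by term. *)
Lemma J_fseriesM c s g M : summable_coefs c s -> measurable_on_I g ->
  (forall x, I x -> `|g x| <= M) ->
  exists2 t : nat -> R, t n @[n --> \oo] --> 0 &
  forall N, `|J (fun x => fseries c s x * g x) - J (fun x => psum c s N x * g x)| <= 2 * pi * M * t N.
Proof.
move=> cs mg gM; have [t t0 ct] := fseries_tail cs; exists t => // N.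
have i1 := L1M_bounded (L1_fseries cs) mg gM.
have i2 := L1M_bounded (L1_psum c s N) mg gM.
rewrite -(JB i1 i2) (_ : _ * t N = J (fun=> M * t N)); last by rewrite J_cst mulrA.
apply: J_norm_le => //.
- exact: L1_measurable (L1B i1 i2).
- exact: L1_cst.
move=> x Ix; rewrite -mulrBl normrM; have := ct N x; have := gM x Ix => gx tx.
by rewrite mulrC ler_pM.
Qed.

Lemma fc_fseries c s m : summable_coefs c s -> fc (fseries c s) m%:R = c m.
Proof.
move=> cs; apply/eqP; rewrite -subr_eq0; apply/eqP.
have mc : measurable_on_I (fun x : R => cos (m%:R * x)).
  by apply: L1_measurable; apply: continuous_L1; exact: continuous_cosM.
have [t t0 ct] := J_fseriesM cs mc (fun x _ => cos_max (m%:R * x)).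
apply: (cvg_eq_small t0 (C := 2 * pi * 1)); near=> n.
have <- : fc (psum c s n) m%:R = c m by rewrite fc_psum ifT//; near: n; exists m.+1.
exact: ct.
Unshelve. all: by end_near.
Qed.

Lemma fs_fseries c s m : s 0%N = 0 -> summable_coefs c s -> fs (fseries c s) m%:R = s m.
Proof.
move=> s0 cs; apply/eqP; rewrite -subr_eq0; apply/eqP.
have mc : measurable_on_I (fun x : R => sin (m%:R * x)).
  by apply: L1_measurable; apply: continuous_L1; exact: continuous_sinM.
have [t t0 ct] := J_fseriesM cs mc (fun x _ => sin_max (m%:R * x)).
apply: (cvg_eq_small t0 (C := 2 * pi * 1)); near=> n.
have <- : fs (psum c s n) m%:R = s m by rewrite fs_psum// ifT//; near: n; exists m.+1.
exact: ct.
Unshelve. all: by end_near.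
Qed.

Lemma fourier_ext f g : {within I, continuous f} -> {within I, continuous g} ->
  (forall n : nat, fc f n%:R = fc g n%:R /\ fs f n%:R = fs g n%:R) ->
  forall x, I x -> f x = g x.
Proof.
move=> cf cg fg x Ix; apply/eqP; rewrite -subr_eq0; apply/eqP.
rewrite -mulN1r; apply: (@fourier_eq0 _ (fun y => f y + -1 * g y)) => //.
  move=> y; apply: cvgD; first exact: cf.
  by apply: cvgM; [exact: cvg_cst|exact: cg].
move=> n; have [-> ->] : fc (fun y => f y + -1 * g y) n%:R = fc f n%:R + -1 * fc g n%:R /\
  fs (fun y => f y + -1 * g y) n%:R = fs f n%:R + -1 * fs g n%:R.
  by split; [apply: fc_lin|apply: fs_lin]; exact: continuous_on_L1.
by have [-> ->] := fg n; rewrite !mulN1r !subrr.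
Qed.

(** Half of Parseval's identity: the integral of the square of the series is the limit
    of its pairings with the partial sums. *)
Lemma J_fseries_sqr c s B : s 0%N = 0 -> summable_coefs c s ->
  (forall N, \sum_(n < N) weight n * (c n ^+ 2 + s n ^+ 2) <= B) ->
  J (fun x => fseries c s x ^+ 2) <= B.
Proof.
move=> s0 cs cB; have [A cA] := cs.
have cF := continuous_fseries cs.
have [t t0 ct] := J_fseriesM cs (L1_measurable (L1_fseries cs)) (fun x _ => fseries_le x cA).
have cv : \sum_(n < N) weight n * (c n ^+ 2 + s n ^+ 2) @[N --> \oo] -->
    J (fun x => fseries c s x ^+ 2).
  apply/cvgrPdist_le => e e0.
  have : 2 * pi * A * t n @[n --> \oo] --> 2 * pi * A * 0.
    by apply: cvgM => //; exact: cvg_cst.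
  rewrite mulr0 => /cvgrPdist_le /(_ _ e0); apply: filterS => n; rewrite sub0r normrN => tn.
  apply: le_trans (_ : 2 * pi * A * t n <= _); last exact: le_trans (ler_norm _) tn.
  have -> : \sum_(k < n) weight k * (c k ^+ 2 + s k ^+ 2) =
      J (fun x => psum c s n x * fseries c s x).
    have -> : J (fun x => psum c s n x * fseries c s x) = J (fun x => fseries c s x * psum c s n x).
      by apply: eq_J => x _; rewrite mulrC.
    rewrite J_psumM; last exact: L1_fseries.
    by apply: eq_bigr => k _; rewrite fc_fseries ?fs_fseries// !expr2.
  have -> : J (fun x => fseries c s x ^+ 2) = J (fun x => fseries c s x * fseries c s x).
    by apply: eq_J => x _; rewrite expr2.
  exact: ct.
by apply: (cvgr_to_le cv); near=> N; exact: cB.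
Unshelve. all: by end_near.
Qed.

Lemma fseriesB c s c' s' (x : R) : summable_coefs c s -> summable_coefs c' s' ->
  fseries (fun n => c n - c' n) (fun n => s n - s' n) x = fseries c s x - fseries c' s' x.
Proof.
move=> cs cs'; apply: (cvg_lim (@Rhausdorff R)).
have -> : (fun N => psum (fun n => c n - c' n) (fun n => s n - s' n) N x) =
    (fun N => psum c s N x - psum c' s' N x).
  apply/funext => N; rewrite /psum -sumrB; apply: eq_bigr => n _; rewrite /trig; ring.
by apply: cvgB; exact: cvg_psum.
Qed.

Lemma fseries_periodic c s (x : R) : fseries c s (x + 2 * pi) = fseries c s x.
Proof.
have e N : psum c s N (x + 2 * pi) = psum c s N x.
  apply: eq_bigr => n _; by rewrite /trig -(cos_periodic n x) -(sin_periodic n x).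
by rewrite /fseries; under eq_fun do rewrite e.
Qed.

(** The mean value theorem. *)
Lemma lipschitz_derive f (df : R -> R) (K : R) :
  (forall z : R, is_derive z 1 f (df z)) -> (forall z, `|df z| <= K) ->
  forall x y, `|f y - f x| <= K * `|y - x|.
Proof.
move=> fd dK; have cf : continuous f by move=> z; exact: is_derive_continuous (fd z).
have lt x y : x < y -> `|f y - f x| <= K * `|y - x|.
  move=> xy; have [z _ ->] := MVT xy (fun z _ => fd z) (continuous_subspaceT cf).
  by rewrite normrM ler_wpM2r.
move=> x y; case: (ltgtP x y) => [|yx|->]; first exact: lt.
  by rewrite distrC (distrC y); exact: lt.
by rewrite !subrr normr0 mulr0.
Qed.

(** The coefficients of the termwise derivative of the series of (c, s) are
    (dcos s, dsin c). *)
Definition dcos s n : R := n%:R * s n.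
Definition dsin c n : R := - (n%:R * c n).

Lemma is_derive_psum c s N (x : R) : is_derive x 1 (psum c s N) (psum (dcos s) (dsin c) N x).
Proof.
elim: N => [|N IH]; first by rewrite !psum0; exact: is_derive_cst.
rewrite !psumS; apply: is_deriveD_fun => //; apply: is_deriveZ_fun.
have h := is_deriveD_fun (is_deriveZ_fun (c N) (is_derive_cosM N%:R x))
  (is_deriveZ_fun (s N) (is_derive_sinM N%:R x)).
by apply: (is_derive_eq h); rewrite /trig /dcos /dsin; ring.
Qed.

(** The difference quotients of the partial sums converge uniformly, since the tails
    of the series are Lipschitz with constants tending to zero. *)
Lemma is_derive_fseries c s (x : R) : summable_coefs c s ->
  summable_coefs (dcos s) (dsin c) ->
  is_derive x 1 (fseries c s) (fseries (dcos s) (dsin c) x).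
Proof.
move=> cs dcs.
have [L cL SL] := abs_sum_cvg dcs.
pose a := fseries (dcos s) (dsin c) x.
have [t t0 dt] := fseries_tail dcs.
pose t' N := L - abs_sum (dcos s) (dsin c) N.
have t'0 : t' n @[n --> \oo] --> 0.
  by rewrite -[X in _ --> X](subrr L); apply: cvgB => //; exact: cvg_cst.
(* the tail of the series is Lipschitz, its constant being the tail t' N of
   the absolute sum of the differentiated series *)
have tail N z : `|(fseries c s z - psum c s N z) - (fseries c s x - psum c s N x)| <= t' N * `|z - x|.
  have cv : `|(psum c s n z - psum c s N z) - (psum c s n x - psum c s N x)| @[n --> \oo] -->
    `|(fseries c s z - psum c s N z) - (fseries c s x - psum c s N x)|.
    by apply: cvg_norm; apply: cvgB; apply: cvgB; [exact: cvg_psum|exact: cvg_cst|exact: cvg_psum|exact: cvg_cst].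
  apply: (cvgr_to_le cv); near=> n.
  have nN : (N <= n)%N by near: n; exists N.
  apply: (@lipschitz_derive (fun z => psum c s n z - psum c s N z)
    (fun z => psum (dcos s) (dsin c) n z - psum (dcos s) (dsin c) N z)) => y.
    by apply: is_deriveB; exact: is_derive_psum.
  by rewrite (le_trans (psum_diff _ _ _ nN))// /t' lerB.
apply/is_derive1_caratheodory.
exists (fun z => if z == x then a else (fseries c s z - fseries c s x) / (z - x)); split.
- move=> z; case: eqP => [->|/eqP zx]; first by rewrite !subrr mulr0.
  by rewrite divfK// subr_eq0.
- apply/cvgrPdist_le => e e0; rewrite eqxx.
  have e3 : 0 < e / 3 by rewrite divr_gt0.
  have [N tN t'N] : exists2 N, t N <= e / 3 & t' N <= e / 3.
    have [N1 _ h1] : \forall N \near \oo, t N <= e / 3 by exact: (cvgr_le _ t0 _ e3).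
    have [N2 _ h2] : \forall N \near \oo, t' N <= e / 3 by exact: (cvgr_le _ t'0 _ e3).
    by exists (maxn N1 N2); [apply: h1; exact: leq_maxl|apply: h2; exact: leq_maxr].
  have /is_derive1_caratheodory[g [gE cg gx]] := is_derive_psum c s N x.
  move/cvgrPdist_le : cg => /(_ _ e3); apply: filterS => z gz.
  case: eqP => [_|/eqP zx]; first by rewrite subrr normr0 ltW.
  have zx0 : 0 < `|z - x| by rewrite normr_gt0 subr_eq0.
  have h1 : `|(fseries c s z - fseries c s x) / (z - x) - g z| <= e / 3.
    rewrite -(ler_pM2r zx0) -normrM mulrBl divfK ?subr_eq0// -gE.
    have -> : fseries c s z - fseries c s x - (psum c s N z - psum c s N x) =
      (fseries c s z - psum c s N z) - (fseries c s x - psum c s N x) by ring.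
    by apply: (le_trans (tail N z)); rewrite ler_pM2r.
  have := dt N x; rewrite -gx -/a; move: h1 gz; rewrite !ler_norml.
  by do 3 move=> /andP[? ?]; apply/andP; split; lra.
- by rewrite eqxx.
Unshelve. all: by end_near.
Qed.

End SeriesLimit.

(** * Periodic extension and convolution *)

Section Convolution.
Context {R : realType}.
Implicit Types (f g q K : R -> R).

Local Notation I := (@I R).
Hint Resolve measurable_I two_pi_gt0 : core.

(** A primitive on a half line, which suffices for integrals over bounded intervals. *)
Lemma continuous_primitive q (a : R) : continuous q ->
  exists P : R -> R, forall x, a < x -> is_derive x 1 P (q x).
Proof.
move=> cq; exists (fun x => \int[lebesgue_measure]_(t in `[a, x]) q t) => x ax.
have iq : lebesgue_measure.-integrable `[a, x + 1] (EFin \o q).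
  by apply: continuous_compact_integrable; [exact: segment_compact|exact: continuous_subspaceT].
have x1 : x < x + 1 by rewrite ltrDl.
have [d e] := continuous_FTC1_closed x1 iq ax (cq x).
by apply: DeriveDef; [exact: d|rewrite -derive1E; exact: e].
Qed.

(** By periodicity the primitive P of q satisfies P (z + 2 pi) - P z = constant. *)
Lemma J_shift q (y : R) : continuous q -> (forall x, q (x + 2 * pi) = q x) -> I y ->
  J (fun x => q (x - y)) = J q.
Proof.
move=> cq pq; rewrite /I /= in_itv/= => /andP[y0 yp].
have [P dP] := continuous_primitive (- (2 * (2 * pi))) cq.
have p0 := @two_pi_gt0 R.
have dPs c z : - (2 * (2 * pi)) < z + c -> is_derive z 1 (fun z => P (z + c)) (q (z + c)).
  move=> zc; have h := dP _ zc.
  have h2 : is_derive z 1 (fun z => z + c) 1.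
    have h3 := is_deriveD_fun (is_derive_id z 1) (is_derive_cst c z 1).
    by apply: (is_derive_eq h3); rewrite addr0.
  have h3 : is_derive z 1 (P \o (fun z => z + c)) (q (z + c) * 1) by exact: is_derive1_comp.
  by apply: (is_derive_eq h3); rewrite mulr1.
have cs c : continuous (fun z => q (z + c)).
  move=> z; apply: continuous_comp; last exact: cq.
  by apply: cvgD; [exact: cvg_id|exact: cvg_cst].
have FTC c : - (2 * pi) <= c -> J (fun x => q (x + c)) = P (2 * pi + c) - P c.
  move=> cp; have -> : P (2 * pi + c) - P c = (fun z => P (z + c)) (2 * pi) - (fun z => P (z + c)) 0.
    by rewrite /= add0r.
  apply: (@integral_derivative R 0 (2 * pi) (fun x => q (x + c)) (fun z => P (z + c))) => //.
  - exact: continuous_subspaceT.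
  - split; first by move=> z /[!in_itv]/= /andP[z0 z1]; apply: ex_derive; apply: dPs; lra.
    + apply: cvg_at_right_filter; apply: is_derive_continuous; apply: dPs; lra.
    + apply: cvg_at_left_filter; apply: is_derive_continuous; apply: dPs; lra.
  - move=> z /[!in_itv]/= /andP[z0 z1]; rewrite derive1E; apply: derive_val; apply: dPs; lra.
rewrite (FTC (- y)); last lra.
have -> : J q = J (fun x => q (x + 0)) by apply: eq_J => x _; rewrite addr0.
rewrite (FTC 0); last lra.
(* P (z + 2 * pi) - P z has zero derivative, so it is constant *)
have dH z : - (2 * (2 * pi)) < z -> is_derive z 1 (fun z => P (z + 2 * pi) - P (z + 0)) 0.
  move=> z0; have h1 := dPs (2 * pi) z; have h2 := dPs 0 z.
  have h : is_derive z 1 (fun z => P (z + 2 * pi) - P (z + 0)) (q (z + 2 * pi) - q (z + 0)).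
    by apply: is_deriveB; [apply: h1|apply: h2]; lra.
  by apply: (is_derive_eq h); rewrite pq addr0 subrr.
have [->|yn0] := eqVneq y 0; first by rewrite oppr0.
have yy : - y < 0 by rewrite oppr_lt0 lt_neqAle eq_sym yn0.
have [||z _ /eqP] := @MVT R (fun z => P (z + 2 * pi) - P (z + 0)) (fun=> 0) (- y) 0 yy.
- by move=> z /[!in_itv]/= /andP[z0 z1]; apply: dH; lra.
- apply: derivable_within_continuous => z /[!in_itv]/= /andP[z0 z1].
  by apply: ex_derive; apply: dH; lra.
by rewrite mul0r subr_eq0 => /eqP; rewrite !addr0 add0r (addrC (- y)) => <-.
Qed.

Lemma periodic_ext_shift f (k : int) (x : R) :
  0 <= x - 2 * pi * k%:~R < 2 * pi -> periodic_ext f x = f (x - 2 * pi * k%:~R).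
Proof.
have p0 := @two_pi_gt0 R; move=> /andP[h1 h2]; rewrite /periodic_ext.
suff -> : Num.floor (x / (2 * pi)) = k by [].
apply: floor_def; rewrite ler_pdivlMr// ltr_pdivrMr// intrD; apply/andP; split; lra.
Qed.

Lemma periodic_ext_reduce (x : R) : exists k : int, 0 <= x - 2 * pi * k%:~R < 2 * pi.
Proof.
have p0 := @two_pi_gt0 R; exists (Num.floor (x / (2 * pi))).
have := floor_itv (x / (2 * pi)).
rewrite ler_pdivlMr// ltr_pdivrMr// intrD => /andP[? ?]; apply/andP; split; lra.
Qed.

Lemma periodic_extD f (x : R) : periodic_ext f (x + 2 * pi) = periodic_ext f x.
Proof.
have [k xk] := periodic_ext_reduce x.
rewrite (periodic_ext_shift f xk).
have E : x + 2 * pi - 2 * pi * (k + 1)%:~R = x - 2 * pi * k%:~R by rewrite intrD; ring.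
by rewrite (@periodic_ext_shift f (k + 1)) E.
Qed.

Lemma periodic_ext_itv f (x : R) : 0 <= x < 2 * pi -> periodic_ext f x = f x.
Proof. by move=> xI; rewrite (@periodic_ext_shift f 0) mulr0 subr0. Qed.

Lemma periodic_ext_I f (x : R) : f 0 = f (2 * pi) -> I x -> periodic_ext f x = f x.
Proof.
move=> f0p; rewrite /I /= in_itv/= => /andP[x0]; rewrite le_eqVlt => /predU1P[->|xp].
  by rewrite -[2 * pi]add0r periodic_extD add0r -f0p periodic_ext_itv// lexx two_pi_gt0.
by rewrite periodic_ext_itv// x0.
Qed.

Lemma periodic_ext_bounded f M (x : R) : (forall x, I x -> `|f x| <= M) ->
  `|periodic_ext f x| <= M.
Proof.
move=> fM; have [k xk] := periodic_ext_reduce x; rewrite (periodic_ext_shift f xk).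
by apply: fM; rewrite /I /= in_itv/=; case/andP: xk => -> /ltW.
Qed.

Lemma continuous_periodic_ext f : {within I, continuous f} -> f 0 = f (2 * pi) ->
  continuous (periodic_ext f).
Proof.
have p0 := @two_pi_gt0 R.
move=> /continuous_within_itvP-/(_ p0)[cf cl cr] f0p.
(* only the point 0 needs f 0 = f (2 * pi): the left limit of the extension
   there is the left limit of f at 2 * pi *)
have near0 x : 0 <= x < 2 * pi -> {for x, continuous (periodic_ext f)}.
  case/andP; rewrite le_eqVlt => /predU1P[<- _|x0 xp]; last first.
    have xin : x \in `]0, 2 * pi[ by rewrite in_itv/= x0.
    rewrite /prop_for /continuous_at [X in _ --> X]periodic_ext_itv ?(ltW x0)//.
    apply: cvg_trans (cf x xin); apply: near_eq_cvg; near=> z.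
    rewrite periodic_ext_itv//; apply/andP; split; last by near: z; exact: lt_nbhsl.
    by apply/ltW; near: z; exact: lt_nbhsr.
  apply/left_right_continuousP; rewrite [periodic_ext f 0]periodic_ext_itv ?lexx//; split.
    rewrite f0p; apply/cvgrPdist_le => e e0.
    move/cvgrPdist_le : cr => /(_ _ e0) /nbhs_ballP[d /= d0 dP].
    near=> z; have z0 : z < 0 by near: z; exact: nbhs_left_lt.
    have zd : - d < z by near: z; apply: nbhs_left_gt; rewrite oppr_lt0.
    have zp : - (2 * pi) < z by near: z; apply: nbhs_left_gt; rewrite oppr_lt0.
    have -> : periodic_ext f z = f (z + 2 * pi).
      by rewrite -periodic_extD periodic_ext_itv//; apply/andP; split; lra.
    by apply: dP; rewrite /ball/= ?ltr_norml; [apply/andP; split|]; lra.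
  apply: cvg_trans cl; apply: near_eq_cvg; near=> z.
  rewrite periodic_ext_itv//; apply/andP; split; first by apply/ltW; near: z; exact: nbhs_right_gt.
  by near: z; exact: nbhs_right_lt.
move=> x; have [k xk] := periodic_ext_reduce x.
have E : periodic_ext f = (periodic_ext f) \o (fun z => z - 2 * pi * k%:~R).
  apply/funext => z /=; have [j zj] := periodic_ext_reduce z.
  have E : z - 2 * pi * k%:~R - 2 * pi * (j - k)%:~R = z - 2 * pi * j%:~R by rewrite intrB; ring.
  by rewrite (periodic_ext_shift f zj) (@periodic_ext_shift f (j - k)) E.
rewrite E; apply: continuous_comp; last exact: near0.
by apply: cvgB; [exact: cvg_id|exact: cvg_cst].
Unshelve. all: by end_near.
Qed.

Definition conv K f (x : R) := J (fun y => periodic_ext K (x - y) * f y).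

Section continuous_kernel.
Variables (K : R -> R).
Hypotheses (cK : {within I, continuous K}) (K0p : K 0 = K (2 * pi)).

Lemma continuous_periodic_ext_sub (x : R) : continuous (fun y => periodic_ext K (x - y)).
Proof.
move=> y; apply: continuous_comp; last exact: continuous_periodic_ext.
by apply: cvgB; [exact: cvg_cst|exact: cvg_id].
Qed.

Lemma continuous_periodic_ext_subl (y : R) : continuous (fun x => periodic_ext K (x - y)).
Proof.
move=> x; apply: continuous_comp; last exact: continuous_periodic_ext.
by apply: cvgB; [exact: cvg_id|exact: cvg_cst].
Qed.

Lemma L1_conv f (x : R) : L1 f -> L1 (fun y => periodic_ext K (x - y) * f y).
Proof.
move=> f1.
have cg := @continuous_periodic_ext_sub x.
have := L1M_continuous f1 (continuous_subspaceT cg).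
by apply: eq_L1 => y _; rewrite mulrC.
Qed.

(** Continuity of an integral with a parameter, with |K| |f| bounded by a multiple of
    the integrable function |f|. *)
Lemma continuous_conv f : L1 f -> continuous (conv K f).
Proof.
move=> f1 x; have [M M0 KM] := continuous_on_bounded cK.
apply: (@continuity_under_integral R _ (lebesgueTypeR R) (@completed_lebesgue_measure R)
  (fun x y => periodic_ext K (x - y) * f y) I measurable_I (x - 1) (x + 1) _ _
  (fun y => M * `|f y|)).
- by move=> z _; exact: L1_conv.
- apply: aeW => y _ z _; apply: cvgM; last exact: cvg_cst.
  exact: continuous_periodic_ext_subl.
- exact: L1Z (L1_norm f1).
- move=> z _; apply: aeW => y _.
  by rewrite normrM ler_wpM2r//; exact: periodic_ext_bounded.
- by rewrite inE/= in_itv/=; apply/andP; split; lra.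
Qed.

(** The convolution theorem: the right-hand sides are the real and (minus the)
    imaginary parts of the product of fc K - i fs K and fc f - i fs f. *)
Lemma fourier_conv f (k : int) : L1 f ->
  fc (conv K f) k%:~R = fc K k%:~R * fc f k%:~R - fs K k%:~R * fs f k%:~R /\
  fs (conv K f) k%:~R = fs K k%:~R * fc f k%:~R + fc K k%:~R * fs f k%:~R.
Proof.
move=> f1; have [M M0 KM] := continuous_on_bounded cK.
pose g := periodic_ext K; have cg : continuous g := continuous_periodic_ext cK K0p.
have pg x : g (x + 2 * pi) = g x := periodic_extD K x.
have mk (phi : R -> R) : continuous phi ->
    measurable_fun [set: R * R] (fun z : R * R => phi z.1 * g (z.1 - z.2)).
  move=> cphi; apply: measurable_funM.
    exact: (measurableT_comp (continuous_measurable_fun cphi) measurable_fst).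
  apply: (measurableT_comp (continuous_measurable_fun cg)).
  by apply: measurable_funB; [exact: measurable_fst|exact: measurable_snd].
(* Fubini turns the integral over x into an integral of a translate of a
   periodic function, over one period *)
have swap (phi : R -> R) : continuous phi -> (forall x, `|phi x| <= 1) ->
    J (fun x => conv K f x * phi x) = J (fun y => J (fun x => phi x * g (x - y)) * f y).
  move=> cphi phi1; rewrite -(fubini_kernel (M := M) (mk _ cphi) _ f1); last first.
    move=> x y _ _; rewrite normrM -[M]mul1r ler_pM//; exact: periodic_ext_bounded.
  apply: eq_J => x _; rewrite mulrC -(JZ (phi x) (L1_conv x f1)).
  by apply: eq_J => y _; rewrite mulrA.
have c1 := @continuous_cosM R k%:~R; have s1 := @continuous_sinM R k%:~R.
pose gc x := g x * cos (k%:~R * x); pose gs x := g x * sin (k%:~R * x).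
have cgc : continuous gc by move=> x; apply: cvgM; [exact: cg|exact: c1].
have cgs : continuous gs by move=> x; apply: cvgM; [exact: cg|exact: s1].
have Jc y : I y -> J (fun x => gc (x - y)) = fc K k%:~R.
  move=> Iy; rewrite J_shift//; last by move=> x; rewrite /gc pg cos_periodic.
  by apply: eq_J => x /set_mem Ix; rewrite /gc /g periodic_ext_I.
have Js y : I y -> J (fun x => gs (x - y)) = fs K k%:~R.
  move=> Iy; rewrite J_shift//; last by move=> x; rewrite /gs pg sin_periodic.
  by apply: eq_J => x /set_mem Ix; rewrite /gs /g periodic_ext_I.
have sub1 (q : R -> R) (y : R) : continuous q -> L1 (fun x => q (x - y)).
  move=> cq; apply: continuous_L1 => x; apply: continuous_comp; last exact: cq.
  by apply: cvgB; [exact: cvg_id|exact: cvg_cst].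
have kx (x y : R) : k%:~R * x = k%:~R * (x - y) + k%:~R * y by ring.
have i1 := L1_cos k%:~R f1; have i2 := L1_sin k%:~R f1.
split.
- rewrite /fc swap//; last by move=> x; exact: cos_max.
  rewrite -/(fc K _) -/(fc f _) -mulNr -(J_comb _ _ i1 i2).
  apply: eq_J => y /set_mem Iy.
  have -> : J (fun x => cos (k%:~R * x) * g (x - y)) =
     J (fun x => cos (k%:~R * y) * gc (x - y) + - sin (k%:~R * y) * gs (x - y)).
    by apply: eq_J => x _; rewrite (kx x y) cosD /gc /gs; ring.
  by rewrite (J_comb _ _ (sub1 _ y cgc) (sub1 _ y cgs)) Jc// Js//; ring.
- rewrite /fs swap//; last by move=> x; exact: sin_max.
  rewrite -/(fs K _) -/(fs f _) -(J_comb _ _ i1 i2).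
  apply: eq_J => y /set_mem Iy.
  have -> : J (fun x => sin (k%:~R * x) * g (x - y)) =
     J (fun x => sin (k%:~R * y) * gc (x - y) + cos (k%:~R * y) * gs (x - y)).
    by apply: eq_J => x _; rewrite (kx x y) sinD /gc /gs; ring.
  by rewrite (J_comb _ _ (sub1 _ y cgc) (sub1 _ y cgs)) Jc// Js//; ring.
Qed.

End continuous_kernel.
End Convolution.

(** * Null sets and dominated convergence *)

Section AlmostEverywhere.
Context {R : realType}.
Implicit Types (f g u v : R -> R).

Local Notation mu := (@completed_lebesgue_measure R).
Local Notation lR := (lebesgueTypeR R).
Local Notation I := (@I R).
Hint Resolve measurable_I two_pi_gt0 : core.

Lemma ae_neq (a : R) : {ae mu, forall x, x <> a}.
Proof.
have neg : mu.-negligible [set a].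
  apply/negligibleP; first by apply: lebesgue_measurable_borel; exact: measurable_set1.
  exact: (lebesgue_measure_set1 a).
by apply: (negligibleS _ neg) => x /= /contrapT.
Qed.

(** The end points of the period form a null set; this is what allows statements
    about the open interval to be used under the integral. *)
Lemma ae_interior (P : R -> Prop) : (forall x, 0 < x < 2 * pi -> P x) ->
  {ae mu, forall x, I x -> P x}.
Proof.
move=> Pin.
apply: (@filterS2 _ _ (ae_filter_ringOfSetsType mu) _ _ _ _ (ae_neq 0) (ae_neq (2 * pi))).
move=> x /eqP x0 /eqP xp; rewrite /I /= in_itv/= => /andP[h1 h2].
by apply: Pin; rewrite !lt_neqAle eq_sym x0 h1 xp h2.
Qed.

Lemma measurable_indic_on_I (A : set R) : measurable A -> measurable_on_I (\1_A : R -> R).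
Proof.
move=> mA; have mA' : measurable (A : set lR) by exact: lebesgue_measurable_borel.
exact: measurable_funTS.
Qed.

Lemma measurable_interior f g : measurable_on_I g -> (forall x, 0 < x < 2 * pi -> g x = f x) ->
  measurable_on_I f.
Proof.
move=> mg gf.
have ms (a c : R) : measurable_on_I (fun x => \1_[set a] x * c).
  by apply: measurable_funM; [exact: measurable_indic_on_I|exact: measurable_cst].
pose g' (x : R) := \1_[set 0] x * (f 0 - g 0) +
  \1_[set 2 * pi] x * (f (2 * pi) - g (2 * pi)) + g x.
have mg' : measurable_on_I g' by apply: (measurable_funD _ mg); exact: (measurable_funD (ms _ _) (ms _ _)).
suff e : {in I, g' =1 f} by exact: (@eq_measurable_fun _ _ lR R I g' f e mg').
have p0 := @two_pi_gt0 R.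
move=> x /set_mem Ix; rewrite /g' !indicE.
have [->|x0] := eqVneq x 0.
  rewrite mem_set// memNset/=; last by move=> e; move: p0; rewrite -e ltxx.
  by rewrite mul1r mul0r addr0 subrK.
have [->|xp] := eqVneq x (2 * pi).
  rewrite memNset/=; last by move=> e; move: p0; rewrite e ltxx.
  by rewrite mem_set// mul1r mul0r add0r subrK.
rewrite !memNset/=; [|exact/eqP..].
rewrite !mul0r !add0r gf//; move: Ix; rewrite /I /= in_itv/= => /andP[h1 h2].
by rewrite !lt_neqAle eq_sym x0 h1 xp h2.
Qed.

Lemma eq_J_ae f g : measurable_on_I f -> measurable_on_I g ->
  {ae mu, forall x, I x -> f x = g x} -> J f = J g.
Proof.
move=> mf mg fg.
have mEf : measurable_fun (I : set lR) (EFin \o f) by apply/measurable_EFinP.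
have mEg : measurable_fun (I : set lR) (EFin \o g) by apply/measurable_EFinP.
rewrite /J /Rintegral; congr fine.
apply: (@ae_eq_integral _ lR R mu I (EFin \o g) (EFin \o f) measurable_I mEf mEg).
by apply: (@filterS _ _ (ae_filter_ringOfSetsType mu) _ _ _ fg) => x h /h /= ->.
Qed.

Lemma J_dominated (f_ : nat -> R -> R) f g : (forall n, measurable_on_I (f_ n)) ->
  measurable_on_I f -> L1 g -> (forall n x, I x -> `|f_ n x| <= g x) ->
  (forall x, 0 < x < 2 * pi -> f_ n x @[n --> \oo] --> f x) ->
  J (f_ n) @[n --> \oo] --> J f.
Proof.
move=> mf_ mf g1 fg ff.
have mEf_ n : measurable_fun (I : set lR) (EFin \o f_ n) by apply/measurable_EFinP; exact: mf_.
have mEf : measurable_fun (I : set lR) (EFin \o f) by exact/measurable_EFinP.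
have f_1 n : L1 (f_ n) by exact: L1_le (mf_ n) g1 (fg n).
have [||] := @dominated_convergence _ lR R mu I measurable_I (fun n => EFin \o f_ n) (EFin \o f) (EFin \o g) mEf_ mEf _ g1 _.
- apply: (@filterS _ _ (ae_filter_ringOfSetsType mu) _ _ _ (ae_interior ff)) => x h Ix.
  by apply: cvg_EFin; [exact: nearW|exact: h].
- by apply: aeW => x n Ix /=; rewrite lee_fin fg.
move=> f1 _ cv; apply: fine_cvg; rewrite (EFin_J f1); exact: cv.
Qed.

End AlmostEverywhere.

(** * Fourier coefficients of functions in H4 *)

Section IntegrationByParts.
Context {R : realType}.
Implicit Types (f g u v w phi : R -> R).

Local Notation mu := (@completed_lebesgue_measure R).
Local Notation lR := (lebesgueTypeR R).
Local Notation I := (@I R).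
Hint Resolve measurable_I two_pi_gt0 : core.

(** The boundary terms cancel by periodicity. *)
Lemma periodic_by_parts (F f phi dphi : R -> R) :
  derivable_oo_LRcontinuous F 0 (2 * pi) -> {in `]0, 2 * pi[, derive1 F =1 f} ->
  {within I, continuous f} -> F 0 = F (2 * pi) ->
  (forall x : R, is_derive x 1 phi (dphi x)) -> continuous dphi -> phi (2 * pi) = phi 0 ->
  J (fun x => f x * phi x) = - J (fun x => F x * dphi x).
Proof.
move=> dF Ff cf F0p dphiE cdphi phi0p.
have cphi : continuous phi by move=> x; exact: is_derive_continuous (dphiE x).
have cF := derivable_oo_LRcontinuous_within dF.
have i1 : L1 (fun x => f x * phi x).
  by apply: L1M_continuous; [exact: continuous_on_L1|exact: continuous_subspaceT].
have i2 : L1 (fun x => F x * dphi x).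
  by apply: L1M_continuous; [exact: continuous_on_L1|exact: continuous_subspaceT].
apply/eqP; rewrite -subr_eq0 opprK -(JD i1 i2); apply/eqP.
transitivity ((fun x => F x * phi x) (2 * pi) - (fun x => F x * phi x) 0); last first.
  by rewrite /= F0p phi0p subrr.
apply: (@integral_derivative R 0 (2 * pi) (fun x => f x * phi x + F x * dphi x)
  (fun x => F x * phi x)) => //.
- move=> x; apply: cvgD; apply: cvgM.
  + exact: cf.
  + exact: (continuous_subspaceT cphi).
  + exact: cF.
  + exact: (continuous_subspaceT cdphi).
- case: dF => dF F0 Fp; split.
  + by move=> x xI; apply: derivableM; [exact: dF|exact: ex_derive].
  + by apply: cvgM => //; exact: cvg_at_right_filter (cphi 0).
  + by apply: cvgM => //; exact: cvg_at_left_filter (cphi _).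
- move=> x xI; have [dF' _ _] := dF; have Fx := Ff x xI.
  have h : is_derive x 1 F (f x) by apply: DeriveDef; [exact: dF'|rewrite -derive1E].
  by rewrite derive1E; have h2 := is_deriveM_fun h (dphiE x); exact: derive_val.
Qed.

Lemma indicator_itv_J f (x y : R) : 0 <= x -> y <= 2 * pi ->
  \int[mu]_(t in `[x, y]) f t = J (fun t => \1_`[x, y] t * f t).
Proof.
move=> x0 yp; rewrite -[in LHS](@setIidr _ I `[x, y]); last first.
  by move=> z; rewrite /I /= !in_itv/= => /andP[? ?]; apply/andP; split; lra.
rewrite Rintegral_mkcondr; apply: eq_J => z _; rewrite patchE indicE.
by case: ifP => _; rewrite ?mul1r ?mul0r.
Qed.

Lemma indic_le1 (A : set R) x : `|\1_A x| <= 1 :> R.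
Proof. by rewrite indicE; case: (_ \in _); rewrite ?normr1 ?normr0. Qed.

(** Here w is absolutely continuous and need not be differentiable everywhere, so the
    product rule is unavailable. Instead w is written as an integral of f, and
    Fubini exchanges it with the integral of dphi. *)
Lemma ac_by_parts (w f phi dphi : R -> R) : L1 f ->
  {within I, continuous w} -> w 0 = w (2 * pi) ->
  (forall x y, 0 < x -> x <= y -> y < 2 * pi -> w y - w x = \int[mu]_(t in `[x, y]) f t) ->
  (forall x : R, is_derive x 1 phi (dphi x)) -> continuous dphi -> phi (2 * pi) = phi 0 ->
  J (fun x => f x * phi x) = - J (fun x => w x * dphi x).
Proof.
move=> f1 cw w0p wf dphiE cdphi phi0p.
have p0 := @two_pi_gt0 R; have pp := @pi_gt0 R; have mf := L1_measurable f1.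
have cphi : continuous phi by move=> x; exact: is_derive_continuous (dphiE x).
have mI01 (x y : R) : measurable_on_I (\1_`[x, y] : R -> R).
  by apply: measurable_indic_on_I; exact: measurable_itv.
(* J f is the limit of w (2 * pi - d n) - w (d n) *)
have Jf0 : J f = 0.
  pose d (n : nat) : R := n.+1%:R^-1.
  have d0 : d n @[n --> \oo] --> 0 by exact: cvg_harmonic.
  have dgt n : 0 < d n by rewrite invr_gt0.
  have dle n : d n <= 1 by rewrite invf_le1// ler1n.
  have p2 := @pi_ge2 R.
  have cvJ : J (fun t => \1_`[d n, 2 * pi - d n] t * f t) @[n --> \oo] --> J f.
    apply: (@J_dominated _ _ _ (fun t => `|f t|)).
    - by move=> n; exact: (measurable_funM (mI01 _ _) mf).
    - by [].
    - exact: L1_norm.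
    - by move=> n x _; rewrite normrM ler_piMl// indic_le1.
    - move=> x /andP[x0 xp]; apply: cvg_near_cst.
      have xp' : 0 < 2 * pi - x by rewrite subr_gt0.
      have dx : \forall n \near \oo, d n < x by apply: (cvgr_lt _ d0).
      have dxp : \forall n \near \oo, d n < 2 * pi - x by apply: (cvgr_lt _ d0).
      apply: filterS2 dx dxp => n dx dxp.
      by rewrite indicE mem_set ?mul1r//= in_itv/=; apply/andP; split; lra.
  have cvw : w (2 * pi - d n) - w (d n) @[n --> \oo] --> w (2 * pi) - w 0.
    have [_ cl cr] := (continuous_within_itvP w p0).1 cw.
    apply: cvgB.
      apply: (cvg_at_leftP w (2 * pi) (w (2 * pi))).1 => //; split; first by move=> n; rewrite ltrBlDr ltrDl.
      by rewrite -[X in _ --> X]subr0; apply: cvgB => //; exact: cvg_cst.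
    exact: (cvg_at_rightP w 0 (w 0)).1.
  rewrite -(subrr (w 0)) {1}w0p; apply: (cvg_unique (@Rhausdorff R) cvJ).
  apply: cvg_trans cvw; apply: near_eq_cvg; near=> n.
  rewrite wf ?indicator_itv_J//; have := dgt n; have := dle n; lra.
(* the increments of w are only known between interior points, so w is
   recovered from its value at pi: w x = w pi + J (k x * f) *)
pose k (x y : R) : R := \1_`[0, x] y - \1_`[0, pi] y.
have JI x y : L1 (fun t => \1_`[x, y] t * f t).
  by have := L1M_bounded f1 (mI01 x y) (fun z _ => indic_le1 _ z); apply: eq_L1 => z _; rewrite mulrC.
have kJ x : J (fun y => k x y * f y) = J (fun y => \1_`[0, x] y * f y) - J (fun y => \1_`[0, pi] y * f y).
  by rewrite -(JB (JI 0 x) (JI 0 pi)); apply: eq_J => y _; rewrite /k mulrBl.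
(* adjacent closed intervals share one point, which has measure zero *)
have add x y : 0 <= x -> x <= y ->
    J (fun t => \1_`[x, y] t * f t) = J (fun t => \1_`[0, y] t * f t) - J (fun t => \1_`[0, x] t * f t).
  move=> x0 xy; rewrite -(JB (JI 0 y) (JI 0 x)); apply: eq_J_ae.
  - exact: L1_measurable (JI x y).
  - exact: L1_measurable (L1B (JI 0 y) (JI 0 x)).
  apply: (@filterS _ _ (ae_filter_ringOfSetsType mu) _ _ _ (ae_neq x)) => z /eqP zx Iz.
  have z0 : 0 <= z by move: Iz; rewrite /I /= in_itv/= => /andP[].
  rewrite -mulrBl !indicE !mem_setE !in_itv/= z0/=.
  case: (ltgtP z x) zx => // zx _; last by rewrite subr0.
  by rewrite (le_trans (ltW zx) xy) !subrr.
have wk x : 0 < x < 2 * pi -> w x = w pi + J (fun y => k x y * f y).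
  move=> /andP[x0 xp]; rewrite kJ; have [xpi|pix] := leP x pi.
    have pip : pi < 2 * pi :> R by lra.
    have := wf x pi x0 xpi pip.
    rewrite (indicator_itv_J f (ltW x0) (ltW pip)) (add x pi (ltW x0) xpi); lra.
  have := wf pi x pp (ltW pix) xp.
  rewrite (indicator_itv_J f (ltW pp) (ltW xp)) (add pi x (ltW pp) (ltW pix)); lra.
have dphi1 : L1 dphi by exact: continuous_L1.
have Jdphi : J dphi = 0 by rewrite (J_derive cdphi dphiE) phi0p subrr.
pose A x := J (fun y => k x y * f y).
have mA : measurable_on_I A.
  have cw' : L1 (fun x => w x - w pi) by apply: L1B; [exact: continuous_on_L1|exact: L1_cst].
  by apply: (measurable_interior (L1_measurable cw')) => x xI; rewrite (wk x xI) addrC addKr.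
have k2 x y : `|k x y| <= 2 by rewrite (le_trans (ler_normB _ _))// (lerD (indic_le1 _ _) (indic_le1 _ _)).
have mk1 x : measurable_on_I (k x) by exact: (measurable_funB (mI01 0 x) (mI01 0 pi)).
have kf1 x : L1 (fun y => k x y * f y).
  by have := L1M_bounded f1 (mk1 x) (fun z _ => k2 x z); apply: eq_L1 => z _; rewrite mulrC.
have A1 : L1 (fun x => dphi x * A x).
  apply: (L1M_bounded dphi1 mA (M := J (fun y => 2 * `|f y|))) => x Ix.
  apply: (J_norm_le (L1_measurable (kf1 x)) (L1Z 2 (L1_norm f1))) => y _.
  by rewrite normrM ler_wpM2r.
have -> : J (fun x => w x * dphi x) = J (fun x => w pi * dphi x + dphi x * A x).
  apply: eq_J_ae.
  - by apply: L1_measurable; have := L1M_continuous dphi1 cw; apply: eq_L1 => x _; rewrite mulrC.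
  - exact: L1_measurable (L1D (L1Z (w pi) dphi1) A1).
  - by apply: ae_interior => x /wk ->; rewrite /A; ring.
rewrite (JD (L1Z (w pi) dphi1) A1) (JZ _ dphi1) Jdphi mulr0 add0r.
have [M M0 dM] := continuous_on_bounded (continuous_subspaceT cdphi (A := I)).
have -> : J (fun x => dphi x * A x) = J (fun x => J (fun y => dphi x * k x y * f y)).
  by apply: eq_J => x _; rewrite -(JZ _ (kf1 x)); apply: eq_J => y _; rewrite mulrA.
rewrite (@fubini_kernel _ (fun x y => dphi x * k x y) f (M * 2)) //; last first.
- by move=> x y Ix _; rewrite normrM ler_pM// dM.
- have itvE (x y : R) : \1_`[0, x] y = if (0 <= y) && (y <= x) then 1 else 0 :> R.
    by rewrite indicE mem_setE in_itv/=; case: ifP.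
  apply: measurable_funM; first exact: (measurableT_comp (continuous_measurable_fun cdphi) measurable_fst).
  rewrite /k; under eq_fun do rewrite !itvE.
  apply: measurable_funB; apply: measurable_fun_ifT => //; apply: measurable_and => //;
    apply: measurable_fun_ler => //.
have if2 : L1 (fun y => (phi (2 * pi) - phi y) * f y).
  have c : {within I, continuous (fun y => phi (2 * pi) - phi y)}.
    by apply: continuous_subspaceT => y; apply: cvgB; [exact: cvg_cst|exact: cphi].
  by have := L1M_continuous f1 c; apply: eq_L1 => y _; rewrite mulrC.
have inner y : 0 < y < 2 * pi -> (phi (2 * pi) - phi y) * f y = J (fun x => dphi x * k x y) * f y.
  move=> /andP[y0 yp]; congr (_ * _).
  have i1 : L1 (fun x => \1_`[y, 2 * pi] x * dphi x).
    have := L1M_bounded dphi1 (mI01 y (2 * pi)) (fun z _ => indic_le1 _ z).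
    by apply: eq_L1 => z _; rewrite mulrC.
  have -> : J (fun x => dphi x * k x y) = J (fun x => 1 * (\1_`[y, 2 * pi] x * dphi x) + (- \1_`[0, pi] y) * dphi x).
    apply: eq_J => x /set_mem; rewrite /I /= in_itv/= => /andP[x0 xp].
    by rewrite /k !indicE !mem_setE !in_itv/= (ltW y0) xp andbT/=; ring.
  rewrite (J_comb _ _ i1 dphi1) Jdphi mulr0 addr0 mul1r -(indicator_itv_J _ (ltW y0) (lexx _)).
  apply/esym/integral_derivative => //.
  - exact: continuous_subspaceT.
  - exact: derive_LRcontinuous.
  - by move=> x _; rewrite derive1E; exact: derive_val.
rewrite -(eq_J_ae (L1_measurable if2) (measurable_interior (L1_measurable if2) inner) (ae_interior inner)).
have i3 : L1 (fun y => f y * phi y) by apply: L1M_continuous => //; exact: continuous_subspaceT.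
have -> : J (fun y => (phi (2 * pi) - phi y) * f y) = J (fun y => phi (2 * pi) * f y + -1 * (f y * phi y)).
  by apply: eq_J => y _; ring.
by rewrite (J_comb _ _ f1 i3) Jf0 mulr0 add0r mulN1r opprK.
Unshelve. all: by end_near.
Qed.

(** The derivatives of a function of H4 are controlled only inside the period, with a
    common limit c at both ends; giving them that value at the ends makes them
    continuous on the closed interval. *)
Definition close_ends (c : R) f (x : R) := if (0 < x) && (x < 2 * pi) then f x else c.

Lemma close_ends_in c f (x : R) : 0 < x < 2 * pi -> close_ends c f x = f x.
Proof. by rewrite /close_ends => ->. Qed.

Lemma close_ends0 c f : close_ends c f 0 = c.
Proof. by rewrite /close_ends ltxx. Qed.

Lemma close_endsp c f : close_ends c f (2 * pi) = c.
Proof. by rewrite /close_ends ltxx andbF. Qed.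

Lemma near_interior (x : R) : 0 < x < 2 * pi -> \forall z \near x, 0 < z < 2 * pi.
Proof.
move=> /andP[x0 xp]; near=> z; apply/andP; split; near: z; [exact: lt_nbhsr|exact: lt_nbhsl].
Unshelve. all: by end_near.
Qed.

Lemma close_ends_limits c f : f x @[x --> 0^'+] --> c -> f x @[x --> (2 * pi)^'-] --> c ->
  close_ends c f x @[x --> 0^'+] --> close_ends c f 0 /\
  close_ends c f x @[x --> (2 * pi)^'-] --> close_ends c f (2 * pi).
Proof.
rewrite close_ends0 close_endsp => c0 cp; split.
- apply: cvg_trans c0; apply: near_eq_cvg; near=> z; rewrite close_ends_in//.
  by apply/andP; split; near: z; [exact: nbhs_right_gt|exact: nbhs_right_lt two_pi_gt0].
- apply: cvg_trans cp; apply: near_eq_cvg; near=> z; rewrite close_ends_in//.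
  by apply/andP; split; near: z; [exact: nbhs_left_gt two_pi_gt0|exact: nbhs_left_lt].
Unshelve. all: by end_near.
Qed.

Lemma close_ends_derivable c f : f x @[x --> 0^'+] --> c -> f x @[x --> (2 * pi)^'-] --> c ->
  (forall x, 0 < x < 2 * pi -> derivable f x 1) ->
  derivable_oo_LRcontinuous (close_ends c f) 0 (2 * pi) /\
  {in `]0, 2 * pi[, derive1 (close_ends c f) =1 derive1 f}.
Proof.
move=> c0 cp df; have [e0 ep] := close_ends_limits c0 cp.
have ne x : 0 < x < 2 * pi -> \near x, f x = close_ends c f x.
  by move=> xI; apply: filterS (near_interior xI) => z zI; rewrite close_ends_in.
split; last first.
  by move=> x /[!in_itv]/= xI; rewrite !derive1E; apply/esym; exact: (near_eq_derive _ (ne x xI)).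
split; [|exact: e0|exact: ep].
move=> x /[!in_itv]/= xI; exact: (near_eq_derivable (ne x xI) (df x xI)).
Qed.

Lemma fourier_ac_derivative (w f : R -> R) (k : int) : L1 f ->
  {within I, continuous w} -> w 0 = w (2 * pi) ->
  (forall x y, 0 < x -> x <= y -> y < 2 * pi -> w y - w x = \int[mu]_(t in `[x, y]) f t) ->
  fc f k%:~R = k%:~R * fs w k%:~R /\ fs f k%:~R = - (k%:~R * fc w k%:~R).
Proof.
move=> f1 cw w0p wf; have w1 := continuous_on_L1 cw.
have cp : cos (k%:~R * (2 * pi)) = cos (k%:~R * 0) :> R by rewrite -[2 * pi]add0r cos_periodic.
have sp : sin (k%:~R * (2 * pi)) = sin (k%:~R * 0) :> R by rewrite -[2 * pi]add0r sin_periodic.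
have cdc : continuous (fun x : R => - (k%:~R * sin (k%:~R * x))).
  by move=> x; apply: cvgN; apply: cvgM; [exact: cvg_cst|exact: continuous_sinM].
have cds : continuous (fun x : R => k%:~R * cos (k%:~R * x)).
  by move=> x; apply: cvgM; [exact: cvg_cst|exact: continuous_cosM].
split.
- rewrite /fc (ac_by_parts f1 cw w0p wf (is_derive_cosM k%:~R) cdc cp).
  rewrite -(JZ _ (L1_sin k%:~R w1)) -[LHS]mulN1r -JZ; last first.
    by apply: L1M_continuous => //; exact: continuous_subspaceT.
  by apply: eq_J => x _; ring.
- rewrite /fs (ac_by_parts f1 cw w0p wf (is_derive_sinM k%:~R) cds sp).
  rewrite -(JZ _ (L1_cos k%:~R w1)); congr (- _).
  by apply: eq_J => x _; ring.
Qed.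

Lemma J_indic_itv (x y : R) : 0 <= x -> x <= y -> y <= 2 * pi -> J (\1_`[x, y] : R -> R) = y - x.
Proof.
move=> x0 xy yp; have mA : measurable (`[x, y]%classic : set lR).
  by apply: lebesgue_measurable_borel; exact: measurable_itv.
have e : (\int[mu]_(t in I) (\1_`[x, y] t)%:E = mu (`[x, y]%classic `&` I))%E.
  exact: integral_indic.
have AI : `[x, y]%classic `<=` I.
  by move=> z; rewrite /I /= !in_itv/= => /andP[? ?]; apply/andP; split; lra.
rewrite /J /Rintegral e setIidl//.
have -> : mu `[x, y]%classic = lebesgue_measure `[x, y]%classic by [].
rewrite lebesgue_measure_itv/= lte_fin; move: xy; rewrite le_eqVlt => /predU1P[->|->].
  by rewrite ltxx subrr.
by rewrite -EFinB.
Qed.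

(** A Cauchy-Schwarz estimate without square roots: |f| <= t f^2 + 1 / t pointwise.
    Optimising in t gives the usual Holder bound. *)
Lemma Ltwo_itv_le f (t x y : R) : Ltwo f -> 0 < t -> 0 <= x -> x <= y -> y <= 2 * pi ->
  `|\int[mu]_(z in `[x, y]) f z| <= t * J (fun z => f z ^+ 2) + t^-1 * (y - x).
Proof.
move=> f2 t0 x0 xy yp; rewrite (indicator_itv_J f x0 yp).
have mA : measurable_on_I (\1_`[x, y] : R -> R) by apply: measurable_indic_on_I; exact: measurable_itv.
have i1 : L1 (\1_`[x, y] : R -> R) by apply: (L1_bounded (M := 1)) => // z _; exact: indic_le1.
have i2 : L1 (fun z => t * f z ^+ 2 + t^-1 * \1_`[x, y] z) by exact: L1D (L1Z t f2.2) (L1Z _ i1).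
rewrite -(J_indic_itv x0 xy yp) -(J_comb _ _ f2.2 i1).
apply: (J_norm_le (measurable_funM mA f2.1) i2) => z _.
rewrite /= indicE; case: (z \in _); rewrite ?mulr1n ?mulr0n; last by rewrite mul0r normr0 mulr0 addr0 mulr_ge0 ?sqr_ge0// ltW.
have tV : t * t^-1 = 1 by rewrite divff// gt_eqF.
have tV0 : 0 < t^-1 by rewrite invr_gt0.
rewrite mul1r mulr1 -(ler_pM2l t0) mulrDr tV -[in leLHS](gtr0_norm t0) -normrM.
have -> : t * (t * f z ^+ 2) = (t * f z) ^+ 2 by ring.
move: (t * f z) => a; have := sqr_ge0 (a + 1); have := sqr_ge0 (a - 1); have := sqr_ge0 a.
by rewrite ler_norml !expr2 => ? ? ?; apply/andP; split; lra.
Qed.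

Lemma fourier_derivative (F f : R -> R) (k : int) :
  derivable_oo_LRcontinuous F 0 (2 * pi) -> {in `]0, 2 * pi[, derive1 F =1 f} ->
  {within I, continuous f} -> F 0 = F (2 * pi) ->
  fc f k%:~R = k%:~R * fs F k%:~R /\ fs f k%:~R = - (k%:~R * fc F k%:~R).
Proof.
move=> dF Ff cf F0p; have F1 := continuous_on_L1 (derivable_oo_LRcontinuous_within dF).
have cp : cos (k%:~R * (2 * pi)) = cos (k%:~R * 0) :> R by rewrite -[2 * pi]add0r cos_periodic.
have sp : sin (k%:~R * (2 * pi)) = sin (k%:~R * 0) :> R by rewrite -[2 * pi]add0r sin_periodic.
have cdc : continuous (fun x : R => - (k%:~R * sin (k%:~R * x))).
  by move=> x; apply: cvgN; apply: cvgM; [exact: cvg_cst|exact: continuous_sinM].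
have cds : continuous (fun x : R => k%:~R * cos (k%:~R * x)).
  by move=> x; apply: cvgM; [exact: cvg_cst|exact: continuous_cosM].
split.
- rewrite /fc (periodic_by_parts dF Ff cf F0p (is_derive_cosM k%:~R) cdc cp).
  rewrite -(JZ _ (L1_sin k%:~R F1)) -[LHS]mulN1r -JZ; last first.
    by apply: L1M_continuous => //; exact: continuous_subspaceT.
  by apply: eq_J => x _; ring.
- rewrite /fs (periodic_by_parts dF Ff cf F0p (is_derive_sinM k%:~R) cds sp).
  rewrite -(JZ _ (L1_cos k%:~R F1)); congr (- _).
  by apply: eq_J => x _; ring.
Qed.

(** Each derivative multiplies fc - i fs by i k; four integrations by parts give
    the factor k^4. The last one is against the absolutely continuous third derivative. *)
Lemma H4_fourier u (k : int) : H4 u ->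
  [/\ Ltwo (derive1n 4 u), {within I, continuous u},
     exists2 u1 : R -> R, (forall x, 0 < x < 2 * pi -> u1 x = derive1 u x) &
       [/\ {within I, continuous u1}, fc u1 k%:~R = k%:~R * fs u k%:~R &
         fs u1 k%:~R = - (k%:~R * fc u k%:~R)],
     fc (derive1n 4 u) k%:~R = k%:~R ^+ 4 * fc u k%:~R &
     fs (derive1n 4 u) k%:~R = k%:~R ^+ 4 * fs u k%:~R].
Proof.
case=> [[_ /L2P u42] du du12 ac [u0p [c1 l1 r1] [c2 l2 r2] [c3 l3 r3]]].
have u41 := Ltwo_L1 u42.
pose v1 := close_ends c1 (derive1n 1 u); pose v2 := close_ends c2 (derive1n 2 u).
pose v3 := close_ends c3 (derive1n 3 u).
have [d1 d1E] := close_ends_derivable l1 r1 (fun x xI => (du12 x xI).1).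
have [d2 d2E] := close_ends_derivable l2 r2 (fun x xI => (du12 x xI).2).
have cu := derivable_oo_LRcontinuous_within du.
have cv1 : {within I, continuous v1} := derivable_oo_LRcontinuous_within d1.
have cv2 : {within I, continuous v2} := derivable_oo_LRcontinuous_within d2.
(* u''' need not be differentiable everywhere; its continuity comes from the
   integral of u'''' over short intervals being small *)
have cv3 : {within I, continuous v3}.
  have [e0 ep] := close_ends_limits l3 r3.
  apply/(continuous_within_itvP _ two_pi_gt0); split; [|exact: e0|exact: ep].
  move=> x /[!in_itv]/= xI; apply/cvgrPdist_le => e e0'.
  pose K := J (fun z => derive1n 4 u z ^+ 2).
  have K0 : 0 <= K by apply: J_ge0 => z _; exact: sqr_ge0.
  pose t := e / 2 / (K + 1).
  have t0 : 0 < t by rewrite !divr_gt0// ltr_wpDl.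
  have tK : t * K <= e / 2.
    rewrite /t -mulrA ler_piMr//; first by rewrite divr_ge0// ltW.
    by rewrite mulrC ler_pdivrMr ?ltr_wpDl// mul1r lerDl.
  near=> z; have zI : 0 < z < 2 * pi by near: z; exact: near_interior.
  have zx : `|x - z| <= e / 2 * t.
    by near: z; apply: cvgr_dist_le; [exact: cvg_id|rewrite mulr_gt0// divr_gt0].
  have bound a c : 0 < a < 2 * pi -> 0 < c < 2 * pi -> a <= c -> `|a - c| <= e / 2 * t ->
      `|derive1n 3 u c - derive1n 3 u a| <= e.
    move=> /andP[a0 ap] /andP[b0 bp] ab dab; rewrite ac//.
    apply: le_trans (Ltwo_itv_le u42 t0 (ltW a0) ab (ltW bp)) _.
    rewrite -/K; suff : t^-1 * (c - a) <= e / 2 by lra.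
    rewrite -(ler_pM2l t0) mulrA divff ?gt_eqF// mul1r mulrC.
    by rewrite -[c - a]ger0_norm ?subr_ge0// distrC.
  rewrite /v3 !close_ends_in//; case: (leP x z) => xz.
    by rewrite distrC bound.
  by rewrite bound ?(ltW xz)// distrC.
have E0 : {in `]0, 2 * pi[, derive1 u =1 v1}.
  by move=> x /[!in_itv]/= xI; rewrite /v1 close_ends_in.
have E1 : {in `]0, 2 * pi[, derive1 v1 =1 v2}.
  by move=> x xI; rewrite d1E//; move: xI => /[!in_itv]/= xI; rewrite /v2 close_ends_in.
have E2 : {in `]0, 2 * pi[, derive1 v2 =1 v3}.
  by move=> x xI; rewrite d2E//; move: xI => /[!in_itv]/= xI; rewrite /v3 close_ends_in.
have ends c f : close_ends c f 0 = close_ends c f (2 * pi) by rewrite close_ends0 close_endsp.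
have [fc1 fs1] := fourier_derivative k du E0 cv1 u0p.
have [fc2 fs2] := fourier_derivative k d1 E1 cv2 (ends _ _).
have [fc3 fs3] := fourier_derivative k d2 E2 cv3 (ends _ _).
have ac3 x y : 0 < x -> x <= y -> y < 2 * pi ->
    v3 y - v3 x = \int[mu]_(t in `[x, y]) derive1n 4 u t.
  move=> x0 xy yp; rewrite -ac// /v3 !close_ends_in//; apply/andP; split => //.
    exact: le_lt_trans yp.
  exact: lt_le_trans xy.
have [fc4 fs4] := fourier_ac_derivative k u41 cv3 (ends _ _) ac3.
split => //.
- by exists v1 => // x xI; rewrite /v1 close_ends_in.
- by rewrite fc4 fs3 fc2 fs1; ring.
- by rewrite fs4 fc3 fs2 fc1; ring.
Unshelve. all: by end_near.
Qed.

End IntegrationByParts.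

(** * The symbol of the differential operator *)

Section LinearProblem.
Context {R : realType}.
Implicit Types (f g u v K : R -> R).

Local Notation mu := (@completed_lebesgue_measure R).
Local Notation I := (@I R).
Hint Resolve measurable_I two_pi_gt0 : core.

Lemma derive1_fun f (df : R -> R) : (forall x : R, is_derive x 1 f (df x)) -> derive1 f = df.
Proof. by move=> fd; apply/funext => x; rewrite derive1E; exact: derive_val. Qed.

Lemma H4_smooth (u u1 u2 u3 u4 : R -> R) :
  (forall x : R, is_derive x 1 u (u1 x)) -> (forall x : R, is_derive x 1 u1 (u2 x)) ->
  (forall x : R, is_derive x 1 u2 (u3 x)) -> (forall x : R, is_derive x 1 u3 (u4 x)) ->
  continuous u4 -> u 0 = u (2 * pi) -> u1 0 = u1 (2 * pi) -> u2 0 = u2 (2 * pi) -> u3 0 = u3 (2 * pi) ->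
  [/\ H4 u, derive1 u = u1 & derive1n 4 u = u4].
Proof.
move=> d1 d2 d3 d4 c4 e0 e1 e2 e3.
have E1 := derive1_fun d1; have E2 := derive1_fun d2; have E3 := derive1_fun d3; have E4 := derive1_fun d4.
have En1 : derive1n 1 u = u1 by [].
have En2 : derive1n 2 u = u2 by rewrite /= E1 E2.
have En3 : derive1n 3 u = u3 by rewrite /= E1 E2 E3.
have En4 : derive1n 4 u = u4 by rewrite /= E1 E2 E3 E4.
split => //.
have c0 : continuous u by move=> x; exact: is_derive_continuous (d1 x).
have same (w dw : R -> R) : (forall x : R, is_derive x 1 w (dw x)) -> w 0 = w (2 * pi) -> same_end_limits w.
  move=> dE w0; exists (w 0).
    exact: cvg_at_right_filter (is_derive_continuous (dE 0)).
  by rewrite w0; exact: cvg_at_left_filter (is_derive_continuous (dE _)).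
rewrite /H4 En1 En2 En3 En4; split.
- by split; apply/L2P; exact: continuous_Ltwo.
- exact: derive_LRcontinuous d1.
- by move=> x _; split; exact: ex_derive.
- move=> x y x0; rewrite le_eqVlt => /predU1P[<- xp|xy yp].
    rewrite subrr (indicator_itv_J _ (ltW x0) (ltW xp)) -[LHS](mulr0 (2 * pi)) -J_cst.
    have m0 : measurable_on_I (fun=> 0 : R) by exact: measurable_cst.
    have m1 : measurable_on_I (fun t : R => \1_`[x, x] t * u4 t).
      apply: measurable_funM; last exact: L1_measurable (continuous_L1 c4).
      by apply: measurable_indic_on_I; exact: measurable_itv.
    apply: (eq_J_ae m0 m1); apply: (@filterS _ _ (ae_filter_ringOfSetsType mu) _ _ _ (ae_neq x)).
    move=> z zx _; rewrite indicE memNset ?mul0r//= in_itv/= => /andP[h1 h2].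
    by apply: zx; apply/eqP; rewrite eq_le h1 h2.
  apply/esym/integral_derivative => //.
  + exact: continuous_subspaceT.
  + exact: derive_LRcontinuous d4.
  + by move=> z _; rewrite E4.
- by split; [exact: e0|exact: same d2 e1|exact: same d3 e2|exact: same d4 e3].
Qed.

Section Symbol.
Variables (a b : R).
Hypotheses (b0 : b != 0).

(** (sym_re n) - i (sym_im n) is the symbol n^4 - a - i b n of the differential
    operator. *)
Definition sym_re (n : nat) : R := n%:R ^+ 4 - a.
Definition sym_im (n : nat) : R := b * n%:R.
Definition sym_sqr n : R := sym_re n ^+ 2 + sym_im n ^+ 2.

Lemma sym_sqr_eq0 n : sym_sqr n = 0 -> n = 0%N /\ a = 0.
Proof.
move=> /eqP; rewrite paddr_eq0 ?sqr_ge0// !sqrf_eq0 /sym_re /sym_im mulf_eq0 (negbTE b0)/= pnatr_eq0.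
by move=> /andP[+ /eqP n0]; rewrite n0 expr0n/= sub0r oppr_eq0 => /eqP.
Qed.

(** The symbol grows like n^4 and vanishes at most at n = 0. Both the four
    derivatives of the solution and its stability rest on this bound. *)
Lemma sym_sqr_ge : exists2 k : R, 1 <= k & forall n, sym_sqr n = 0 \/ 1 + n%:R ^+ 8 <= k * sym_sqr n.
Proof.
have bb : 0 < b ^+ 2 by rewrite exprn_even_gt0.
(* if n^4 >= 2 a, the real part alone is at least n^4 / 2; if n^4 < 2 a with
   n > 0, the imaginary part b n is at least b in absolute value; n = 0 leaves a^2 *)
pose k := 8 + 8 * (a ^+ 2 / b ^+ 2) + (a ^+ 2)^-1.
have q0 : 0 <= a ^+ 2 / b ^+ 2 by rewrite divr_ge0 ?sqr_ge0.
have i0 : 0 <= (a ^+ 2)^-1 by rewrite invr_ge0 sqr_ge0.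
exists k; first by rewrite /k; lra.
move=> [|n].
  rewrite /sym_sqr /sym_re /sym_im expr0n/= sub0r mulr0 expr0n/= addr0 sqrrN.
  have [->|an0] := eqVneq a 0; [by left; rewrite expr0n|right].
  have a20 : 0 < a ^+ 2 by rewrite exprn_even_gt0.
  have : (a ^+ 2)^-1 * a ^+ 2 <= k * a ^+ 2 by rewrite ler_pM2r// /k; lra.
  by rewrite mulVf ?gt_eqF// expr0n/= addr0.
right; set x : R := n.+1%:R ^+ 4.
have x1 : 1 <= n.+1%:R :> R by rewrite ler1n.
have n2 : 1 <= n.+1%:R ^+ 2 :> R by rewrite exprn_ege1.
have xg : 1 <= x by rewrite exprn_ege1.
have -> : n.+1%:R ^+ 8 = x ^+ 2 by rewrite /x -exprM.
have im : b ^+ 2 <= sym_im n.+1 ^+ 2 by rewrite /sym_im exprMn ler_peMr// ltW.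
have S0 : 0 <= sym_re n.+1 ^+ 2 by exact: sqr_ge0.
have [xa|xa] := leP (2 * a) x.
  have re : x ^+ 2 / 4 <= sym_re n.+1 ^+ 2 by rewrite /sym_re -/x !expr2; nra.
  apply: (@le_trans _ _ (8 * sym_sqr n.+1)).
    by rewrite /sym_sqr; nra.
  by rewrite ler_wpM2r ?addr_ge0 ?sqr_ge0// /k; lra.
apply: (@le_trans _ _ (8 * (a ^+ 2 / b ^+ 2) * b ^+ 2)).
  by rewrite -mulrA divfK ?gt_eqF// !expr2; nra.
apply: (@le_trans _ _ (k * b ^+ 2)); first by rewrite ler_wpM2r ?ltW// /k; lra.
by rewrite ler_wpM2l// /k/sym_sqr; lra.
Qed.

Implicit Types gc gs c s : nat -> R.

(** conv_re - i conv_im is the product of gc - i gs and c - i s; sol_c - i sol_s is its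
    quotient by the symbol. A vanishing symbol makes the quotient zero. *)
Definition conv_re gc gs c s n : R := gc n * c n - gs n * s n.
Definition conv_im gc gs c s n : R := gs n * c n + gc n * s n.
Definition sol_c gc gs c s n : R :=
  (sym_re n * conv_re gc gs c s n + sym_im n * conv_im gc gs c s n) / sym_sqr n.
Definition sol_s gc gs c s n : R :=
  (sym_re n * conv_im gc gs c s n - sym_im n * conv_re gc gs c s n) / sym_sqr n.

(** The modulus of a quotient is the quotient of the moduli. *)
Lemma sol_sqr gc gs c s n : sym_sqr n * (sol_c gc gs c s n ^+ 2 + sol_s gc gs c s n ^+ 2) =
  if sym_sqr n == 0 then 0 else (gc n ^+ 2 + gs n ^+ 2) * (c n ^+ 2 + s n ^+ 2).
Proof.
case: eqP => [->|/eqP S0]; first by rewrite mul0r.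
rewrite /sol_c /sol_s !expr_div_n -mulrDl mulrA; apply: (canLR (mulfK _)).
  by rewrite expf_eq0.
by rewrite /sym_sqr /conv_re /conv_im; ring.
Qed.

Lemma sol_uniq gc gs c s n (C S : R) : sym_sqr n != 0 ->
  sym_re n * C - sym_im n * S = conv_re gc gs c s n ->
  sym_re n * S + sym_im n * C = conv_im gc gs c s n ->
  C = sol_c gc gs c s n /\ S = sol_s gc gs c s n.
Proof.
rewrite /sol_c /sol_s => S0 <- <-.
by split; apply: (canRL (mulfK S0)); rewrite /sym_sqr; ring.
Qed.

Lemma sol_eq gc gs c s n : sym_sqr n != 0 ->
  sym_re n * sol_c gc gs c s n - sym_im n * sol_s gc gs c s n = conv_re gc gs c s n /\
  sym_re n * sol_s gc gs c s n + sym_im n * sol_c gc gs c s n = conv_im gc gs c s n.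
Proof.
by move=> S0; split; rewrite /sol_c /sol_s; move: S0; rewrite /sym_sqr => S0; field.
Qed.

(** The product of the coefficients of the kernel and of the source is split by the
    inequality of the means, with a weight t left free, to be adapted to the size of
    the source. It plays the part of the Cauchy-Schwarz inequality. *)
Lemma sol_bound : exists2 k : R, 0 < k & forall gc gs c s n (j : nat) (t : R), (j <= 4)%N -> 0 < t ->
  n%:R ^+ j * (`|sol_c gc gs c s n| + `|sol_s gc gs c s n|) <=
    k * (t * (gc n ^+ 2 + gs n ^+ 2) + t^-1 * (c n ^+ 2 + s n ^+ 2)).
Proof.
have [k k1 kS] := sym_sqr_ge; exists (2 * k); first lra.
move=> gc gs c s n j t j4 t0.
set C := sol_c gc gs c s n; set S := sol_s gc gs c s n.
pose x := t * (gc n ^+ 2 + gs n ^+ 2); pose y := t^-1 * (c n ^+ 2 + s n ^+ 2).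
have tV0 : 0 <= t^-1 by rewrite invr_ge0 ltW.
have x0 : 0 <= x := mulr_ge0 (ltW t0) (addr_ge0 (sqr_ge0 _) (sqr_ge0 _)).
have y0 : 0 <= y := mulr_ge0 tV0 (addr_ge0 (sqr_ge0 _) (sqr_ge0 _)).
(* the product x * y does not depend on t; t enters through the
   arithmetic-geometric mean inequality 4 x y <= (x + y)^2 *)
have CS : (1 + n%:R ^+ 8) * (C ^+ 2 + S ^+ 2) <= k * (x * y).
  have E := sol_sqr gc gs c s n; rewrite -/C -/S in E.
  have xy : x * y = (gc n ^+ 2 + gs n ^+ 2) * (c n ^+ 2 + s n ^+ 2).
    by rewrite /x /y mulrACA divff ?gt_eqF// mul1r.
  case: (kS n) => [S0|]; last first.
    move=> h; apply: (@le_trans _ _ (k * sym_sqr n * (C ^+ 2 + S ^+ 2))).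
      by apply: ler_wpM2r h; rewrite addr_ge0 ?sqr_ge0.
    rewrite -mulrA E xy ler_wpM2l//; first lra.
    by case: ifP => // _; rewrite -xy; exact: mulr_ge0.
  have -> : C = 0 by rewrite /C /sol_c S0 invr0 mulr0.
  have -> : S = 0 by rewrite /S /sol_s S0 invr0 mulr0.
  rewrite expr0n/= addr0 mulr0; apply: mulr_ge0; [lra|exact: mulr_ge0].
have nj : (n%:R ^+ j) ^+ 2 <= 1 + n%:R ^+ 8 :> R.
  rewrite -exprM; case: n {C S x y x0 y0 CS} => [|n].
    by rewrite expr0n [0 ^+ 8]expr0n/= addr0; case: (_ == _); rewrite ?ler01.
  rewrite (@le_trans _ _ (n.+1%:R ^+ 8))// ?lerDr//.
  by apply: ler_weXn2l; [rewrite ler1n|exact: (@leq_mul j 2 4 2)].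
rewrite -/x -/y.
have m0 : 0 <= n%:R ^+ j :> R by rewrite exprn_ge0.
rewrite -(ler_pXn2r (ltn0Sn 1)) ?nnegrE; last 2 first.
- by rewrite mulr_ge0// addr_ge0.
- by apply: mulr_ge0; [lra|exact: addr_ge0].
have CS2 : (`|C| + `|S|) ^+ 2 <= 2 * (C ^+ 2 + S ^+ 2).
  rewrite -(real_normK (num_real C)) -(real_normK (num_real S)).
  by have := sqr_ge0 (`|C| - `|S|); rewrite !expr2; lra.
have xy4 : 4 * (x * y) <= (x + y) ^+ 2 by have := sqr_ge0 (x - y); rewrite !expr2; lra.
rewrite !exprMn; apply: (@le_trans _ _ ((1 + n%:R ^+ 8) * (2 * (C ^+ 2 + S ^+ 2)))).
  by rewrite ler_pM// ?sqr_ge0.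
rewrite mulrCA; apply: (@le_trans _ _ (2 * (k * (x * y)))); first by rewrite ler_wpM2l.
have xy0 : 0 <= x * y by exact: mulr_ge0.
apply: (@le_trans _ _ (2 ^+ 2 * k ^+ 2 * (4 * (x * y)))); last by rewrite ler_wpM2l// mulr_ge0// sqr_ge0.
have kk : k <= k ^+ 2 by rewrite expr2 ler_peMl//; lra.
have : k * (x * y) <= k ^+ 2 * (x * y) by rewrite ler_wpM2r.
have : 0 <= k ^+ 2 * (x * y) by rewrite mulr_ge0// sqr_ge0.
by lra.
Qed.

End Symbol.
End LinearProblem.

(** * The solution operator of the linear problem *)

Section SolutionOperator.
Context {R : realType}.
Implicit Types (f g u v K : R -> R) (c s : nat -> R).

Local Notation mu := (@completed_lebesgue_measure R).
Local Notation I := (@I R).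
Hint Resolve measurable_I two_pi_gt0 : core.

Definition fcn f (n : nat) := fc f n%:R.
Definition fsn f (n : nat) := fs f n%:R.

Lemma fsn0 f : fsn f 0 = 0. Proof. exact: fs0. Qed.

Lemma sum_fourier_sqr_le f N : Ltwo f ->
  \sum_(n < N) (fcn f n ^+ 2 + fsn f n ^+ 2) <= 2 * pi * J (fun x => f x ^+ 2).
Proof.
move=> f2; apply: le_trans (ler_wpM2l (ltW two_pi_gt0) (bessel N f2)).
rewrite mulr_sumr; apply: ler_sum => n _; rewrite mulrA ler_peMl ?addr_ge0 ?sqr_ge0//.
have p0 := @pi_gt0 R; rewrite /weight; case: ifP => _; first by rewrite divff// gt_eqF// two_pi_gt0.
by rewrite mulfK ?gt_eqF// ler1n.
Qed.

Variables (a b : R).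
Hypotheses (b0 : b != 0).

Definition uc K f := sol_c a b (fcn K) (fsn K) (fcn f) (fsn f).
Definition us K f := sol_s a b (fcn K) (fsn K) (fcn f) (fsn f).
(** The solution of - u'''' + b u' + a u + conv K f = 0, obtained by
    dividing the coefficients of conv K f by the symbol. *)
Definition linsol K f : R -> R := fseries (uc K f) (us K f).

(** Up to the sign and the exchange of sines and cosines, the coefficients of the j-th
    derivative. *)
Definition pw (j : nat) c (n : nat) : R := n%:R ^+ j * c n.

Lemma us0 K f : us K f 0 = 0.
Proof.
have e : conv_im (fcn K) (fsn K) (fcn f) (fsn f) 0 = 0 by rewrite /conv_im !fsn0 mul0r mulr0 addr0.
have e2 : sym_im b 0 = 0 by rewrite /sym_im mulr0n mulr0.
by rewrite /us /sol_s e e2 mulr0 mul0r subr0 mul0r.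
Qed.

Lemma pw_us0 j K f : pw j (us K f) 0 = 0. Proof. by rewrite /pw us0 mulr0. Qed.

(** Both the kernel and the source have square summable coefficients, so their product
    is summable, and the symbol absorbs the factor n^j for j <= 4. *)
Lemma linsol_abs_sum : exists2 k : R, 0 < k & forall K f (j : nat) (t : R) N, Ltwo K -> Ltwo f ->
  (j <= 4)%N -> 0 < t ->
  abs_sum (pw j (uc K f)) (pw j (us K f)) N <=
    k * (t * J (fun x => K x ^+ 2) + t^-1 * J (fun x => f x ^+ 2)).
Proof.
have [k k0 kP] := sol_bound a b0; exists (k * (2 * pi)); first by rewrite mulr_gt0// two_pi_gt0.
move=> K f j t N K2 f2 j4 t0; have tV0 : 0 <= t^-1 by rewrite invr_ge0 ltW.
have -> : k * (2 * pi) * (t * J (fun x => K x ^+ 2) + t^-1 * J (fun x => f x ^+ 2)) =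
  k * (t * (2 * pi * J (fun x => K x ^+ 2)) + t^-1 * (2 * pi * J (fun x => f x ^+ 2))) by ring.
apply: (@le_trans _ _ (\sum_(n < N) k * (t * (fcn K n ^+ 2 + fsn K n ^+ 2) + t^-1 * (fcn f n ^+ 2 + fsn f n ^+ 2)))).
  apply: ler_sum => n _; rewrite /pw !(normrM (n%:R ^+ j)) !(ger0_norm (exprn_ge0 _ (ler0n _ _))) -mulrDr.
  exact: kP.
rewrite -mulr_sumr big_split/= -!mulr_sumr ler_pM2l// lerD//.
  by apply: (ler_wpM2l (ltW t0)); exact: sum_fourier_sqr_le.
by apply: (ler_wpM2l tV0); exact: sum_fourier_sqr_le.
Qed.

Lemma linsol_summable K f j : Ltwo K -> Ltwo f -> (j <= 4)%N ->
  summable_coefs (pw j (uc K f)) (pw j (us K f)).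
Proof.
move=> K2 f2 j4; have [k _ kP] := linsol_abs_sum.
exists (k * (1 * J (fun x => K x ^+ 2) + 1^-1 * J (fun x => f x ^+ 2))) => N.
exact: kP.
Qed.

Lemma pw0 c : pw 0 c = c.
Proof. by apply/funext => n; rewrite /pw expr0 mul1r. Qed.

(** Differentiation exchanges the sine and the cosine coefficients up to sign, which
    leaves the absolute sums unchanged. *)
Lemma abs_sum_swap c s c' s' N : (forall n, `|c' n| = `|s n|) -> (forall n, `|s' n| = `|c n|) ->
  abs_sum c' s' N = abs_sum c s N.
Proof. by move=> cc ss; apply: eq_bigr => n _; rewrite cc ss addrC. Qed.

(** Termwise differentiation, four times; the series is then C^4 and periodic. *)
Lemma fseries_H4 c s : (forall j, (j <= 4)%N -> summable_coefs (pw j c) (pw j s)) ->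
  [/\ H4 (fseries c s), derive1 (fseries c s) = fseries (dcos s) (dsin c) &
      derive1n 4 (fseries c s) = fseries (pw 4 c) (pw 4 s)].
Proof.
move=> cs; have sw j c' s' : (j <= 4)%N -> (forall n, `|c' n| = `|pw j s n|) ->
    (forall n, `|s' n| = `|pw j c n|) -> summable_coefs c' s'.
  by move=> j4 cc ss; have [A AP] := cs j j4; exists A => N; rewrite (abs_sum_swap _ cc ss).
have sm j c' s' : (j <= 4)%N -> (forall n, `|c' n| = `|pw j c n|) ->
    (forall n, `|s' n| = `|pw j s n|) -> summable_coefs c' s'.
  move=> j4 cc ss; have [A AP] := cs j j4; exists A => N; apply: le_trans (AP N).
  by apply: ler_sum => n _; rewrite cc ss.
have s0 : summable_coefs c s by apply: (sm 0%N) => // n; rewrite pw0.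
have s1 : summable_coefs (dcos s) (dsin c).
  by apply: (sw 1%N) => // n; rewrite /dcos /dsin /pw ?normrN expr1.
have s2 : summable_coefs (dcos (dsin c)) (dsin (dcos s)).
  by apply: (sm 2) => // n; rewrite /dcos /dsin /pw ?mulrN ?normrN mulrA -expr2.
have s3 : summable_coefs (dcos (dsin (dcos s))) (dsin (dcos (dsin c))).
  by apply: (sw 3) => // n; rewrite /dcos /dsin /pw ?mulrN ?opprK ?normrN !mulrA -expr2 -exprSr.
have E4c : dcos (dsin (dcos (dsin c))) = pw 4 c.
  by apply/funext => n; rewrite /dcos /dsin /pw; ring.
have E4s : dsin (dcos (dsin (dcos s))) = pw 4 s.
  by apply/funext => n; rewrite /dcos /dsin /pw; ring.
have s4 : summable_coefs (dcos (dsin (dcos (dsin c)))) (dsin (dcos (dsin (dcos s)))).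
  by rewrite E4c E4s; exact: cs.
have per c' s' : fseries c' s' 0 = fseries c' s' (2 * pi).
  by rewrite -[2 * pi]add0r fseries_periodic.
have [h4 h1 h] := H4_smooth (fun x => is_derive_fseries x s0 s1) (fun x => is_derive_fseries x s1 s2)
  (fun x => is_derive_fseries x s2 s3) (fun x => is_derive_fseries x s3 s4)
  (continuous_fseries s4) (per _ _) (per _ _) (per _ _) (per _ _).
by split => //; rewrite h E4c E4s.
Qed.

Lemma linsol_H4 K f : Ltwo K -> Ltwo f ->
  [/\ H4 (linsol K f), derive1 (linsol K f) = fseries (dcos (us K f)) (dsin (uc K f)) &
      derive1n 4 (linsol K f) = fseries (pw 4 (uc K f)) (pw 4 (us K f))].
Proof. by move=> K2 f2; apply: fseries_H4 => j; exact: linsol_summable. Qed.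

Lemma linsol_fourier K f n : Ltwo K -> Ltwo f ->
  fcn (linsol K f) n = uc K f n /\ fsn (linsol K f) n = us K f n.
Proof.
move=> K2 f2; have cs := linsol_summable K2 f2 (leq0n 4); rewrite !pw0 in cs.
by rewrite /fcn /fsn fc_fseries// fs_fseries// us0.
Qed.

Lemma linsol_sup : exists2 k : R, 0 < k & forall K f (t x : R), Ltwo K -> Ltwo f -> 0 < t ->
  `|linsol K f x| <= k * (t * J (fun x => K x ^+ 2) + t^-1 * J (fun x => f x ^+ 2)).
Proof.
have [k k0 kP] := linsol_abs_sum; exists k => // K f t x K2 f2 t0.
apply: fseries_le => N; have := kP K f 0%N t N K2 f2 isT t0; by rewrite !pw0.
Qed.

(** Parseval for the series, then the bound rho on the squared quotients, then Bessel
    for f. For j = 0 and j = 4 it bounds the L2 operator norms of f |-> linsol K f and of its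
    fourth derivative by the square root of rho. *)
Lemma linsol_pw_J j rho K f : Ltwo K -> Ltwo f -> (j <= 4)%N -> 0 <= rho ->
  (forall n : nat, (n%:R ^+ j) ^+ 2 * (fcn K n ^+ 2 + fsn K n ^+ 2) <= rho * sym_sqr a b n) ->
  J (fun x => fseries (pw j (uc K f)) (pw j (us K f)) x ^+ 2) <= rho * J (fun x => f x ^+ 2).
Proof.
move=> K2 f2 j4 r0 Kr; apply: J_fseries_sqr; [exact: pw_us0|exact: linsol_summable|move=> N].
apply: le_trans (ler_wpM2l r0 (bessel N f2)); rewrite mulr_sumr; apply: ler_sum => n _.
rewrite mulrCA; apply: (ler_wpM2l (ltW (weight_gt0 _))).
rewrite /pw !(exprMn _ (n%:R ^+ j)) -mulrDr -/(fcn f n) -/(fsn f n).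
have E := sol_sqr a b (fcn K) (fsn K) (fcn f) (fsn f) n.
have F0 : 0 <= fcn f n ^+ 2 + fsn f n ^+ 2 by rewrite addr_ge0 ?sqr_ge0.
have [S0|S0] := eqVneq (sym_sqr a b n) 0.
  have -> : uc K f n = 0 by rewrite /uc /sol_c S0 invr0 mulr0.
  have -> : us K f n = 0 by rewrite /us /sol_s S0 invr0 mulr0.
  by rewrite expr0n/= addr0 mulr0; exact: mulr_ge0.
have Spos : 0 < sym_sqr a b n by rewrite lt_neqAle eq_sym S0 addr_ge0 ?sqr_ge0.
rewrite (negbTE S0) in E.
rewrite -(ler_pM2l Spos) mulrCA E mulrA [leRHS]mulrA (mulrC _ rho).
exact: ler_wpM2r F0 _ _ (Kr n).
Qed.

Lemma linsol_J rho K f : Ltwo K -> Ltwo f -> 0 <= rho ->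
  (forall n : nat, fcn K n ^+ 2 + fsn K n ^+ 2 <= rho * sym_sqr a b n) ->
  J (fun x => linsol K f x ^+ 2) <= rho * J (fun x => f x ^+ 2).
Proof.
move=> K2 f2 r0 Kr; have := @linsol_pw_J 0 rho K f K2 f2 isT r0; rewrite !pw0; apply => n.
by rewrite expr0 expr1n mul1r.
Qed.

Lemma linsol_J4 rho K f : Ltwo K -> Ltwo f -> 0 <= rho ->
  (forall n : nat, (n%:R ^+ 4) ^+ 2 * (fcn K n ^+ 2 + fsn K n ^+ 2) <= rho * sym_sqr a b n) ->
  J (fun x => derive1n 4 (linsol K f) x ^+ 2) <= rho * J (fun x => f x ^+ 2).
Proof. by move=> K2 f2 r0 Kr; have [_ _ ->] := linsol_H4 K2 f2; exact: linsol_pw_J. Qed.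

Lemma fcnB f g n : L1 f -> L1 g -> fcn (fun x => f x - g x) n = fcn f n - fcn g n.
Proof.
move=> f1 g1; rewrite /fcn -[X in _ = _ + X]mulN1r -fc_lin//.
by apply: eq_J => x _; rewrite mulN1r.
Qed.

Lemma fsnB f g n : L1 f -> L1 g -> fsn (fun x => f x - g x) n = fsn f n - fsn g n.
Proof.
move=> f1 g1; rewrite /fsn -[X in _ = _ + X]mulN1r -fs_lin//.
by apply: eq_J => x _; rewrite mulN1r.
Qed.

Lemma linsolBr K f g (x : R) : Ltwo K -> Ltwo f -> Ltwo g ->
  linsol K f x - linsol K g x = linsol K (fun y => f y - g y) x.
Proof.
move=> K2 f2 g2; have f1 := Ltwo_L1 f2; have g1 := Ltwo_L1 g2.
have cf := linsol_summable K2 f2 (leq0n 4); have cg := linsol_summable K2 g2 (leq0n 4).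
rewrite !pw0 in cf cg; rewrite -(fseriesB x cf cg) /linsol.
congr (fseries _ _ x); apply/funext => n; rewrite /uc /us /sol_c /sol_s /conv_re /conv_im (fcnB n f1 g1) (fsnB n f1 g1); ring.
Qed.

Lemma linsolBl K L f (x : R) : Ltwo K -> Ltwo L -> Ltwo f ->
  linsol K f x - linsol L f x = linsol (fun y => K y - L y) f x.
Proof.
move=> K2 L2 f2; have K1 := Ltwo_L1 K2; have L1 := Ltwo_L1 L2.
have cf := linsol_summable K2 f2 (leq0n 4); have cg := linsol_summable L2 f2 (leq0n 4).
rewrite !pw0 in cf cg; rewrite -(fseriesB x cf cg) /linsol.
congr (fseries _ _ x); apply/funext => n; rewrite /uc /us /sol_c /sol_s /conv_re /conv_im (fcnB n K1 L1) (fsnB n K1 L1); ring.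
Qed.

End SolutionOperator.

(** * Existence and uniqueness in the linear problem *)

Section LinearEquation.
Context {R : realType}.
Implicit Types (f g u v K : R -> R).

Local Notation mu := (@completed_lebesgue_measure R).
Local Notation lR := (lebesgueTypeR R).
Local Notation I := (@I R).
Hint Resolve measurable_I two_pi_gt0 : core.

Variables (a b : R).
Hypotheses (b0 : b != 0).

Definition residual (u4 u1 u g : R -> R) (x : R) := - u4 x + b * u1 x + a * u x + g x.

Lemma fourier_residual (u4 u1 u g : R -> R) w : L1 u4 -> L1 u1 -> L1 u -> L1 g ->
  fc (residual u4 u1 u g) w = - fc u4 w + b * fc u1 w + a * fc u w + fc g w /\
  fs (residual u4 u1 u g) w = - fs u4 w + b * fs u1 w + a * fs u w + fs g w.
Proof.
move=> i4 i1 i0 ig.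
pose r2 x := g x + a * u x; pose r1 x := r2 x + b * u1 x.
have ir2 : L1 r2 by apply: L1D => //; exact: L1Z.
have ir1 : L1 r1 by apply: L1D => //; exact: L1Z.
have rE : residual u4 u1 u g = fun x => r1 x + -1 * u4 x.
  by apply/funext => x; rewrite /residual /r1 /r2; ring.
rewrite rE (fc_lin _ w ir1 i4) (fs_lin _ w ir1 i4) (fc_lin _ w ir2 i1) (fs_lin _ w ir2 i1).
by rewrite (fc_lin _ w ig i0) (fs_lin _ w ig i0); split; ring.
Qed.

(** The almost everywhere equation is integrated against cos and sin; the derivatives
    turn into powers of k and the convolution into a product. *)
Lemma equation_fourier K f v (k : int) : {within I, continuous K} -> K 0 = K (2 * pi) ->
  L1 f -> H4 v ->
  {ae mu, forall x, I x -> - derive1n 4 v x + b * derive1 v x + a * v x + conv K f x = 0} ->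
  (k%:~R ^+ 4 - a) * fc v k%:~R - b * k%:~R * fs v k%:~R =
    fc K k%:~R * fc f k%:~R - fs K k%:~R * fs f k%:~R /\
  (k%:~R ^+ 4 - a) * fs v k%:~R + b * k%:~R * fc v k%:~R =
    fs K k%:~R * fc f k%:~R + fc K k%:~R * fs f k%:~R.
Proof.
move=> cK K0p f1 v4 ae0.
have [v42 cv [v1 v1E [cv1 c1 s1]] c4 s4] := H4_fourier k v4.
have ig : L1 (conv K f) by apply: continuous_L1; exact: continuous_conv.
have i4 := Ltwo_L1 v42; have i1 := continuous_on_L1 cv1; have i0 := continuous_on_L1 cv.
have [cr sr] := fourier_residual k%:~R i4 i1 i0 ig.
have [cc ss] := fourier_conv cK K0p k f1.
have ir : L1 (residual (derive1n 4 v) v1 v (conv K f)).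
  have : L1 (fun x => (conv K f x + a * v x) + (b * v1 x - derive1n 4 v x)).
    by apply: L1D; [apply: L1D => //; exact: L1Z|apply: L1B => //; exact: L1Z].
  by apply: eq_L1 => x _; rewrite /residual; ring.
have r0 : {ae mu, forall x, I x -> residual (derive1n 4 v) v1 v (conv K f) x = 0}.
  have v1I : {ae mu, forall x, I x -> v1 x = derive1 v x} by exact: ae_interior.
  apply: (@filterS2 _ _ (ae_filter_ringOfSetsType mu) _ _ _ _ ae0 v1I) => x e1 e2 Ix.
  by rewrite /residual e2//; exact: e1.
have z0 : J (fun=> 0 : R) = 0 by rewrite J_cst mulr0.
have m0 : measurable_on_I (fun=> 0 : R) by exact: measurable_cst.
have fc0 : fc (residual (derive1n 4 v) v1 v (conv K f)) k%:~R = 0.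
  rewrite -[RHS]z0; apply: (eq_J_ae (L1_measurable (L1_cos _ ir)) m0).
  by apply: (@filterS _ _ (ae_filter_ringOfSetsType mu) _ _ _ r0) => x e Ix; rewrite e// mul0r.
have fs0 : fs (residual (derive1n 4 v) v1 v (conv K f)) k%:~R = 0.
  rewrite -[RHS]z0; apply: (eq_J_ae (L1_measurable (L1_sin _ ir)) m0).
  by apply: (@filterS _ _ (ae_filter_ringOfSetsType mu) _ _ _ r0) => x e Ix; rewrite e// mul0r.
move: cr sr; rewrite fc0 fs0 c4 s4 c1 s1 cc ss => e1 e2; split.
- by rewrite -[RHS]subr0 [X in _ = _ - X]e1; ring.
- by rewrite -[RHS]subr0 [X in _ = _ - X]e2; ring.
Qed.

Lemma fcn0 f : fcn f 0 = J f.
Proof. by apply: eq_J => x _; rewrite mul0r cos0 mulr1. Qed.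

(** Uniqueness in the linear problem: away from a zero of the symbol the equation
    determines the coefficients, and at such a zero the condition J v = 0 does. *)
Lemma solution_linsol K f v : {within I, continuous K} -> K 0 = K (2 * pi) ->
  L1 f -> Ltwo f -> H4 v -> (a = 0 -> J v = 0) ->
  {ae mu, forall x, I x -> - derive1n 4 v x + b * derive1 v x + a * v x + conv K f x = 0} ->
  forall x, I x -> v x = linsol a b K f x.
Proof.
move=> cK K0p f1 f2 v4 v0 veq.
have K2 : Ltwo K := continuous_on_Ltwo cK.
have [_ cv _ _ _] := H4_fourier 0 v4.
have cu : continuous (linsol a b K f).
  by have := linsol_summable a b0 K2 f2 (leq0n 4); rewrite !pw0; exact: continuous_fseries.
apply: (fourier_ext cv (continuous_subspaceT cu)) => n.
have [uC uS] := linsol_fourier a b0 n K2 f2.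
have {}uC : fc (linsol a b K f) n%:R = uc a b K f n := uC.
have {}uS : fs (linsol a b K f) n%:R = us a b K f n := uS.
rewrite uC uS.
(* where the symbol vanishes, n = 0 and a = 0, and the mean conditions
   replace the equation *)
have [S0|S0] := eqVneq (sym_sqr a b n) 0.
  have [n0 a0] := sym_sqr_eq0 b0 S0.
  have -> : uc a b K f n = 0 by rewrite /uc /sol_c S0 invr0 mulr0.
  have -> : us a b K f n = 0 by rewrite /us /sol_s S0 invr0 mulr0.
  by rewrite n0; split; [rewrite -(v0 a0); exact: fcn0|exact: fsn0].
have [e1 e2] := equation_fourier (n : int) cK K0p f1 v4 veq.
exact: sol_uniq S0 e1 e2.
Qed.

(** Existence in the linear problem. The equation holds everywhere, because the
    fourth derivative of linsol K f is continuous. *)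
Lemma linsol_equation K f : {within I, continuous K} -> K 0 = K (2 * pi) ->
  Ltwo f -> (a = 0 -> J K = 0) ->
  forall x, I x -> - derive1n 4 (linsol a b K f) x + b * derive1 (linsol a b K f) x +
    a * linsol a b K f x + conv K f x = 0.
Proof.
move=> cK K0p f2 K0; have K2 : Ltwo K := continuous_on_Ltwo cK; have f1 := Ltwo_L1 f2.
have [_ d1 d4] := linsol_H4 a b0 K2 f2.
have sm j : (j <= 4)%N -> summable_coefs (pw j (uc a b K f)) (pw j (us a b K f)).
  exact: linsol_summable.
have sm1 : summable_coefs (dcos (us a b K f)) (dsin (uc a b K f)).
  have [A AP] := sm 1%N isT; exists A => N; apply: le_trans (AP N).
  rewrite le_eqVlt; apply/orP; left; apply/eqP; apply: abs_sum_swap => n.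
    by rewrite /dcos /pw expr1.
  by rewrite /dsin /pw expr1 normrN.
have sm0 : summable_coefs (uc a b K f) (us a b K f) by have := sm 0%N isT; rewrite !pw0.
have cconv : continuous (conv K f) by exact: continuous_conv.
(* the residual is continuous, so the vanishing of its coefficients suffices *)
pose r := residual (fseries (pw 4 (uc a b K f)) (pw 4 (us a b K f)))
  (fseries (dcos (us a b K f)) (dsin (uc a b K f))) (linsol a b K f) (conv K f).
have cr : continuous r.
  move=> x; apply: cvgD; last exact: cconv.
  apply: cvgD; last by apply: cvgM; [exact: cvg_cst|exact: (continuous_fseries sm0)].
  apply: cvgD; first by apply: cvgN; exact: (continuous_fseries (sm 4 isT)).
  by apply: cvgM; [exact: cvg_cst|exact: (continuous_fseries sm1)].
move=> x Ix; rewrite d4 d1 -/(residual _ _ _ _ x) -/r.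
apply: (fourier_eq0 (continuous_subspaceT cr)) => // n.
have [-> ->] := fourier_residual n%:R (L1_fseries (sm 4 isT)) (L1_fseries sm1) (L1_fseries sm0) (continuous_L1 cconv).
have [cc ss] := fourier_conv cK K0p (n : int) f1; rewrite cc ss.
have [uC uS] := linsol_fourier a b0 n K2 f2.
have {}uC : fc (linsol a b K f) n%:R = uc a b K f n := uC.
have {}uS : fs (linsol a b K f) n%:R = us a b K f n := uS.
have ds0 : dsin (uc a b K f) 0 = 0 by rewrite /dsin mul0r oppr0.
rewrite uC uS (fc_fseries n (sm 4 isT)) (fc_fseries n sm1).
rewrite (fs_fseries n (pw_us0 a b 4 K f) (sm 4 isT)) (fs_fseries n ds0 sm1).
rewrite -/(fcn K n) -/(fcn f n) -/(fsn K n) -/(fsn f n) /dcos /dsin /pw.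
(* where the symbol vanishes, the mean of K vanishes as well *)
have [S0|S0] := eqVneq (sym_sqr a b n) 0.
  have [n0 a0] := sym_sqr_eq0 b0 S0.
  have -> : uc a b K f n = 0 by rewrite /uc /sol_c S0 invr0 mulr0.
  have -> : us a b K f n = 0 by rewrite /us /sol_s S0 invr0 mulr0.
  by rewrite n0 !fsn0 [fcn K 0]fcn0 K0//; split; ring.
have [e1 e2] := sol_eq (fcn K) (fsn K) (fcn f) (fsn f) S0.
move: e1 e2; rewrite /conv_re /conv_im /sym_re /sym_im -/(uc a b K f) -/(us a b K f) => <- <-.
by split; ring.
Qed.

End LinearEquation.

(** * The superposition operator *)

Section Nemytskii.
Context {R : realType}.
Implicit Types (f g u v h : R -> R) (F : R -> R -> R).

Local Notation mu := (@completed_lebesgue_measure R).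
Local Notation lR := (lebesgueTypeR R).
Local Notation I := (@I R).
Hint Resolve measurable_I two_pi_gt0 : core.

(** The superposition operator of F, named after Nemytskii. *)
Definition nemytskii F u (y : R) := F (u y) y.

(** The set I is a countable union of measurable pieces on which the first argument of
    F is constant. *)
Lemma measurable_countable_comp F (s : R -> int) (q : int -> R) :
  (forall c, measurable_on_I (F c)) ->
  (forall z, measurable (I `&` [set y | s y = z] : set lR)) ->
  measurable_on_I (fun y => F (q (s y)) y).
Proof.
move=> mF ms _ B mB.
have -> : I `&` (fun y => F (q (s y)) y) @^-1` B =
    \bigcup_z ((I `&` [set y | s y = z]) `&` (I `&` F (q z) @^-1` B)).
  apply/seteqP; split => [y [Iy /= By]|y [z _ [[Iy /= sz] [_ /= By]]]].
    by exists (s y).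
  by split => //=; rewrite sz.
apply: countable_bigcupT_measurable; first exact: countableP.
by move=> z; apply: measurableI => //; exact: mF.
Qed.

(** The Lipschitz bound makes F(u(y), y) a limit of compositions with rounded values of
    u. *)
Lemma measurable_nemytskii F (l : R) u : 0 <= l -> (forall c, measurable_on_I (F c)) ->
  (forall (u1 u2 x : R), I x -> `|F u1 x - F u2 x| <= l * `|u1 - u2|) ->
  measurable_on_I u -> measurable_on_I (nemytskii F u).
Proof.
move=> l0 mF lF mu_.
(* q n (s n y) is u y rounded down to a multiple of 1 / (n + 1): it takes
   countably many values, and for each fixed value F is measurable *)
pose s (n : nat) (y : R) : int := Num.floor (u y * n.+1%:R).
pose q (n : nat) (z : int) : R := z%:~R / n.+1%:R.
have near n y : `|q n (s n y) - u y| <= n.+1%:R^-1.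
  have n0 : 0 < n.+1%:R :> R by rewrite ltr0n.
  have /andP[h1 h2] := floor_itv (u y * n.+1%:R).
  rewrite -(ler_pM2r n0) mulVf ?gt_eqF// -[X in _ * X <= _](gtr0_norm n0) -normrM mulrBl divfK ?gt_eqF//.
  rewrite intrD in h2; rewrite ler_norml; apply/andP; split; rewrite /s; lra.
apply: (@measurable_fun_cvg _ lR R I (fun n y => F (q n (s n y)) y)).
- move=> n; apply: measurable_countable_comp => // z.
  have -> : I `&` [set y | s n y = z] = I `&` (fun y => u y * n.+1%:R) @^-1` `[z%:~R, (z + 1)%:~R[.
    apply/seteqP; split => y [Iy /= h]; split => //=; rewrite ?in_itv/=.
      by rewrite -h; exact: floor_itv.
    by apply: floor_def; move: h; rewrite in_itv/=.
  have mu' : measurable_on_I (fun y => u y * n.+1%:R).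
    by apply: measurable_funM => //; exact: measurable_cst.
  by apply: mu' => //; exact: measurable_itv.
- move=> y Iy; apply/cvgrPdist_le => e e0.
  have l1 : 0 < l + 1 by rewrite ltr_wpDl.
  have : \forall n \near \oo, n.+1%:R^-1 < e / (l + 1).
    by apply: (cvgr_lt _ (@cvg_harmonic R)); rewrite divr_gt0.
  apply: filterS => n; rewrite ltr_pdivlMr// => ne; rewrite distrC.
  rewrite (le_trans (lF _ _ _ Iy))//.
  apply: (@le_trans _ _ (l * n.+1%:R^-1)); first by rewrite ler_wpM2l.
  have : 0 <= n.+1%:R^-1 :> R by rewrite invr_ge0.
  move: ne; move: (n.+1%:R^-1) => i ne i0; rewrite mulrDr mulr1 in ne; rewrite mulrC; lra.
Qed.

Lemma Ltwo_nemytskii F (k l : R) h u : assumptionA F k l h -> {within I, continuous u} ->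
  Ltwo (nemytskii F u).
Proof.
move=> [[mF _] [k0 l0 /L2P h2 _] Fh Fl] cu.
have u2 := continuous_on_Ltwo cu.
have an : Ltwo (fun x => `|u x|).
  apply: continuous_on_Ltwo => x; apply: (cvg_norm (cu x)).
apply: (@Ltwo_le _ _ (fun x => k * `|u x| + h x)).
- exact: (measurable_nemytskii (ltW l0) mF Fl u2.1).
- by apply: LtwoD => //; exact: LtwoZ.
- by move=> x Ix; exact: Fh.
Qed.

Lemma nemytskii_lipschitz F (k l : R) h u v : assumptionA F k l h ->
  {within I, continuous u} -> {within I, continuous v} ->
  J (fun x => (nemytskii F u x - nemytskii F v x) ^+ 2) <= l ^+ 2 * J (fun x => (u x - v x) ^+ 2).
Proof.
move=> A cu cv; have Fu := Ltwo_nemytskii A cu; have Fv := Ltwo_nemytskii A cv.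
have uv := LtwoB (continuous_on_Ltwo cu) (continuous_on_Ltwo cv).
case: A => _ [_ l0 _ _] _ Fl.
rewrite -(JZ _ uv.2); apply: (le_J (LtwoB Fu Fv).2 (L1Z _ uv.2)) => x Ix.
rewrite -exprMn -[leLHS]real_normK ?num_real// -[leRHS]real_normK ?num_real//.
rewrite lerXn2r ?nnegrE// normrM (gtr0_norm l0); exact: Fl.
Qed.

Lemma geometric_cvg (x_ : nat -> R) (M q : R) : 0 <= q < 1 ->
  (forall j, `|x_ j.+1 - x_ j| <= M * q ^+ j) ->
  exists2 L : R, x_ n @[n --> \oo] --> L & forall j, `|L - x_ j| <= M / (1 - q) * q ^+ j.
Proof.
move=> /andP[q0 q1] xq; have q1' : 0 < 1 - q by lra.
pose r j := M / (1 - q) * q ^+ j.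
have rS j : r j - r j.+1 = M * q ^+ j.
  by rewrite /r exprS; field; rewrite gt_eqF.
have r0 : r n @[n --> \oo] --> 0.
  rewrite -[X in _ --> X](mulr0 (M / (1 - q))); apply: cvgM; first exact: cvg_cst.
  by apply: cvg_expr; rewrite ger0_norm.
pose y j := x_ j + r j; pose z j := x_ j - r j.
have xj j : x_ j.+1 - x_ j <= M * q ^+ j /\ - (M * q ^+ j) <= x_ j.+1 - x_ j.
  by have := xq j; rewrite ler_norml => /andP[].
have yd : nonincreasing_seq y.
  by apply/nonincreasing_seqP => j; have := xj j; have := rS j; rewrite /y; lra.
have zi : nondecreasing_seq z.
  by apply/nondecreasing_seqP => j; have := xj j; have := rS j; rewrite /z; lra.
have rge j : 0 <= r j.
  have M0 : 0 <= M by have := le_trans (normr_ge0 _) (xq 0%N); rewrite expr0 mulr1.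
  by rewrite mulr_ge0 ?divr_ge0 ?exprn_ge0// ltW.
have zc : cvgn z.
  apply: nondecreasing_is_cvgn => //; exists (y 0%N) => _ [j _ <-].
  have := yd _ _ (leq0n j); have := rge j; rewrite /y /z; lra.
pose L := limn z.
have xL : x_ n @[n --> \oo] --> L.
  have -> : x_ = fun n => z n + r n by apply/funext => n; rewrite /z subrK.
  by rewrite -[L]addr0; apply: cvgD.
have yL : y n @[n --> \oo] --> L by rewrite -[L]addr0; apply: cvgD.
exists L => // j.
have zL : z j <= L by exact: nondecreasing_cvgn_le.
have Ly : L <= y j.
  have yc : cvgn y by apply/cvg_ex; exists L.
  have := nonincreasing_cvgn_ge yd yc j; by rewrite (cvg_lim (@Rhausdorff R) yL).
by rewrite ler_norml; move: zL Ly; rewrite /z /y /r => ? ?; apply/andP; split; lra.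
Qed.

End Nemytskii.

(** * Existence and uniqueness in the nonlinear problem *)

Section FixedPoint.
Context {R : realType}.
Implicit Types (f g u v K : R -> R).

Local Notation mu := (@completed_lebesgue_measure R).
Local Notation lR := (lebesgueTypeR R).
Local Notation I := (@I R).
Hint Resolve measurable_I two_pi_gt0 : core.

Variables (a b : R) (F : R -> R -> R) (k l : R) (h : R -> R).
Hypotheses (b0 : b != 0) (hA : assumptionA F k l h).

Let l0 : 0 < l. Proof. by case: hA => _ []. Qed.

(** The assumptions on a kernel in the form used below: up to the normalisation
    of the coefficients, rho bounds the squared moduli of both quotients whose suprema
    define calN. *)
Definition admissible (rho : R) K :=
  [/\ {within I, continuous K}, K 0 = K (2 * pi), a = 0 -> J K = 0,
   forall n, fcn K n ^+ 2 + fsn K n ^+ 2 <= rho * sym_sqr a b n &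
   forall n, (n%:R ^+ 4) ^+ 2 * (fcn K n ^+ 2 + fsn K n ^+ 2) <= rho * sym_sqr a b n].

(** A function of H4 (of mean zero if a = 0) solves the nonlinear problem if and only if
    it agrees on I with its image under this map: a solution is the solution of the linear
    problem with source nemytskii F u. *)
Definition picard K u := linsol a b K (nemytskii F u).

Let NF u : {within I, continuous u} -> Ltwo (nemytskii F u) := Ltwo_nemytskii hA.

Lemma continuous_linsol K f : Ltwo K -> Ltwo f -> continuous (linsol a b K f).
Proof.
by move=> K2 f2; have := linsol_summable a b0 K2 f2 (leq0n 4); rewrite !pw0; exact: continuous_fseries.
Qed.

Lemma picard_contraction rho (s : R) K u v : admissible rho K -> 0 <= rho -> rho * l ^+ 2 <= s ->
  {within I, continuous u} -> {within I, continuous v} ->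
  J (fun x => (picard K u x - picard K v x) ^+ 2) <= s * J (fun x => (u x - v x) ^+ 2).
Proof.
move=> [cK _ _ K1 _] rho0 rs cu cv; have K2 := continuous_on_Ltwo cK.
have -> : J (fun x => (picard K u x - picard K v x) ^+ 2) =
    J (fun x => linsol a b K (fun y => nemytskii F u y - nemytskii F v y) x ^+ 2).
  apply: eq_J => x _; rewrite -linsolBr//; exact: NF.
have d0 : 0 <= J (fun x => (u x - v x) ^+ 2) by apply: J_ge0 => x _; exact: sqr_ge0.
apply: le_trans (linsol_J b0 K2 (LtwoB (NF cu) (NF cv)) rho0 K1) _.
apply: le_trans (ler_wpM2l rho0 (nemytskii_lipschitz hA cu cv)) _.
by rewrite mulrA ler_wpM2r.
Qed.

(** When t is the L2 distance of u and v, the right-hand side is 2 C t: this is a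
    Lipschitz bound from L2 to the sup norm. *)
Lemma picard_sup K : Ltwo K -> exists2 C : R, 0 < C & forall u v (t x : R), {within I, continuous u} ->
  {within I, continuous v} -> 0 < t ->
  `|picard K u x - picard K v x| <= C * (t + t^-1 * J (fun x => (u x - v x) ^+ 2)).
Proof.
move=> K2; have [c c0 cP] := linsol_sup a b0.
have JK0 : 0 <= J (fun x => K x ^+ 2) by apply: J_ge0 => x _; exact: sqr_ge0.
exists (c * (1 + J (fun x => K x ^+ 2) + l ^+ 2)).
  by rewrite mulr_gt0// -addrA ltr_wpDr// addr_ge0// sqr_ge0.
move=> u v t x cu cv t0; rewrite /picard linsolBr//; try exact: NF.
apply: le_trans (cP _ _ t x K2 (LtwoB (NF cu) (NF cv)) t0) _.
rewrite -mulrA ler_pM2l//.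
have tV0 : 0 <= t^-1 by rewrite invr_ge0 ltW.
have d0 : 0 <= J (fun x => (u x - v x) ^+ 2) by apply: J_ge0 => y _; exact: sqr_ge0.
have L := ler_wpM2l tV0 (nemytskii_lipschitz hA cu cv).
have l2 := sqr_ge0 l.
have td : 0 <= t^-1 * J (fun x => (u x - v x) ^+ 2) by exact: mulr_ge0.
rewrite [t^-1 * (l ^+ 2 * _)]mulrCA in L.
apply: le_trans (lerD (lexx _) L) _.
move: (t^-1 * _) td => z z0; move: (l ^+ 2) l2 => L2 L20; move: (J _) JK0 => y y0.
have t0' := ltW t0; have := mulr_ge0 L20 t0'; have := mulr_ge0 y0 z0.
by nra.
Qed.

(** The iterates contract in the mean square with rate s; picard_sup upgrades this to
    uniform geometric convergence, so the limit is found among continuous functions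
    rather than in L2. *)
Lemma picard_fixed_point rho (s : R) K : admissible rho K -> 0 <= rho -> 0 < s < 1 ->
  rho * l ^+ 2 <= s ^+ 2 ->
  exists2 u : R -> R, continuous u & u = picard K u.
Proof.
move=> aK rho0 /andP[s0 s1] rs; have [cK _ _ _ _] := aK; have K2 := continuous_on_Ltwo cK.
have [C C0 CP] := picard_sup K2.
pose v := fix v n := if n is n'.+1 then picard K (v n') else fun=> 0.
have cv n : continuous (v n).
  elim: n => [|n IH]; first by move=> x; exact: cvg_cst.
  by apply: continuous_linsol => //; apply: NF; exact: continuous_subspaceT.
have cvI n : {within I, continuous (v n)} by exact: continuous_subspaceT.
(* J controls squares, hence the square of s ^ n below, while the choice
   t = s ^ n in the sup estimate keeps a rate s ^ n *)
pose d n := J (fun x => (v n.+1 x - v n x) ^+ 2).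
have dle n : d n <= (s ^+ n) ^+ 2 * d 0%N.
  elim: n => [|n IH]; first by rewrite expr0 expr1n mul1r.
  apply: le_trans (picard_contraction aK rho0 rs (cvI n.+1) (cvI n)) _.
  rewrite [s ^+ n.+1]exprS exprMn -[leRHS]mulrA; apply: (ler_wpM2l (sqr_ge0 s)); exact: IH.
have sn0 n : 0 < s ^+ n by rewrite exprn_gt0.
have step n x : `|v n.+2 x - v n.+1 x| <= C * (1 + d 0%N) * s ^+ n.
  apply: le_trans (CP _ _ (s ^+ n) x (cvI n.+1) (cvI n) (sn0 n)) _.
  rewrite -mulrA ler_pM2l// mulrDl mul1r lerD2l.
  rewrite -(ler_pM2l (sn0 n)) mulrA divff ?gt_eqF// mul1r; apply: le_trans (dle n) _.
  by rewrite mulrCA -expr2 mulrC.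
have s01 : 0 <= s < 1 by rewrite (ltW s0).
pose u x := limn (fun n => v n.+1 x).
pose M := C * (1 + d 0%N) / (1 - s).
have uv n x : `|u x - v n.+1 x| <= M * s ^+ n.
  have [L vL LP] := geometric_cvg s01 (fun n => step n x).
  have -> : u x = L by apply: (cvg_lim (@Rhausdorff R)) vL.
  exact: LP.
have M0 : 0 <= M by have := le_trans (normr_ge0 _) (uv 0%N 0); rewrite expr0 mulr1.
have cvs : s ^+ n @[n --> \oo] --> 0 by apply: cvg_expr; rewrite ger0_norm// ltW.
have cu : continuous u.
  apply: (@continuous_uniform_limit R (fun n => v n.+1)) => [n|e e0]; first exact: cv.
  have cM : M * s ^+ n @[n --> \oo] --> 0.
    by rewrite -[X in _ --> X](mulr0 M); apply: cvgM => //; exact: cvg_cst.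
  have [N _ NP] : \forall n \near \oo, M * s ^+ n <= e by exact: (cvgr_le _ cM _ e0).
  by exists N => x; apply: le_trans (uv N x) (NP N (leqnn N)).
have cuI : {within I, continuous u} by exact: continuous_subspaceT.
exists u => //; apply/funext => x; apply/eqP; rewrite -subr_eq0; apply/eqP.
(* u - picard u = (u - v n.+2) - (picard u - picard (v n.+1)), and both terms
   are of order s ^ n *)
pose Q := M + C * (1 + 2 * pi * M ^+ 2).
apply: (cvg_eq_small cvs (C := Q)); near=> n.
have Jn : J (fun y => (u y - v n.+1 y) ^+ 2) <= 2 * pi * (M * s ^+ n) ^+ 2.
  have u2 := LtwoB (continuous_on_Ltwo cuI) (continuous_on_Ltwo (cvI n.+1)).
  rewrite -J_cst; apply: (le_J u2.2 (L1_cst _)) => y _.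
  have Ms : 0 <= M * s ^+ n := mulr_ge0 M0 (ltW (sn0 n)).
  by rewrite -[leLHS]real_normK ?num_real// lerXn2r ?nnegrE.
have h1 := CP _ _ (s ^+ n) x cuI (cvI n.+1) (sn0 n).
have h2 : C * (s ^+ n + (s ^+ n)^-1 * J (fun y => (u y - v n.+1 y) ^+ 2)) <=
    C * (1 + 2 * pi * M ^+ 2) * s ^+ n.
  rewrite -mulrA ler_pM2l// mulrDl mul1r lerD2l.
  rewrite -(ler_pM2l (sn0 n)) mulrA divff ?gt_eqF// mul1r; apply: le_trans Jn _.
  by rewrite exprMn le_eqVlt; apply/orP; left; apply/eqP; ring.
have h3 := uv n.+1 x.
have h4 : M * s ^+ n.+1 <= M * s ^+ n.
  by rewrite exprS mulrCA; apply: ler_piMl; [exact: mulr_ge0 M0 (ltW (sn0 n))|exact: ltW s1].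
have -> : u x - picard K u x = (u x - v n.+2 x) - (picard K u x - v n.+2 x) by ring.
rewrite (le_trans (ler_normB _ _))// /Q mulrDl lerD//; first exact: le_trans h3 h4.
exact: le_trans h1 h2.
Unshelve. all: by end_near.
Qed.

(** The mean square distance is zero, and picard_sup with t tending to zero makes
    the images equal everywhere. *)
Lemma sqr_J_eq0 K (s : R) u v : Ltwo K -> s < 1 ->
  {within I, continuous u} -> {within I, continuous v} ->
  J (fun x => (u x - v x) ^+ 2) <= s * J (fun x => (u x - v x) ^+ 2) ->
  forall x, picard K u x = picard K v x.
Proof.
move=> K2 s1 cu cv; have [C C0 CP] := picard_sup K2.
have : 0 <= J (fun x => (u x - v x) ^+ 2) by apply: J_ge0 => y _; exact: sqr_ge0.
move E : (J _) => d d0 ds x; apply/eqP; rewrite -subr_eq0; apply/eqP.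
have dz : d = 0 by apply/eqP; rewrite eq_le d0 andbT; nra.
(* the sup estimate at t = 1 / (n + 1), for every n *)
apply: (cvg_eq_small (@cvg_harmonic R) (C := C)); near=> n.
have := CP u v n.+1%:R^-1 x cu cv; rewrite E dz mulr0 addr0; apply.
by rewrite invr_gt0 ltr0n.
Unshelve. all: by end_near.
Qed.

Lemma H4_continuous u : H4 u -> {within I, continuous u}.
Proof. by move=> u4; have [_ cu _ _ _] := H4_fourier 0 u4. Qed.

Lemma solution_picard K u : {within I, continuous K} -> K 0 = K (2 * pi) -> H4 u ->
  (a = 0 -> J u = 0) -> solution a b K F u -> forall x, I x -> u x = picard K u x.
Proof.
move=> cK K0 u4 u0 su; have N2 := NF (H4_continuous u4).
exact: (solution_linsol b0 cK K0 (Ltwo_L1 N2) N2 u4 u0 su).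
Qed.

Lemma fixed_point_solution rho K u : admissible rho K -> continuous u -> u = picard K u ->
  [/\ H4 u, a = 0 -> J u = 0 & solution a b K F u].
Proof.
move=> [cK K0p K0 _ _] cu uE; have K2 := continuous_on_Ltwo cK.
have N2 : Ltwo (nemytskii F u) by apply: NF; exact: continuous_subspaceT.
have [h4 _ _] := linsol_H4 a b0 K2 N2.
split.
- by rewrite uE.
- move=> a0; rewrite -fcn0 uE /picard.
  have [-> _] := linsol_fourier a b0 0 K2 N2.
  have S0 : sym_sqr a b 0 = 0.
    by rewrite /sym_sqr /sym_re /sym_im a0 mulr0n mulr0 expr0n/= subr0 expr0n/= addr0.
  by rewrite /uc /sol_c S0 invr0 mulr0.
- have eqn := linsol_equation b0 cK K0p N2 K0.
  by apply: aeW => x Ix; have := eqn x Ix; rewrite -/(picard K u) -uE.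
Qed.

Lemma fixed_point_unique rho (s : R) K u v : admissible rho K -> 0 <= rho -> s < 1 -> rho * l ^+ 2 <= s ->
  continuous u -> u = picard K u -> H4 v -> (a = 0 -> J v = 0) -> solution a b K F v ->
  forall x, I x -> v x = u x.
Proof.
move=> aK rho0 s1 rs cu uE v4 v0 sv x Ix; have [cK K0p _ _ _] := aK.
have vE := solution_picard cK K0p v4 v0 sv.
have cv := H4_continuous v4; have cuI : {within I, continuous u} := continuous_subspaceT cu.
rewrite vE// [in RHS]uE; apply: (sqr_J_eq0 (continuous_on_Ltwo cK) s1 cv cuI).
have := picard_contraction aK rho0 rs cv cuI; rewrite -uE; apply: le_trans.
rewrite le_eqVlt; apply/orP; left; apply/eqP; apply: eq_J => y /set_mem Iy.
by rewrite -vE.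
Qed.

(** For u = 0 the equation says that all products of the coefficients of K and of F(0, .)
    vanish. *)
Lemma nontrivial_solution K u (n : int) : {within I, continuous K} -> K 0 = K (2 * pi) ->
  H4 u -> solution a b K F u ->
  (fc K n%:~R ^+ 2 + fs K n%:~R ^+ 2) * (fc (F 0) n%:~R ^+ 2 + fs (F 0) n%:~R ^+ 2) != 0 ->
  exists2 x, I x & u x != 0.
Proof.
move=> cK K0p u4 su nz; apply: contrapT => /forall2NP u0.
have {}u0 x : I x -> u x = 0.
  by move=> Ix; have [//|/negP] := u0 x; rewrite negbK => /eqP.
have N2 := NF (H4_continuous u4).
have [e1 e2] := equation_fourier n cK K0p (Ltwo_L1 N2) u4 su.
have fcu : fc u n%:~R = 0.
  by rewrite -[RHS](mulr0 (2 * pi)) -J_cst; apply: eq_J => x /set_mem Ix; rewrite u0// mul0r.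
have fsu : fs u n%:~R = 0.
  by rewrite -[RHS](mulr0 (2 * pi)) -J_cst; apply: eq_J => x /set_mem Ix; rewrite u0// mul0r.
have fcN : fc (nemytskii F u) n%:~R = fc (F 0) n%:~R.
  by apply: eq_J => x /set_mem Ix; rewrite /nemytskii u0.
have fsN : fs (nemytskii F u) n%:~R = fs (F 0) n%:~R.
  by apply: eq_J => x /set_mem Ix; rewrite /nemytskii u0.
move: e1 e2; rewrite fcu fsu fcN fsN !mulr0 subr0 addr0 => e1 e2.
move/eqP: nz; apply.
transitivity ((fc K n%:~R * fc (F 0) n%:~R - fs K n%:~R * fs (F 0) n%:~R) ^+ 2 +
  (fs K n%:~R * fc (F 0) n%:~R + fc K n%:~R * fs (F 0) n%:~R) ^+ 2); first by ring.
by rewrite -e1 -e2 expr0n/= addr0.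
Qed.

End FixedPoint.

(** * Dependence of the solution on the kernel *)

Section Convergence.
Context {R : realType}.
Implicit Types (f g u v K L : R -> R) (c s : nat -> R).

Local Notation mu := (@completed_lebesgue_measure R).
Local Notation lR := (lebesgueTypeR R).
Local Notation I := (@I R).
Hint Resolve measurable_I two_pi_gt0 : core.

Lemma summable_coefsB c s c' s' : summable_coefs c s -> summable_coefs c' s' ->
  summable_coefs (fun n => c n - c' n) (fun n => s n - s' n).
Proof.
move=> [A AP] [B BP]; exists (A + B) => N; apply: le_trans (lerD (AP N) (BP N)).
rewrite /abs_sum -big_split/=; apply: ler_sum => n _.
have := ler_normB (c n) (c' n); have := ler_normB (s n) (s' n); lra.
Qed.

Variables (a b : R).
Hypotheses (b0 : b != 0).

Lemma linsol_derive4B K L f g : Ltwo K -> Ltwo L -> Ltwo f -> Ltwo g ->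
  derive1n 4 (linsol a b K f \- linsol a b L g) =
  derive1n 4 (linsol a b K f) \- derive1n 4 (linsol a b L g).
Proof.
move=> K2 L2 f2 g2.
have cK := linsol_summable a b0 K2 f2 (leq0n 4); have cL := linsol_summable a b0 L2 g2 (leq0n 4).
rewrite !pw0 in cK cL.
have [_ _ eK] := linsol_H4 a b0 K2 f2; have [_ _ eL] := linsol_H4 a b0 L2 g2.
have E : linsol a b K f \- linsol a b L g =
    fseries (fun n => uc a b K f n - uc a b L g n) (fun n => us a b K f n - us a b L g n).
  by apply/funext => x; rewrite fseriesB.
have pwB j p q : pw j (fun n => p n - q n) = fun n => pw j p n - pw j q n :> R.
  by apply/funext => n; rewrite /pw mulrBr.
have [|_ _ eKL] := @fseries_H4 R (fun n => uc a b K f n - uc a b L g n) (fun n => us a b K f n - us a b L g n).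
  by move=> j j4; rewrite !pwB; apply: summable_coefsB; exact: linsol_summable.
apply: (etrans (congr1 (derive1n 4) E)); apply: (etrans eKL).
apply: etrans (esym (congr2 (fun p r : R -> R => p \- r) eK eL)).
by apply/funext => x; rewrite !pwB fseriesB//; exact: linsol_summable.
Qed.

Lemma sub_add_sub (w p q U V W : R -> R) : w = U \- W -> p = U \- V -> q = V \- W ->
  w = fun x => p x + q x.
Proof. by move=> -> -> ->; apply/funext => x /=; rewrite addrA subrK. Qed.

(** The arithmetic of the stability estimate: w and w4 stand for the squared L2 norms of
    the difference and of its fourth derivative, x and x4 for the parts caused by the
    different sources, y and y4 for the parts caused by the different kernels. *)
Lemma stability_bound (q r e w x y w4 x4 y4 : R) : q < 1 -> 2 * r <= q -> 0 <= w ->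
  w <= 2 * x + 2 * y -> x <= r * w -> y <= e ->
  w4 <= 2 * x4 + 2 * y4 -> x4 <= r * w -> y4 <= e ->
  w + w4 <= (2 / (1 - q) + (2 / (1 - q) + 2)) * e.
Proof.
move=> q1 rq w0 wxy xw ye w4xy x4w y4e; have p1 : 0 < 1 - q by rewrite subr_gt0.
have rw : 2 * (r * w) <= q * w by rewrite mulrA; exact: ler_wpM2r.
have qw : q * w <= w by rewrite ler_piMl// ltW.
have we : w <= 2 / (1 - q) * e by rewrite mulrAC ler_pdivlMr//; lra.
rewrite mulrDl (mulrDl (2 / (1 - q))); lra.
Qed.

Lemma J_sqrD_le f g : Ltwo f -> Ltwo g ->
  J (fun x => (f x + g x) ^+ 2) <= 2 * J (fun x => f x ^+ 2) + 2 * J (fun x => g x ^+ 2).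
Proof.
move=> f2 g2; rewrite -(J_comb 2 2 f2.2 g2.2).
apply: (le_J (LtwoD f2 g2).2 (L1D (L1Z 2 f2.2) (L1Z 2 g2.2))) => x _.
by have := sqr_ge0 (f x - g x); rewrite !expr2; lra.
Qed.

Variables (F : R -> R -> R) (k l : R) (h : R -> R).
Hypotheses (hA : assumptionA F k l h).

Lemma fourier_le K (d : R) (n : nat) : L1 K -> (forall x, I x -> `|K x| <= d) ->
  fcn K n ^+ 2 + fsn K n ^+ 2 <= 2 * (2 * pi * d) ^+ 2.
Proof.
move=> K1 Kd.
have d0 : 0 <= d by apply: le_trans (normr_ge0 _) (Kd 0 _); rewrite /I /= in_itv/= lexx (ltW two_pi_gt0).
have D0 : 0 <= 2 * pi * d := mulr_ge0 (ltW two_pi_gt0) d0.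
have bound (phi : R -> R) : (forall x, `|phi x| <= 1) -> measurable_on_I (fun x => K x * phi x) ->
    `|J (fun x => K x * phi x)| <= 2 * pi * d.
  move=> phi1 m; rewrite -J_cst; apply: (J_norm_le m (L1_cst d)) => x Ix.
  by rewrite normrM -[d]mulr1 ler_pM// Kd.
have bc := bound _ (fun x => cos_max (n%:R * x)) (L1_measurable (L1_cos n%:R K1)).
have bs := bound _ (fun x => sin_max (n%:R * x)) (L1_measurable (L1_sin n%:R K1)).
rewrite -[fcn K n ^+ 2]real_normK ?num_real// -[fsn K n ^+ 2]real_normK ?num_real//.
have sq (x : R) : `|x| <= 2 * pi * d -> `|x| ^+ 2 <= (2 * pi * d) ^+ 2 by move=> xd; rewrite lerXn2r ?nnegrE.
have := sq _ bc; have := sq _ bs; rewrite /fcn /fsn /fc /fs; lra.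
Qed.

(** The coefficients of K - L are bounded by its sup norm, and the symbol is bounded
    below wherever these coefficients do not vanish. *)
Lemma admissible_small : exists2 c : R, 0 <= c & forall K L (d : R),
  {within I, continuous K} -> {within I, continuous L} -> K 0 = K (2 * pi) -> L 0 = L (2 * pi) ->
  (a = 0 -> J K = 0) -> (a = 0 -> J L = 0) -> (forall x, I x -> `|K x - L x| <= d) ->
  admissible a b (c * d ^+ 2) (fun x => K x - L x).
Proof.
have [q q1 qP] := sym_sqr_ge a b0.
exists (q * (2 * (2 * pi) ^+ 2)).
  by apply: mulr_ge0; [lra|apply: mulr_ge0; [lra|exact: sqr_ge0]].
move=> K L d cK cL K0p L0p K0 L0 KLd.
have cKL : {within I, continuous (fun x => K x - L x)}.
  by move=> x; apply: cvgB; [exact: cK|exact: cL].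
have KL1 := continuous_on_L1 cKL.
have z0 : a = 0 -> J (fun x => K x - L x) = 0.
  by move=> a0; rewrite JB ?K0 ?L0 ?subrr//; exact: continuous_on_L1.
have main n : (1 + n%:R ^+ 8) * (fcn (fun x => K x - L x) n ^+ 2 + fsn (fun x => K x - L x) n ^+ 2) <=
    q * (2 * (2 * pi) ^+ 2) * d ^+ 2 * sym_sqr a b n.
  have Fle := fourier_le n KL1 KLd.
  case: (qP n) => [S0|nq].
    have [n0 a0] := sym_sqr_eq0 b0 S0.
    have -> : fcn (fun x => K x - L x) n ^+ 2 + fsn (fun x => K x - L x) n ^+ 2 = 0.
      by rewrite n0 fsn0 fcn0 z0// expr0n/= addr0.
    by rewrite S0 !mulr0.
  have n8 : 0 <= 1 + n%:R ^+ 8 :> R by rewrite addr_ge0// exprn_ge0.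
  apply: le_trans (ler_wpM2l n8 Fle) _.
  have e0 : 0 <= 2 * (2 * pi * d) ^+ 2 by rewrite mulr_ge0// sqr_ge0.
  apply: le_trans (ler_wpM2r e0 nq) _.
  by rewrite le_eqVlt; apply/orP; left; apply/eqP; ring.
have S n : 0 <= fcn (fun x => K x - L x) n ^+ 2 + fsn (fun x => K x - L x) n ^+ 2.
  by rewrite addr_ge0 ?sqr_ge0.
have n8 n : 0 <= n%:R ^+ 8 :> R by rewrite exprn_ge0.
split => // [|n|n].
- by rewrite K0p L0p.
- by apply: le_trans (main n); rewrite ler_peMl// lerDl.
- by apply: le_trans (main n); rewrite -exprM ler_wpM2r// lerDr.
Qed.

Lemma H4norm_le (w : R -> R) (E : R) : Ltwo w -> Ltwo (derive1n 4 w) -> 0 <= E ->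
  J (fun x => w x ^+ 2) + J (fun x => derive1n 4 w x ^+ 2) <= E ^+ 2 -> H4norm w <= E.
Proof.
move=> w2 w42 E0 wE; rewrite /H4norm !L2norm_sqr//.
by rewrite -(sqr_sqrtr (sqr_ge0 E)) in wE; rewrite -[E]ger0_norm// -sqrtr_sqr ler_wsqrtr// -[E ^+ 2]sqr_sqrtr ?sqr_ge0.
Qed.

Lemma H4_Ltwo u : H4 u -> Ltwo u /\ Ltwo (derive1n 4 u).
Proof. by move=> [[/L2P ? /L2P ?] _ _ _ _]. Qed.

(** The difference of the two fixed points splits into the effect of the sources, which
    is absorbed because 2 rho l^2 < 1, and the effect of the kernels, which is
    proportional to d by admissible_small. The factor 2 comes from (x + y)^2 <= 2 x^2 + 2 y^2. *)
Lemma picard_stability rho (q : R) L v : admissible a b rho L -> 0 <= rho -> q < 1 ->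
  2 * (rho * l ^+ 2) <= q -> continuous v -> v = picard a b F L v ->
  exists2 E : R, 0 <= E & forall K u (d : R), admissible a b rho K -> continuous u ->
    u = picard a b F K u -> 0 <= d -> (forall x, I x -> `|K x - L x| <= d) ->
    H4norm (u \- v) <= E * d.
Proof.
move=> aL rho0 q1 rq cv vE; have [c c0 cP] := admissible_small.
have [cL L0p L0 _ _] := aL; have L2 := continuous_on_Ltwo cL.
have cvI : {within I, continuous v} := continuous_subspaceT cv.
have Nv := Ltwo_nemytskii hA cvI.
pose m := J (fun x => nemytskii F v x ^+ 2).
have m0 : 0 <= m by apply: J_ge0 => x _; exact: sqr_ge0.
have p1 : 0 < 1 - q by lra.
pose E2 := 2 * c * m / (1 - q) + (2 * c * m / (1 - q) + 2 * c * m).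
have cm0 : 0 <= 2 * c * m by rewrite !mulr_ge0.
have cmq : 0 <= 2 * c * m / (1 - q) by rewrite divr_ge0// ltW.
exists (Num.sqrt E2) => [|K u d aK cu uE d0 Kd]; first exact: sqrtr_ge0.
have [cK K0p K0 K1 K4] := aK; have K2 := continuous_on_Ltwo cK.
have cuI : {within I, continuous u} := continuous_subspaceT cu.
have Nu := Ltwo_nemytskii hA cuI.
have aKL := cP K L d cK cL K0p L0p K0 L0 Kd.
have [cKL _ _ KL1 KL4] := aKL; have KL2 := continuous_on_Ltwo cKL.
pose A := linsol a b K (fun y => nemytskii F u y - nemytskii F v y).
pose B := linsol a b (fun y => K y - L y) (nemytskii F v).
have NuNv := LtwoB Nu Nv.
have [A2 A42] := H4_Ltwo (let: And3 p _ _ := linsol_H4 a b0 K2 NuNv in p).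
have [B2 B42] := H4_Ltwo (let: And3 p _ _ := linsol_H4 a b0 KL2 Nv in p).
rewrite -/A -/B in A2 A42 B2 B42.
(* u - v = A + B, where A compares the sources and B compares the kernels *)
have AE : A = linsol a b K (nemytskii F u) \- linsol a b K (nemytskii F v).
  by apply/funext => x; rewrite /A -(linsolBr a b0 _ K2 Nu Nv).
have BE : B = linsol a b K (nemytskii F v) \- linsol a b L (nemytskii F v).
  by apply/funext => x; rewrite /B -(linsolBl a b0 _ K2 L2 Nv).
have uvE : u \- v = linsol a b K (nemytskii F u) \- linsol a b L (nemytskii F v).
  exact: (congr2 (fun p r : R -> R => p \- r) uE vE).
have wE : u \- v = fun x => A x + B x := sub_add_sub uvE AE BE.
have w4E : derive1n 4 (u \- v) = fun x => derive1n 4 A x + derive1n 4 B x.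
  have A4E := linsol_derive4B K2 K2 Nu Nv; rewrite -AE in A4E.
  have B4E := linsol_derive4B K2 L2 Nv Nv; rewrite -BE in B4E.
  have w4E := linsol_derive4B K2 L2 Nu Nv; rewrite -uvE in w4E.
  exact: (sub_add_sub w4E A4E B4E).
have cd0 : 0 <= c * d ^+ 2 by rewrite mulr_ge0// sqr_ge0.
pose w := J (fun x => (u x - v x) ^+ 2).
have w0 : 0 <= w by apply: J_ge0 => x _; exact: sqr_ge0.
have Nle : rho * J (fun x => (nemytskii F u x - nemytskii F v x) ^+ 2) <= rho * l ^+ 2 * w.
  by rewrite -mulrA; apply: (ler_wpM2l rho0); exact: (nemytskii_lipschitz hA cuI cvI).
have JA := le_trans (linsol_J b0 K2 NuNv rho0 K1) Nle.
have JA4 := le_trans (linsol_J4 b0 K2 NuNv rho0 K4) Nle.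
have JB := linsol_J b0 KL2 Nv cd0 KL1.
have JB4 := linsol_J4 b0 KL2 Nv cd0 KL4.
rewrite -/A -/B -/m in JA JA4 JB JB4.
have Jw : w <= 2 * J (fun x => A x ^+ 2) + 2 * J (fun x => B x ^+ 2).
  apply: le_trans (J_sqrD_le A2 B2); rewrite le_eqVlt; apply/orP; left; apply/eqP.
  exact: (congr1 (fun p : R -> R => J (fun x => p x ^+ 2)) wE).
have Jw4 : J (fun x => derive1n 4 (u \- v) x ^+ 2) <=
    2 * J (fun x => derive1n 4 A x ^+ 2) + 2 * J (fun x => derive1n 4 B x ^+ 2).
  by rewrite w4E; exact: J_sqrD_le.
have wle := stability_bound q1 rq w0 Jw JA JB Jw4 JA4 JB4.
apply: H4norm_le.
- by rewrite wE; exact: LtwoD.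
- by rewrite w4E; exact: LtwoD.
- by rewrite mulr_ge0// sqrtr_ge0.
rewrite exprMn sqr_sqrtr; last by rewrite !addr_ge0.
apply: le_trans wle _; rewrite /E2 le_eqVlt; apply/orP; left; apply/eqP; ring.
Qed.

End Convergence.

(** * The norm of the quotients as a bound on real coefficients *)

Section QuotientNorm.
Context {R : realType}.
Implicit Types (f g u v K : R -> R).

Local Notation mu := (@completed_lebesgue_measure R).
Local Notation lR := (lebesgueTypeR R).
Local Notation I := (@I R).
Local Notation normc := ComplexField.Normc.normc.
Hint Resolve measurable_I two_pi_gt0 : core.

Lemma normc_sqr (p q : R) : normc (p -i* q)%C ^+ 2 = p ^+ 2 + q ^+ 2.
Proof. by rewrite /normc/= sqrrN sqr_sqrtr// addr_ge0// sqr_ge0. Qed.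

Lemma normc_ge0 (z : R[i]) : 0 <= normc z.
Proof. by case: z => p q; exact: sqrtr_ge0. Qed.

Lemma normc_natX (n j : nat) : normc (n%:R ^+ j : R[i]) = n%:R ^+ j.
Proof.
have -> : (n%:R ^+ j : R[i]) = (((n%:R : R) ^+ j) -i* 0)%C.
  by rewrite -(rmorph_nat (real_complex R)) -rmorphXn /= /real_complex_def oppr0.
have e0 : 0 <= (n%:R : R) ^+ j by rewrite exprn_ge0.
by rewrite /normc/= oppr0 expr0n/= addr0 sqrtr_sqr ger0_norm.
Qed.

Lemma fourier_normc K (n : int) : L1 K ->
  normc (fourier K n) ^+ 2 = (fc K n%:~R ^+ 2 + fs K n%:~R ^+ 2) / (2 * pi).
Proof.
move=> K1; rewrite /fourier normc_sqr.
have E (phi : R -> R) : L1 (fun x => K x * phi x) ->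
    \int[mu]_(x in I) (K x * (phi x / Num.sqrt (2 * pi))) =
    (Num.sqrt (2 * pi))^-1 * J (fun x => K x * phi x).
  move=> K1'; rewrite -(JZ (Num.sqrt (2 * pi))^-1 K1').
  by apply: eq_J => x _; rewrite mulrA mulrC.
rewrite (E _ (L1_cos n%:~R K1)) (E _ (L1_sin n%:~R K1)) !exprMn exprVn.
by rewrite (sqr_sqrtr (ltW two_pi_gt0)) -mulrDr mulrC.
Qed.

Lemma linf_le (z : int -> R[i]) (c q l : R) n : 0 <= c -> 0 < l ->
  (c%:E * linf_norm z * l%:E <= q%:E)%E -> c * normc (z n) * l <= q.
Proof.
move=> c0 l0 zq; rewrite -lee_fin; apply: le_trans zq; rewrite !EFinM.
apply: lee_wpmul2r; first by rewrite lee_fin ltW.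
apply: lee_wpmul2l; first by rewrite lee_fin.
by apply: ereal_sup_ubound; exists n.
Qed.

Lemma calN_le (a b : R) K (c q l : R) : 0 <= c -> 0 < l ->
  (c%:E * calN a b K * l%:E <= q%:E)%E -> forall n : nat,
  c * (normc (fourier K n) / normc (symb a b n)) * l <= q /\
  c * (n%:R ^+ 4 * normc (fourier K n) / normc (symb a b n)) * l <= q.
Proof.
move=> c0 l0 Nq n.
have mono x : (x <= calN a b K)%E -> (c%:E * x * l%:E <= q%:E)%E.
  move=> xN; apply: le_trans Nq; apply: lee_wpmul2r; first by rewrite lee_fin ltW.
  by apply: lee_wpmul2l => //; rewrite lee_fin.
split.
  have : (linf_norm (fun n => fourier K n / symb a b n)%R <= calN a b K)%E by rewrite /calN le_max lexx.
  by move=> /mono /(linf_le n c0 l0); rewrite ComplexField.Normc.normcM ComplexField.Normc.normcV.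
have : (linf_norm (fun n => n%:~R ^+ 4 * fourier K n / symb a b n)%R <= calN a b K)%E.
  by rewrite /calN le_max lexx orbT.
move=> /mono /(linf_le n c0 l0).
have nE : normc (n%:~R ^+ 4 : R[i]) = n%:R ^+ 4 := normc_natX n 4.
by rewrite ComplexField.Normc.normcM ComplexField.Normc.normcV ComplexField.Normc.normcM nE.
Qed.

Lemma sqr_quotient_le (p s t l q c : R) : 0 <= p -> 0 < s -> 0 < l -> 0 <= q -> 0 <= t -> 0 <= c ->
  c * (t * p / s) * l <= q -> c ^+ 2 * l ^+ 2 * (t ^+ 2 * p ^+ 2) <= q ^+ 2 * s ^+ 2.
Proof.
move=> p0 s0 l0 q0 t0 c0 pq.
have x0 : 0 <= c * (t * p / s) * l.
  by apply: mulr_ge0 (ltW l0); apply: mulr_ge0 => //; apply: divr_ge0 (ltW s0); exact: mulr_ge0.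
have : (c * (t * p / s) * l) ^+ 2 <= q ^+ 2 by rewrite lerXn2r ?nnegrE.
have s20 : 0 < s ^+ 2 by rewrite exprn_gt0.
move=> /(ler_wpM2r (ltW s20)); apply: le_trans; rewrite le_eqVlt; apply/orP; left; apply/eqP.
by field; rewrite gt_eqF.
Qed.

Variables (a b l q : R).
Hypotheses (b0 : b != 0) (l0 : 0 < l) (q0 : 0 <= q).

(** Squaring the hypothesis turns 2 sqrt pi times the factor 1 / sqrt (2 pi) of the
    normalised coefficients into the constant 2. *)
Lemma admissible_calN K : {within I, continuous K} -> K 0 = K (2 * pi) -> (a = 0 -> J K = 0) ->
  ((2 * Num.sqrt pi)%:E * calN a b K * l%:E <= q%:E)%E ->
  admissible a b (q ^+ 2 / (2 * l ^+ 2)) K.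
Proof.
move=> cK K0p K0 Nq; have K1 := continuous_on_L1 cK.
have c0 : 0 <= 2 * Num.sqrt pi :> R by rewrite mulr_ge0// sqrtr_ge0.
have l20 : 0 < 2 * l ^+ 2 by rewrite mulr_gt0// exprn_gt0.
have main (t : R) (n : nat) : 0 <= t -> 2 * Num.sqrt pi * (t * normc (fourier K n) / normc (symb a b n)) * l <= q ->
    t ^+ 2 * (fcn K n ^+ 2 + fsn K n ^+ 2) <= q ^+ 2 / (2 * l ^+ 2) * sym_sqr a b n.
  move=> t0 nq; have [S0|S0] := eqVneq (sym_sqr a b n) 0.
    have [n0 a0] := sym_sqr_eq0 b0 S0.
    by rewrite S0 n0 fsn0 fcn0 K0// expr0n/= addr0 !mulr0.
  have symE : normc (symb a b n) ^+ 2 = sym_sqr a b n by rewrite normc_sqr.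
  have s0 : 0 < normc (symb a b n).
    by rewrite lt_def normc_ge0 andbT -sqrf_eq0 symE.
  have := sqr_quotient_le (normc_ge0 _) s0 l0 q0 t0 c0 nq.
  rewrite symE (fourier_normc n K1) exprMn sqr_sqrtr ?pi_ge0// => main.
  rewrite [leRHS]mulrAC ler_pdivlMr//; apply: le_trans main.
  rewrite le_eqVlt; apply/orP; left; apply/eqP; rewrite /fcn /fsn.
  have pi0 : pi != 0 :> R by rewrite gt_eqF ?pi_gt0.
  by move: pi0; generalize (@pi R) => p p0; field.
have N n := calN_le c0 l0 Nq n.
split => [||//|n|n].
- exact: cK.
- exact: K0p.
- have [N1 _] := N n; have := @main 1 n ler01; rewrite expr1n !mul1r; exact.
- have [_ N4] := N n; apply: main; [by rewrite exprn_ge0|exact: N4].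
Qed.

End QuotientNorm.

(** * Uniform limits of kernels *)

Section Limit.
Context {R : realType}.
Implicit Types (f g u v K : R -> R).

Local Notation mu := (@completed_lebesgue_measure R).
Local Notation I := (@I R).
Local Notation normc := ComplexField.Normc.normc.
Hint Resolve measurable_I two_pi_gt0 : core.

Lemma fourier_neq0 K (n : int) : L1 K -> fourier K n != 0 ->
  fc K n%:~R ^+ 2 + fs K n%:~R ^+ 2 != 0.
Proof.
move=> K1; apply: contra_neq => K0; apply: ComplexField.Normc.eq0_normc; apply/eqP.
by rewrite -sqrf_eq0 (fourier_normc n K1) K0 mul0r.
Qed.

Variables (G_ : nat -> R -> R) (G : R -> R).
Hypotheses (cG_ : forall m, {within I, continuous (G_ m)}) (cG : {within I, continuous G}).
Hypothesis G_G : {uniform I, G_ m @[m --> \oo] --> G}.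

Lemma uniform_near (e : R) : 0 < e -> \forall m \near \oo, forall x, I x -> `|G_ m x - G x| <= e.
Proof.
move=> e0; apply: (G_G (_ : nbhs _ [set f | forall x, I x -> `|f x - G x| <= e])).
apply/uniform_nbhs; exists [set p | ball p.1 e p.2]; split; first exact: (entourage_ball _ (PosNum e0)).
by move=> f fG x /fG /=; rewrite distrC => /ltW.
Qed.

Lemma cvg_fourier n : fcn (G_ m) n @[m --> \oo] --> fcn G n /\ fsn (G_ m) n @[m --> \oo] --> fsn G n.
Proof.
have sq (x d : R) : 0 <= d -> x ^+ 2 <= 2 * (2 * pi * d) ^+ 2 -> `|x| <= 4 * pi * d.
  move=> d0 xd; have p0 : 0 <= 4 * pi * d by rewrite !mulr_ge0// pi_ge0.
  rewrite -ler_sqr ?nnegrE// real_normK ?num_real//; apply: le_trans xd _.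
  have := sqr_ge0 (2 * pi * d); rewrite !expr2; lra.
have near (e : R) : 0 < e -> \forall m \near \oo,
    `|fcn G n - fcn (G_ m) n| <= e /\ `|fsn G n - fsn (G_ m) n| <= e.
  move=> e0; pose d := e / (4 * pi).
  have p0 : 0 < 4 * pi :> R by rewrite mulr_gt0// pi_gt0.
  have d0 : 0 < d by rewrite divr_gt0.
  have de : 4 * pi * d = e by rewrite /d mulrC divfK// gt_eqF.
  apply: filterS (uniform_near d0) => m md.
  have m1 := continuous_on_L1 (@cG_ m); have G1 := continuous_on_L1 cG.
  have := fourier_le n (L1B m1 G1) md; rewrite (fcnB n m1 G1) (fsnB n m1 G1) => le2.
  rewrite (distrC (fcn G n)) (distrC (fsn G n)) -de; split; apply: (sq _ _ (ltW d0)); apply: le_trans le2.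
    by rewrite lerDl sqr_ge0.
  by rewrite lerDr sqr_ge0.
by split; apply/cvgrPdist_le => e e0; apply: filterS (near e e0) => m [].
Qed.

(** Each condition is closed under uniform convergence of the kernels. *)
Lemma admissible_limit (a b rho : R) : (forall m, admissible a b rho (G_ m)) -> admissible a b rho G.
Proof.
move=> aG; have pt x : I x -> G_ m x @[m --> \oo] --> G x.
  move=> Ix; apply/cvgrPdist_le => e e0; apply: filterS (uniform_near e0) => m.
  by move=> /(_ x Ix); rewrite distrC.
have sqr n : fcn (G_ m) n ^+ 2 + fsn (G_ m) n ^+ 2 @[m --> \oo] --> fcn G n ^+ 2 + fsn G n ^+ 2.
  have [c s] := cvg_fourier n; rewrite !expr2; under eq_fun do rewrite !expr2.
  by apply: cvgD; apply: cvgM.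
split=> [||a0|n|n].
- exact: cG.
- have i0 : I 0 by rewrite /I /= in_itv/= lexx (ltW two_pi_gt0).
  have i1 : I (2 * pi) by rewrite /I /= in_itv/= lexx (ltW two_pi_gt0).
  have h0 := pt _ i0; have h1 := pt _ i1.
  apply: (cvg_unique _ h0) => //; apply: cvg_trans h1; apply: near_eq_cvg.
  by near=> m; have [_ -> _ _ _] := aG m.
- have [c _] := cvg_fourier 0; rewrite -fcn0.
  apply: (cvg_unique _ c) => //.
  have -> : (fun m => fcn (G_ m) 0) = fun=> 0.
    by apply/funext => m; rewrite fcn0; have [_ _ h _ _] := aG m; exact: h.
  exact: cvg_cst.
- apply: (cvgr_to_le (sqr n)); apply: nearW => m; by have [_ _ _ h _] := aG m; exact: h.
- have sqr4 : (n%:R ^+ 4) ^+ 2 * (fcn (G_ m) n ^+ 2 + fsn (G_ m) n ^+ 2) @[m --> \oo] -->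
      (n%:R ^+ 4) ^+ 2 * (fcn G n ^+ 2 + fsn G n ^+ 2) by apply: cvgM (sqr n); exact: cvg_cst.
  by apply: (cvgr_to_le sqr4); apply: nearW => m; have [_ _ _ _ h] := aG m; exact: h.
Unshelve. all: by end_near. Qed.

End Limit.

(** * Solvability and convergence *)

Section Solvability.
Context {R : realType}.
Local Notation mu := (@completed_lebesgue_measure R).
Local Notation I := (@I R).
Hint Resolve measurable_I two_pi_gt0 : core.

Variables (a b : R) (F : R -> R -> R) (k l : R) (h : R -> R) (q : R).
Hypotheses (b0 : b != 0) (hA : assumptionA F k l h) (q01 : 0 < q < 1).
Variables (G_ : nat -> R -> R) (G : R -> R) (V : (R -> R) -> Prop).
Hypothesis VE : forall u, V u <-> H4 u /\ (a = 0 -> J u = 0).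

(** With rho = q^2 / (2 l^2) one has rho l^2 = q^2 / 2. The factor 1 / 2 is consumed
    by the stability estimate.
    The condition a = 0 -> J u = 0 treats the spaces H4 and H4_0 together. *)
Lemma solvable_and_convergent_admissible :
  (forall m, admissible a b (q ^+ 2 / (2 * l ^+ 2)) (G_ m)) -> {within I, continuous G} ->
  {uniform I, G_ m @[m --> \oo] --> G} -> solvable_and_convergent V a b G_ G F.
Proof.
set rho := q ^+ 2 / _ => aG_ cG GG; have [q0 q1] := andP q01.
have cG_ m : {within I, continuous (G_ m)} by have [c _ _ _ _] := aG_ m; exact: c.
have aG := admissible_limit cG_ cG GG aG_.
have l0 : 0 < l by case: hA => _ [].
have l20 : 0 < l ^+ 2 by rewrite exprn_gt0.
have rho0 : 0 <= rho by apply: divr_ge0; [exact: sqr_ge0|exact: mulr_ge0 (ltW l20)].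
have q20 : 0 <= q ^+ 2 by exact: sqr_ge0.
have rhoE : 2 * (rho * l ^+ 2) = q ^+ 2 by rewrite /rho; field; rewrite gt_eqF.
have rhol : rho * l ^+ 2 <= q ^+ 2 by lra.
have q21 : q ^+ 2 < 1 by rewrite expr_lt1// ltW.
have ex K : admissible a b rho K -> exists u : R -> R, continuous u /\ u = picard a b F K u.
  by move=> aK; have [u cu uE] := picard_fixed_point b0 hA aK rho0 q01 rhol; exists u.
have [u_ u_P] := choice (fun m => ex _ (aG_ m)).
have [u [cu uE]] := ex _ aG.
have uniq K (v : R -> R) : admissible a b rho K -> continuous v -> v = picard a b F K v ->
    unique_in V (solution a b K F) v.
  move=> aK cv vE; have [v4 v0 sv] := fixed_point_solution b0 hA aK cv vE.
  split=> [||w /VE[w4 w0] sw]; [exact/VE|exact: sv|].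
  exact: (fixed_point_unique b0 hA aK rho0 q21 rhol cv vE w4 w0 sw).
have nontriv K (v : R -> R) : admissible a b rho K -> continuous v -> v = picard a b F K v ->
    (exists n, fourier K n * fourier (F 0) n != 0) -> exists2 x, I x & v x != 0.
  move=> aK cv vE [n]; rewrite mulf_eq0 negb_or => /andP[Kn Fn].
  have [v4 v0 sv] := fixed_point_solution b0 hA aK cv vE; have [cK K0p _ _ _] := aK.
  apply: (nontrivial_solution hA (n := n) cK K0p v4 sv); apply: mulf_neq0.
    exact: fourier_neq0 (continuous_on_L1 cK) Kn.
  have c0 : {within I, continuous (fun=> 0 : R)} by apply: continuous_subspaceT; exact: cst_continuous.
  exact: fourier_neq0 (Ltwo_L1 (Ltwo_nemytskii hA c0)) Fn.
exists u_, u; split.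
- split=> [m|]; last exact: uniq.
  by have [c e] := u_P m; exact: uniq.
- have rq : 2 * (rho * l ^+ 2) <= q ^+ 2 by rewrite rhoE.
  have [E E0 EP] := picard_stability b0 hA aG rho0 q21 rq cu uE.
  apply/cvgrPdist_le => e e0; pose d := e / (E + 1).
  have E1 : 0 < E + 1 by rewrite ltr_wpDl.
  have d0 : 0 < d by rewrite divr_gt0.
  apply: filterS (uniform_near GG d0) => m md; have [c f] := u_P m.
  rewrite sub0r normrN ger0_norm; last exact: sqrtr_ge0.
  apply: le_trans (EP _ _ _ (aG_ m) c f (ltW d0) md) _.
  by rewrite /d mulrCA ger_pMr// ler_pdivrMr// mul1r lerDl.
- by move=> m; have [c e] := u_P m; exact: nontriv.
- exact: nontriv.
Qed.

End Solvability.
Theorem theorem4 (R : realType) (a b : R) (Gm : nat -> R -> R) (G : R -> R)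
    (F : R -> R -> R) (k l : R) (h : R -> R) (eps : R)
    (ha : 0 <= a) (hb : b != 0)
    (hGm : forall m, {within @I R, continuous (Gm m)})
    (hGmper : forall m, Gm m 0 = Gm m (2 * pi))
    (hG : {within @I R, continuous G})
    (hGmG : {uniform @I R, Gm m @[m --> \oo] --> G})
    (hA : assumptionA F k l h)
    (hFper : forall u, F u 0 = F u (2 * pi))
    (heps : 0 < eps < 1)
    (hN : forall m,
       ((2 * Num.sqrt pi)%:E * calN a b (Gm m) * l%:E <= (1 - eps)%:E)%E) :
  (0 < a -> solvable_and_convergent H4 a b Gm G F) /\
  (a = 0 ->
   (forall m, \int[completed_lebesgue_measure]_(x in @I R) Gm m x = 0) ->
   solvable_and_convergent H4_0 0 b Gm G F).
Proof.
have [e0 e1] := andP heps; have q01 : 0 < 1 - eps < 1 by apply/andP; split; lra.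
have l0 : 0 < l by case: hA => _ [].
have q0 : 0 <= 1 - eps by rewrite ltW//; case/andP: q01.
split=> [a0|a0 hJ].
  have an0 : a <> 0 by move=> a00; rewrite a00 ltxx in a0.
  apply: (solvable_and_convergent_admissible hb hA q01) => [u|m||]; last 2 first.
  - exact: hG.
  - exact: hGmG.
  - by split=> [u4|[]//]; split=> // /an0.
  - by apply: (admissible_calN hb l0 q0 (hGm m) (hGmper m) _ (hN m)) => /an0.
rewrite a0 in hN; apply: (solvable_and_convergent_admissible hb hA q01) => [u|m||]; last 2 first.
- exact: hG.
- exact: hGmG.
- by split=> -[u4 u0]; split=> //; exact: u0.
- by apply: (admissible_calN hb l0 q0 (hGm m) (hGmper m) _ (hN m)) => _; exact: hJ.
Qed.
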